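(* The billiard ball map inside an ellipsoid in pseudo-Euclidean space, acting on the contact space of oriented light-like lines, is a completely integrable contact transformation. More precisely, let $V=\mathbb R^{p,q}$, $p+q=n+1$, let $M_0^{2n-1}$ be the contact space of oriented light-like lines in $V$, let $\mathcal F$ be the foliation of $M_0$ whose leaves consist of the null lines tangent to $n-1$ fixed quadrics of the pseudo-confocal family of the ellipsoid, and let $T$ be the billiard ball map on oriented light-like lines intersecting the ellipsoid. Then $\mathcal F$ is co-Legendrian, there is a contact form on $M_0$ (on the set of oriented null lines entering the ellipsoid) which is invariant under $T$ and whose Reeb field is tangent to $\mathcal F$, and $T$ is a contact completely integrable system with respect to $\mathcal F$ and the transverse measure of the associated Legendrian foliation defined by this contact form.
   Context: All statements are on the (open) set of lines where the objects in question are defined and smooth: the billiard reflection is undefined at points where the normal to the ellipsoid is tangent to it, and the $n-1$ tangent pseudo-confocal quadrics are assumed to define a foliation. Contact integrability. An $n$-dimensional foliation $\mathcal F$ on a contact manifold $(M^{2n-1},\xi)$ is co-Legendrian if it is transverse to $\xi$ and $T\mathcal F\cap\xi$ is integrable; the resulting $(n-1)$-dimensional foliation $\mathcal G$ is the associated Legendrian foliation. The contact manifold with $\mathcal F$ is completely integrable if on each leaf $F$ of $\mathcal F$ the foliation $\mathcal G$ has a holonomy invariant transverse smooth measure (a nowhere zero 1-form $\alpha_F$ on $F$ with kernel $T\mathcal G$ and $i_u\alpha_F=L_u\alpha_F=0$ for $u$ tangent to $\mathcal G$). If the Reeb field ($i_vd\lambda=0,\lambda(v)=1$) of a contact form $\lambda$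 is tangent to $\mathcal F$, the restriction of $\lambda$ to the leaves is such a measure. A discrete-time contact completely integrable system is a contactomorphism that preserves $\mathcal F$ leaf-wise and preserves the transverse measure of $\mathcal G$. Pseudo-Euclidean setting. $V=\mathbb R^{p,q}$ has the metric $\langle x,x\rangle=E(x)\cdot x$, $E=\mathrm{diag}(1,\dots,1,-1,\dots,-1)$ ($p$ pluses, $q$ minuses). The ellipsoid is $A(x)\cdot x=1$ with $A=\mathrm{diag}(a_1^{-2},\dots,a_{n+1}^{-2})$. The pseudo-confocal family is $$\frac{x_1^2}{a_1^2+\mu}+\dots+\frac{x_p^2}{a_p^2+\mu}+\frac{x_{p+1}^2}{a_{p+1}^2-\mu}+\dots+\frac{x_{p+q}^2}{a_{p+q}^2-\mu}=1,\qquad \mu\in\mathbb R.$$ A light-like (null) line is one whose direction $v$ satisfies $\langle v,v\rangle=0$. The space $P^{2n}$ of scaled oriented null lines is the symplectic reduction of $T^*V$ on the zero energy level $\{(x,p):|p|^2=0,\ p\ne0\}$ (quotient by the characteristics of the restricted symplectic form); scaling of $p$ makes $P$ a bundle over the space $M_0^{2n-1}$ of oriented null lines, and $M_0$ is the contact manifold whose symplectization is $P$. The billiard ball map $T$ takes the oriented line of the incoming trajectory to that of the outgoing one after elastic reflection in the ellipsoid: the component of the velocity tangent to the ellipsoid is preserved and the normal (with respect to the metric) component changes sign. $T$ preserves the type of a line. A generic null line that is part of a billiard trajectory inside the ellipsoid is tangent to $n-1$ quadrics of the pseudo-confocal family, and $T$ preserves these quadrics. *)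

(* Defs.v *)
From HB Require Import structures.
From mathcomp Require Import all_boot all_order all_algebra.
From mathcomp Require Import all_classical all_reals all_analysis.
Set Implicit Arguments.
Unset Strict Implicit.
Unset Printing Implicit Defensive.
Import Order.TTheory GRing.Theory Num.Theory.
Import numFieldNormedType.Exports.
Local Open Scope classical_set_scope.
Local Open Scope ring_scope.

(** * Differential geometry on a submanifold of a vector space

    A manifold is given as a submanifold [M] of a finite-dimensional space [E],
    through its tangent spaces [TM : E -> set E].  Functions, maps, vector
    fields and forms on a subset [S] of [M] are restrictions of ones that are
    smooth on an open subset of [E] containing [S]; every notion below depends
    only on these restrictions. *)

Section Smooth.
Variables (R : realType) (E F : normedModType R).

(* [C^k] on [O], for finite-dimensional [E]. *)
Fixpoint Ck (k : nat) (O : set E) (f : E -> F) : Prop :=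
  match k with
  | 0 => forall x, O x -> {for x, continuous f}
  | k'.+1 => (forall x, O x -> differentiable f x) /\
             (forall w, Ck k' O (fun x => 'd f x w))
  end.

Definition smooth (O : set E) (f : E -> F) : Prop :=
  open O /\ forall k, Ck k O f.

End Smooth.

Section Geometry.
Variables (R : realType) (E : normedModType R).
Implicit Types (TM D : E -> set E) (S U : set E) (f : E -> E).

Definition one_form (O : set E) (alpha : E -> E -> R) : Prop :=
  [/\ open O,
      forall x, O x -> scalar (alpha x) &
      forall w, smooth O (fun x => alpha x w)].

Definition ext_d (alpha : E -> E -> R) (x w1 w2 : E) : R :=
  'd (fun z => alpha z w2 : R^o) x w1 - 'd (fun z => alpha z w1 : R^o) x w2.

(* [L_u alpha] in the linear coordinates of [E]:
   [(L_u alpha)_j = u_i d_i alpha_j + alpha_i d_j u_i]. *)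
Definition lie_d (u : E -> E) (alpha : E -> E -> R) (x w : E) : R :=
  'd (fun z => alpha z w : R^o) x (u x) + alpha x ('d u x w).

Definition submersion_at TM k (h : 'I_k -> E -> R) (x : E) : Prop :=
  forall y : 'I_k -> R,
    exists2 w, TM x w & forall i, 'd (h i : E -> R^o) x w = y i.

(* [D] is an integrable distribution of codimension [k] on the open subset [S]
   of [M], i.e. the tangent distribution of a foliation: near each point its
   leaves are the level sets of a submersion to [R^k]. *)
Definition integrable_dist TM S (k : nat) D : Prop :=
  forall x, S x -> exists (O : set E) (h : 'I_k -> E -> R),
    [/\ open O, O x,
        forall i, smooth O (h i : E -> R^o) &
        forall z, O z -> S z -> submersion_at TM h z /\
          forall w, D z w <->
            (TM z w /\ forall i, 'd (h i : E -> R^o) z w = 0)].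

Definition transverse_dist TM S D D' : Prop :=
  forall x, S x -> forall w, TM x w ->
    exists w1 w2, [/\ D x w1, D' x w2 & w = w1 + w2].

Definition capD D D' : E -> set E := fun x => D x `&` D' x.

(* On a [(2n-1)]-dimensional [M], for a foliation [F] of dimension [n]
   (codimension [n-1]) with tangent distribution [TF]; the associated
   foliation has dimension [n-1], hence codimension [n]. *)
Definition co_legendrian TM (xi : E -> set E) (n : nat) S TF : Prop :=
  [/\ integrable_dist TM S n.-1 TF,
      transverse_dist TM S TF xi &
      integrable_dist TM S n (capD TF xi)].

(* [alpha] is a contact form of the contact structure [xi] on [S]. *)
Definition contact_form TM (xi : E -> set E) S (alpha : E -> E -> R) : Prop :=
  exists O : set E, [/\ S `<=` O, one_form O alpha &
    forall x, S x ->
      [/\ exists2 w, TM x w & alpha x w != 0,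
          forall w, xi x w <-> (TM x w /\ alpha x w = 0) &
          forall w, xi x w ->
            (forall w', xi x w' -> ext_d alpha x w w' = 0) -> w = 0]].

(* For a contact form these conditions determine [v] on [S]. *)
Definition reeb_field TM S (alpha : E -> E -> R) (v : E -> E) : Prop :=
  forall x, S x ->
    [/\ TM x (v x), alpha x (v x) = 1 &
        forall w, TM x w -> ext_d alpha x (v x) w = 0].

(* The restrictions of [alpha] to the leaves of [F] form a holonomy invariant
   transverse measure of the foliation [G].  The equation [i_u alpha = 0] for
   [u] tangent to [G] is part of the kernel condition. *)
Definition transverse_measure S TF TG (alpha : E -> E -> R) : Prop :=
  (exists2 O : set E, S `<=` O & one_form O alpha) /\
  forall x, S x ->
    [/\ exists2 w, TF x w & alpha x w != 0,
        forall w, TG x w <-> (TF x w /\ alpha x w = 0) &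
        forall (O : set E) (u : E -> E), O x -> smooth O u ->
          (forall z, O z -> S z -> TG z (u z)) ->
          forall w, TF x w -> lie_d u alpha x w = 0].

Definition completely_integrable TM xi n S TF alpha : Prop :=
  co_legendrian TM xi n S TF /\
  transverse_measure S TF (capD TF xi) alpha.

(* [f] is a contactomorphism from the open subset [U] of [M] onto an open
   subset of [M]. *)
Definition contactomorphism (M : set E) TM (xi : E -> set E) U f : Prop :=
  (exists2 O, U = M `&` O & smooth O f) /\
  (exists O g, [/\ f @` U = M `&` O, smooth O g &
                   forall x, U x -> g (f x) = x]) /\
  (forall x, U x -> forall w, TM x w ->
     TM (f x) ('d f x w) /\ (xi x w <-> xi (f x) ('d f x w))).

Definition preserves_form TM U f (alpha : E -> E -> R) : Prop :=
  forall x, U x -> forall w, TM x w -> alpha (f x) ('d f x w) = alpha x w.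

(* [f] is defined on [U], the foliation [F] (with the given [leaves]) on [S]:
   its invariance is meaningful at points of [S] sent to [S]. *)
Definition contact_ci_system (M : set E) TM xi n U f S
    (leaves : set (set E)) TF (alpha : E -> E -> R) : Prop :=
  [/\ contactomorphism M TM xi U f,
      completely_integrable TM xi n S TF alpha,
      forall L, leaves L -> forall x, L x -> U x -> S x -> S (f x) -> L (f x) &
      forall x, U x -> S x -> S (f x) -> forall w, TF x w ->
        TF (f x) ('d f x w) /\ alpha (f x) ('d f x w) = alpha x w].

End Geometry.

(** * Pseudo-Euclidean billiards *)

Section Billiard.
Variables (R : realType) (m : nat).
Local Notation V := 'rV[R]_m.

Definition dot (x y : V) : R := \sum_i x 0 i * y 0 i.

Definition sgn (p : nat) (i : 'I_m) : R := if (i < p)%N then 1 else -1.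

Definition Emap (p : nat) (x : V) : V := \row_i (sgn p i * x 0 i).

Definition pdot (p : nat) (x y : V) : R := dot (Emap p x) y.

Definition Amap (a : 'I_m -> R) (x : V) : V := \row_i (x 0 i / a i ^+ 2).

(* The quadric [Q_mu] of the pseudo-confocal family is [Bmap mu x . x = 1];
   it is defined when no denominator vanishes. *)
Definition Bmap p (a : 'I_m -> R) (mu : R) (x : V) : V :=
  \row_i (x 0 i / (a i ^+ 2 + sgn p i * mu)).

Definition admissible p (a : 'I_m -> R) (mu : R) : Prop :=
  forall i, a i ^+ 2 + sgn p i * mu != 0.

(** An oriented line has a unique parametrization [x + t u] with [u . u = 1]
    and [x . u = 0] (Euclidean products); this identifies the space of oriented
    lines with a submanifold of [V * V] diffeomorphic to the tangent bundle of
    the sphere.  The null lines are cut out by one more equation, and the three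
    equations are independent along [nullLines].  [oline y v] is the oriented
    line through [y] with direction [v]. *)
Definition oline (y v : V) : V * V :=
  let u := (Num.sqrt (dot v v))^-1 *: v in (y - dot y u *: u, u).

Definition nullLines p : set (V * V) :=
  [set l | [/\ dot l.2 l.2 = 1, dot l.1 l.2 = 0 & pdot p l.2 l.2 = 0]].

Definition tgNull p (l : V * V) : set (V * V) :=
  [set w | [/\ 'd (fun z : V * V => dot z.2 z.2 : R^o) l w = 0,
               'd (fun z : V * V => dot z.1 z.2 : R^o) l w = 0 &
               'd (fun z : V * V => pdot p z.2 z.2 : R^o) l w = 0]].

(* The null covector at [x] corresponding to the line [(x, u)] is [E u], up to
   a positive factor.  On null covectors, the Liouville form [p . dx] vanishes
   on the characteristics and on the Euler field, and is multiplied by [c] when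
   [p] is; its kernel [E u . dx = 0] therefore descends to the space of oriented
   null lines, and this is the contact structure whose symplectization is the
   space of scaled oriented null lines. *)
Definition contactNull p (l : V * V) : set (V * V) :=
  [set w | tgNull p l w /\ pdot p l.2 w.1 = 0].

(* Null lines entering the ellipsoid [A x . x = 1]. *)
Definition entering p a : set (V * V) :=
  [set l | nullLines p l /\
     exists t, let y := l.1 + t *: l.2 in dot (Amap a y) y < 1].

Definition tangent_to p a (l : V * V) (mu : R) : Prop :=
  admissible p a mu /\
  exists t, let y := l.1 + t *: l.2 in
    dot (Bmap p a mu y) y = 1 /\ dot (Bmap p a mu y) l.2 = 0.

(* The [k] quadrics tangent to a null line near [l] form smooth independent
   functions [mu_i]. *)
Definition confocal_chart p a k (O : set (V * V)) (mu : 'I_k -> V * V -> R)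
    : Prop :=
  [/\ open O,
      forall i, smooth O (mu i : V * V -> R^o) &
      forall l, O l -> nullLines p l ->
        [/\ injective (fun i => mu i l),
            forall s, tangent_to p a l s <-> exists i, s = mu i l &
            submersion_at (tgNull p) mu l]].

(* The set of null lines near which the [k] tangent quadrics define a
   foliation, the leaves of this foliation and their tangent spaces. *)
Definition foliated p a (k : nat) : set (V * V) :=
  [set l | nullLines p l /\
     exists O (mu : 'I_k -> V * V -> R), O l /\ confocal_chart p a O mu].

Definition leavesF p a (k : nat) : set (set (V * V)) :=
  [set L | exists2 c : 'I_k -> R, injective c &
     L = [set l | foliated p a k l /\ forall i, tangent_to p a l (c i)]].

Definition tgF p a (k : nat) (l : V * V) : set (V * V) :=
  [set w | tgNull p l w /\
     exists O (mu : 'I_k -> V * V -> R),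
       [/\ O l, confocal_chart p a O mu &
           forall i, 'd (mu i : V * V -> R^o) l w = 0]].

(* The larger root [t] of [A (x + t u) . (x + t u) = 1]. *)
Definition exit_time a (l : V * V) : R :=
  let: (x, u) := l in
  let b := dot (Amap a x) u in
  (- b + Num.sqrt (b ^+ 2 - dot (Amap a u) u * (dot (Amap a x) x - 1)))
    / dot (Amap a u) u.

Definition exit_point a (l : V * V) : V := l.1 + exit_time a l *: l.2.

(* The metric normal to the ellipsoid at [y] is [E (A y)]. *)
Definition normal p a (y : V) : V := Emap p (Amap a y).

Definition reflect p a (y v : V) : V :=
  let N := normal p a y in v - (2 * pdot p N v / pdot p N N) *: N.

Definition billiard p a (l : V * V) : V * V :=
  let y := exit_point a l in oline y (reflect p a y l.2).

(* The normal is tangent to the ellipsoid exactly where it is null. *)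
Definition billiard_dom p a : set (V * V) :=
  [set l | entering p a l /\
     let N := normal p a (exit_point a l) in pdot p N N != 0].

End Billiard.

(* Main.v *)
Require Import Defs.
From HB Require Import structures.
From mathcomp Require Import all_boot all_order all_algebra.
From mathcomp Require Import all_classical all_reals all_analysis.
From mathcomp Require Import perm zify ring lra.
Import Order.TTheory GRing.Theory Num.Theory.
Import numFieldNormedType.Exports.
Local Open Scope classical_set_scope.
Local Open Scope ring_scope.

Set Implicit Arguments.
Unset Strict Implicit.
Unset Printing Implicit Defensive.

(** The billiard map is integrable because of one family of functions.  For a
    quadric with diagonal matrix B, let Phi B x u be the discriminant of the
    equation B y . y = 1 on the line x + t u, viewed as a function of the
    covector E u at the point x.

    - It is constant along lines and homogeneous of degree 2 in u, and a line is
      tangent to the quadric when it vanishes.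
    - The discriminants of confocal quadrics commute (bracket_Phi).  This
      follows from the resolvent identity E B P = (P - B) / (mu - nu) for the
      matrices of two quadrics of the family.
    - When y lies on the ellipsoid, Phi B y u is unchanged if u is reflected
      (Phi_reflect).

    Let P0 be the discriminant of the ellipsoid itself and theta = E u . dx.  The
    invariant contact form is theta / sqrt P0, which is the form of the scale
    where P0 = 1.  It is invariant because reflection preserves P0 and theta
    (dT_theta, Phi_T).  Its Reeb field is the Hamiltonian field of sqrt P0, and
    it is tangent to the leaves because the discriminants commute (reeb_TF).

    On a null line the discriminant is, up to the product of the denominators, a
    polynomial of degree n - 1 in the parameter of the family (size_specpoly).
    If it has n - 1 distinct roots then they are all simple, the line touches
    each of these quadrics at a finite point (tangent_dir_neq0), and the normals
    N_i at the points of tangency are mutually orthogonal and not null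
    (tnormal_orth, chart_N).  Consequently the differentials of the roots and of
    the discriminants with fixed parameters have the same kernels on the
    tangent space (chart_dmu0), and the foliation is given by the latter
    (tgF_discr).

    The main work is the integrability of the intersection of the foliation with
    the contact structure, which needs a function whose differential is
    proportional to theta on the leaves (leaf_primitive).  It is a complete
    integral of the eikonal equation.  Through a point y near a line of the leaf
    passes a nearby null line tangent to the same n - 1 quadrics.  Its direction
    U is the solution of n + 1 quadratic equations: nullity, n - 1 tangencies,
    and a normalization by one more discriminant.  If y is not a point of
    tangency these equations are independent, because their differentials are
    multiples of the N_i, the isotropic conormal E u, and a covector which does
    not vanish on u (quad_mx_unit).  A quantitative inverse function theorem for
    quadratic maps (quad_inverse) gives U, smooth in y and in the leaf
    (implicit_Ck).  The functions being in involution, E U . dy is closed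
    (isotropy, U_closed), and integrating it along segments gives the function.

    The same isotropy makes theta / sqrt P0 closed on the leaves (TF_isotropic),
    which is the invariance of the transverse measure (contact_lam_measure). *)

(** * Values of differentials *)

Section Hasd.
Variable R : realType.

(** Carrying differentiability together with the value of the differential
    lets the value at a composite expression be computed by applying one
    rule per operation. *)
Definition has_diff (E F : normedModType R) (f : E -> F) (x w : E) (d : F) : Prop :=
  differentiable f x /\ 'd f x w = d.

Section Gen.
Variables (E F : normedModType R).
Implicit Types (f g : E -> F) (x w : E).

Lemma has_diff_diff f x w : differentiable f x -> has_diff f x w ('d f x w).
Proof. by []. Qed.

Lemma has_diff_cst (c : F) x w : has_diff (fun=> c) x w 0.
Proof. by split; [exact: differentiable_cst|rewrite (diff_cst c x)]. Qed.

Lemma has_diff_add f g x w d e :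
  has_diff f x w d -> has_diff g x w e -> has_diff (fun z => f z + g z) x w (d + e).
Proof.
move=> [df <-] [dg <-]; split; first exact: differentiableD.
by rewrite (diffD df dg).
Qed.

Lemma has_diff_opp f x w d : has_diff f x w d -> has_diff (fun z => - f z) x w (- d).
Proof.
by move=> [df <-]; split; [exact: differentiableN|rewrite (diffN df)].
Qed.

Lemma has_diff_sub f g x w d e :
  has_diff f x w d -> has_diff g x w e -> has_diff (fun z => f z - g z) x w (d - e).
Proof. by move=> hf hg; apply: has_diff_add => //; exact: has_diff_opp. Qed.

Lemma has_diff_sum (I : Type) (r : seq I) (P : pred I) (f : I -> E -> F) x w
    (d : I -> F) :
  (forall i, P i -> has_diff (f i) x w (d i)) ->
  has_diff (fun z => \sum_(i <- r | P i) f i z) x w (\sum_(i <- r | P i) d i).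
Proof.
move=> H; elim: r => [|i r IH].
  rewrite big_nil (_ : (fun _ => _) = fun=> 0); first exact: has_diff_cst.
  by apply/funext => z; rewrite big_nil.
rewrite big_cons (_ : (fun _ => _) = fun z => if P i then
  f i z + \sum_(i <- r | P i) f i z else \sum_(i <- r | P i) f i z); last first.
  by apply/funext => z; rewrite big_cons.
by case: ifP => // Pi; apply: has_diff_add => //; exact: H.
Qed.

Lemma has_diff_lin (f : E -> F) x w : linear f -> continuous f -> has_diff f x w (f w).
Proof.
move=> lf cf; pose G := GRing.isLinear.Build _ _ _ _ f lf; pose g : {linear E -> F} :=
  HB.pack f G.
split; first exact: (@linear_differentiable _ _ _ g).
by rewrite (@diff_lin _ _ _ g).
Qed.

Lemma near_differentiable f g x :
  (\near x, f x = g x) -> differentiable f x -> 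
  differentiable g x /\ 'd g x = 'd f x :> (E -> F).
Proof.
move=> fg df.
have fgx : f x = g x by exact: nbhs_singleton fg.
have nfg : \forall y \near (0 : E), f (y + x) = g (y + x).
  have H : (fun y : E => y + x) @ (0 : E) --> 0 + x.
    by apply: cvgD; [exact: cvg_id|exact: cvg_cst].
  by rewrite add0r in H; exact: (H _ fg).
have key : g \o shift x = cst (g x) + 'd f x +o_ 0 id.
  apply/eqaddoP => e e0.
  have := diff_locally df => /eqaddoP /(_ e e0) => H.
  near=> y.
  have -> : (g \o shift x - (cst (g x) + 'd f x)) y =
            (f \o shift x - (cst (f x) + 'd f x)) y.
    rewrite /= !fctE /= fgx; congr (_ - _); symmetry.
    by near: y.
  by near: y.
have dg : 'd g x = 'd f x :> (E -> F).
  apply: diff_unique => //; exact: diff_continuous.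
split=> //; apply/diff_locallyP; rewrite dg; split=> //.
exact: diff_continuous.
Unshelve. all: by end_near.
Qed.

Lemma has_diff_near f g x w d :
  (\near x, f x = g x) -> has_diff f x w d -> has_diff g x w d.
Proof.
by move=> fg [df <-]; have [dg dgE] := near_differentiable fg df; split; [exact: dg|exact: (congr1 (@^~ w) dgE)].
Qed.

Lemma has_diff_fun f x w d d' : has_diff f x w d -> has_diff f x w d' -> d = d'.
Proof. by move=> [_ <-] [_ <-]. Qed.

Lemma has_diff_eq f x w d d' : has_diff f x w d -> d = d' -> has_diff f x w d'.
Proof. by move=> ? <-. Qed.

End Gen.

Lemma has_diff_comp (E F G : normedModType R) (f : E -> F) (g : F -> G) x w d e :
  has_diff f x w d -> has_diff g (f x) d e -> has_diff (fun z => g (f z)) x w e.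
Proof.
move=> [df <-] [dg <-]; split; first exact: (differentiable_comp df dg).
by rewrite (diff_comp df dg).
Qed.

Section Real.
Variable E : normedModType R.
Implicit Types (f g : E -> R^o) (x w : E).

Lemma has_diff_mul f g x w (d e : R) :
  has_diff f x w d -> has_diff g x w e ->
  has_diff (fun z => (f z * g z : R^o)) x w (f x * e + d * g x).
Proof.
move=> [df <-] [dg <-]; split; first exact: differentiableM.
rewrite (diffM df dg) -[LHS]/(f x * 'd g x w + g x * 'd f x w).
by rewrite [X in _ + X]mulrC.
Qed.

Lemma has_diff_scale (c : R) f x w (d : R) :
  has_diff f x w d -> has_diff (fun z => (c * f z : R^o)) x w (c * d).
Proof.
move=> H; apply: has_diff_eq (has_diff_mul (has_diff_cst c x w) H) _.
by rewrite mul0r addr0.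
Qed.

Lemma has_diff_sqr f x w (d : R) :
  has_diff f x w d -> has_diff (fun z => (f z ^+ 2 : R^o)) x w (2 * f x * d).
Proof.
move=> H; apply: has_diff_eq (has_diff_mul H H) _; by ring.
Qed.

Lemma has_diff_inv f x w (d : R) : f x != 0 ->
  has_diff f x w d -> has_diff (fun z => ((f z)^-1 : R^o)) x w (- d / (f x) ^+ 2).
Proof.
move=> f0 [df <-]; split; first exact: differentiableV.
rewrite (diffV df f0) -[LHS]/(- (f x) ^- 2 * 'd f x w).
by rewrite mulNr mulrC mulNr.
Qed.

Lemma has_diff_sqrt f x w (d : R) : 0 < f x ->
  has_diff f x w d -> has_diff (fun z => (Num.sqrt (f z) : R^o)) x w (d / (2 * Num.sqrt (f x))).
Proof.
move=> f0 H; apply: (@has_diff_comp E R^o R^o f (@Num.sqrt R) x w d) => //.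
have [ds es] := @is_derive1_sqrt R (f x) f0.
have D : differentiable (@Num.sqrt R) (f x) by exact/derivable1_diffP.
split; first exact: D.
rewrite -[X in 'd _ _ X = _]mulr1 -[d * 1]/(d *: (1 : R^o)) linearZ /=.
by rewrite -deriveE // es.
Qed.

Lemma has_diff_scalel (F : normedModType R) f (v : F) x w (d : R) :
  has_diff f x w d -> has_diff (fun z => f z *: v) x w (d *: v).
Proof.
move=> [df <-]; split; first exact: differentiableZl.
by rewrite (diffZl v df).
Qed.

End Real.
End Hasd.

(** * Calculus of C^k functions *)

Section CkBase.
Variable R : realType.
Variables (E F : normedModType R).
Implicit Types (f g : E -> F) (O : set E).

Lemma Ck_S k O f : Ck k.+1 O f -> Ck k O f.
Proof.
elim: k f => [|k IH] f; first by move=> [df _] x Ox; exact/differentiable_continuous/df.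
by move=> [df ddf]; split=> // w; exact/IH/ddf.
Qed.

Lemma Ck_sub k O O' f : O' `<=` O -> Ck k O f -> Ck k O' f.
Proof.
move=> sO; elim: k f => [|k IH] f; first by move=> cf x /sO; exact: cf.
by move=> [df ddf]; split=> [x /sO|w]; [exact: df|exact/IH/ddf].
Qed.

Lemma near_open O f g : open O -> (forall x, O x -> f x = g x) ->
  forall x, O x -> \near x, f x = g x.
Proof.
move=> oO fg x Ox; move: oO; rewrite openE => /(_ x Ox).
by apply: filterS => y; exact: fg.
Qed.

Lemma Ck_ext k O f g : open O -> (forall x, O x -> f x = g x) ->
  Ck k O f -> Ck k O g.
Proof.
move=> oO; elim: k f g => [|k IH] f g fg.
  move=> cf x Ox; have := cf x Ox.
  rewrite /prop_for /continuous_at -(fg _ Ox).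
  by apply: cvg_trans; apply: near_eq_cvg; apply: near_open Ox.
move=> [df ddf]; have nfg := near_open oO fg.
split=> [x Ox|w]; first by have [] := near_differentiable (nfg x Ox) (df x Ox).
apply: IH (ddf w) => x Ox.
by have [_ ->] := near_differentiable (nfg x Ox) (df x Ox).
Qed.

(** The form in which closure properties are proved by induction on k: it is
    enough to exhibit the differential on the open set, and to see that it
    is C^k. *)
Lemma Ck_step k O f (df : E -> E -> F) : open O ->
  (forall x w, O x -> has_diff f x w (df x w)) ->
  (forall w, Ck k O (df^~ w)) -> Ck k.+1 O f.
Proof.
move=> oO H C; split=> [x Ox|w]; first by have [] := H x 0 Ox.
by apply: Ck_ext oO _ (C w) => x Ox; have [_ ->] := H x w Ox.
Qed.

Lemma Ck_hasd k O f x w : Ck k.+1 O f -> O x -> has_diff f x w ('d f x w).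
Proof. by move=> [df _] Ox; apply/has_diff_diff/df. Qed.

Lemma Ck_d k O f w : Ck k.+1 O f -> Ck k O (fun x => 'd f x w).
Proof. by move=> [_]; apply. Qed.

Lemma Ck_cst k O (c : F) : open O -> Ck k O (fun=> c).
Proof.
move=> oO; elim: k c => [|k IH] c; first by move=> x _; exact: cvg_cst.
apply: (Ck_step (df := fun _ _ => 0)) => // x w _; exact: has_diff_cst.
Qed.

Lemma Ck_add k O f g : open O -> Ck k O f -> Ck k O g ->
  Ck k O (fun x => f x + g x).
Proof.
move=> oO; elim: k f g => [|k IH] f g.
  by move=> cf cg x Ox; apply: cvgD; [exact: cf|exact: cg].
move=> Cf Cg; apply: (Ck_step (df := fun x w => 'd f x w + 'd g x w)) => //.
  by move=> x w Ox; apply: has_diff_add; [exact: Ck_hasd Cf Ox|exact: Ck_hasd Cg Ox].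
by move=> w; exact: (IH _ _ (Ck_d w Cf) (Ck_d w Cg)).
Qed.

Lemma Ck_opp k O f : open O -> Ck k O f -> Ck k O (fun x => - f x).
Proof.
move=> oO; elim: k f => [|k IH] f.
  by move=> cf x Ox; apply: cvgN; exact: cf.
move=> Cf; apply: (Ck_step (df := fun x w => - 'd f x w)) => //.
  by move=> x w Ox; apply: has_diff_opp; exact: Ck_hasd Cf Ox.
by move=> w; exact: (IH _ (Ck_d w Cf)).
Qed.

Lemma Ck_subr k O f g : open O -> Ck k O f -> Ck k O g ->
  Ck k O (fun x => f x - g x).
Proof. by move=> oO Cf Cg; apply: Ck_add => //; exact: Ck_opp. Qed.

Lemma Ck_sum k O (I : Type) (r : seq I) (P : pred I) (f : I -> E -> F) :
  open O -> (forall i, P i -> Ck k O (f i)) ->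
  Ck k O (fun x => \sum_(i <- r | P i) f i x).
Proof.
move=> oO H; elim: r => [|i r IH].
  by apply: (Ck_ext oO _ (Ck_cst k 0 oO)) => x _; rewrite big_nil.
apply: (@Ck_ext _ _ (fun z => if P i then
  f i z + \sum_(i <- r | P i) f i z else \sum_(i <- r | P i) f i z)) => //.
  by move=> x _; rewrite big_cons.
case Pi: (P i); last exact: IH.
by apply: Ck_add => //; exact: H.
Qed.

Lemma Ck_lin k O f : open O -> linear f -> continuous f -> Ck k O f.
Proof.
move=> oO lf cf; elim: k => [|k IH]; first by move=> x _; exact: cf.
apply: (Ck_step (df := fun _ => f)) => //; last by move=> w; exact: Ck_cst.
by move=> x w _; exact: has_diff_lin.
Qed.

End CkBase.

Section CkComp.
Variable R : realType.
Variables (E F G : normedModType R).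

Lemma Ck_post k (O : set E) (f : E -> F) (L : F -> G) : open O ->
  linear L -> continuous L -> Ck k O f -> Ck k O (fun x => L (f x)).
Proof.
move=> oO lL cL; elim: k f => [|k IH] f.
  by move=> cf x Ox; apply: (@continuous_comp _ _ _ f L); [exact: cf|exact: cL].
move=> Cf; apply: (Ck_step (df := fun x w => L ('d f x w))) => //.
  move=> x w Ox; apply: has_diff_comp; first exact: Ck_hasd Cf Ox.
  exact: has_diff_lin.
by move=> w; exact: (IH _ (Ck_d w Cf)).
Qed.

Lemma Ck_pre k (O : set F) (O' : set E) (f : F -> G) (L : E -> F) : open O' ->
  (forall x, O' x -> O (L x)) ->
  linear L -> continuous L -> Ck k O f -> Ck k O' (fun x => f (L x)).
Proof.
move=> oO sO lL cL; elim: k f => [|k IH] f.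
  by move=> cf x /sO Ox; apply: (@continuous_comp _ _ _ L f); [exact: cL|exact: cf].
move=> Cf; apply: (Ck_step (df := fun x w => 'd f (L x) (L w))) => //.
  move=> x w /sO Ox; apply: (@has_diff_comp _ _ _ _ L f x w (L w)); first exact: has_diff_lin.
  exact: Ck_hasd Cf Ox.
by move=> w; exact: (IH _ (Ck_d (L w) Cf)).
Qed.

End CkComp.

Section CkReal.
Variable R : realType.
Variables (E : normedModType R) (O : set E).
Hypothesis oO : open O.
Implicit Types f g : E -> R^o.

Lemma Ck_mul k f g : Ck k O f -> Ck k O g -> Ck k O (fun x => (f x * g x : R^o)).
Proof.
elim: k f g => [|k IH] f g.
  by move=> cf cg x Ox; apply: cvgM; [exact: cf|exact: cg].
move=> Cf Cg.
apply: (Ck_step (df := fun x w => f x * 'd g x w + 'd f x w * g x)) => //.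
  by move=> x w Ox; apply: has_diff_mul; [exact: Ck_hasd Cf Ox|exact: Ck_hasd Cg Ox].
move=> w; exact: (Ck_add oO (IH _ _ (Ck_S Cf) (Ck_d w Cg))
  (IH _ _ (Ck_d w Cf) (Ck_S Cg))).
Qed.

Lemma Ck_prod k (I : Type) (r : seq I) (f : I -> E -> R^o) :
  (forall i, Ck k O (f i)) -> Ck k O (fun x => \prod_(i <- r) f i x : R^o).
Proof.
move=> H; elim: r => [|i r IH].
  by apply: (Ck_ext oO _ (Ck_cst k (1 : R^o) oO)) => x _; rewrite big_nil.
apply: (@Ck_ext _ _ _ _ _ (fun z => f i z * \prod_(i <- r) f i z)) => //.
  by move=> x _; rewrite big_cons.
exact: Ck_mul.
Qed.

Lemma Ck_inv k f : (forall x, O x -> f x != 0) -> Ck k O f ->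
  Ck k O (fun x => ((f x)^-1 : R^o)).
Proof.
move=> f0; elim: k => [|k IH].
  by move=> cf x Ox; apply: cvgV; [exact: f0|exact: cf].
move=> Cf.
apply: (Ck_step (df := fun x w => - ('d f x w * ((f x)^-1 * (f x)^-1)))) => //.
  move=> x w Ox; apply: has_diff_eq (has_diff_inv (f0 x Ox) (Ck_hasd w Cf Ox)) _.
  by rewrite mulNr -expr2 exprVn.
move=> w; apply: Ck_opp => //; apply: Ck_mul; first exact: Ck_d.
by apply: Ck_mul; apply/IH/Ck_S.
Qed.

Lemma Ck_sqrt k f : (forall x, O x -> 0 < f x) -> Ck k O f ->
  Ck k O (fun x => (Num.sqrt (f x) : R^o)).
Proof.
move=> f0; elim: k => [|k IH].
  by move=> cf x Ox; apply: (@continuous_comp _ _ _ f (@Num.sqrt R));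
    [exact: cf|exact: sqrt_continuous].
move=> Cf.
apply: (Ck_step (df := fun x w => ('d f x w * (2 * Num.sqrt (f x))^-1))) => //.
  by move=> x w Ox; exact: (has_diff_sqrt (f0 x Ox) (Ck_hasd w Cf Ox)).
move=> w; apply: Ck_mul; first exact: Ck_d.
apply: Ck_inv; first by move=> x Ox; rewrite mulf_neq0 // gt_eqF // sqrtr_gt0 f0.
by apply: Ck_mul; [exact: Ck_cst|apply/IH/Ck_S].
Qed.

Lemma Ck_scalel k (F : normedModType R) f (v : F) : Ck k O f ->
  Ck k O (fun x => f x *: v).
Proof.
apply: (@Ck_post R E R^o F k O f (fun c : R^o => c *: v)) => //.
  by move=> c a b; rewrite scalerDl -scalerA.
by move=> c; exact: scalel_continuous.
Qed.

Lemma Ck_coord k m n (f : E -> 'M[R]_(m, n)) i j : Ck k O f ->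
  Ck k O (fun x => (f x i j : R^o)).
Proof.
apply: (@Ck_post R E _ R^o k O f (fun v => v i j)) => //.
  by move=> c a b; rewrite !mxE.
exact: coord_continuous.
Qed.

Lemma Ck_row k n (f : E -> 'rV[R]_n) : (forall j, Ck k O (fun x => (f x 0 j : R^o))) ->
  Ck k O f.
Proof.
move=> H; apply: (@Ck_ext _ _ _ _ _ (fun x => \sum_j f x 0 j *: delta_mx 0 j)) => //.
  by move=> x _; rewrite -row_sum_delta.
by apply: Ck_sum => // j _; exact: Ck_scalel.
Qed.

Lemma Ck_pair k (F G : normedModType R) (f : E -> F) (g : E -> G) :
  Ck k O f -> Ck k O g -> Ck k O (fun x => (f x, g x)).
Proof.
move=> Cf Cg; apply: (@Ck_ext _ _ _ _ _ (fun x => (f x, 0) + (0, g x))) => //.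
  by move=> x _; congr (_, _); rewrite /= ?addr0 ?add0r.
apply: Ck_add => //.
  apply: (@Ck_post R E _ _ k O f (fun v => (v, 0))) => //.
    by move=> c a b; congr (_, _); rewrite /= scaler0 addr0.
  by move=> x; apply: cvg_pair; [exact: cvg_id|exact: cvg_cst].
apply: (@Ck_post R E _ _ k O g (fun v => (0, v))) => //.
  by move=> c a b; congr (_, _); rewrite /= scaler0 addr0.
by move=> x; apply: cvg_pair; [exact: cvg_cst|exact: cvg_id].
Qed.

End CkReal.

Section CkFst.
Variable R : realType.
Variables (E F G : normedModType R).

Lemma Ck_fst k (O : set E) (f : E -> F * G) : open O -> Ck k O f ->
  Ck k O (fun x => (f x).1).
Proof. by move=> oO; apply: (Ck_post (L := fst)) => // x; exact: cvg_fst. Qed.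

Lemma Ck_snd k (O : set E) (f : E -> F * G) : open O -> Ck k O f ->
  Ck k O (fun x => (f x).2).
Proof. by move=> oO; apply: (Ck_post (L := snd)) => // x; exact: cvg_snd. Qed.

Lemma Ck_id k (O : set E) : open O -> Ck k O (fun x => x).
Proof. by move=> oO; apply: Ck_lin => // x; exact: cvg_id. Qed.

Lemma has_diff_fst (f : E -> F * G) x w d : has_diff f x w d ->
  has_diff (fun x => (f x).1) x w d.1.
Proof.
move=> H; apply: (@has_diff_comp _ _ _ _ f fst) H _.
by apply: has_diff_lin => // z; exact: cvg_fst.
Qed.

Lemma has_diff_snd (f : E -> F * G) x w d : has_diff f x w d ->
  has_diff (fun x => (f x).2) x w d.2.
Proof.
move=> H; apply: (@has_diff_comp _ _ _ _ f snd) H _.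
by apply: has_diff_lin => // z; exact: cvg_snd.
Qed.

Lemma has_diff_id (x w : E) : has_diff (fun x => x) x w w.
Proof. by apply: has_diff_lin => // z; exact: cvg_id. Qed.

Lemma has_diff_pair (f : E -> F) (g : E -> G) x w d e : has_diff f x w d ->
  has_diff g x w e -> has_diff (fun x => (f x, g x)) x w (d, e).
Proof.
move=> [df <-] [dg <-]; split; first exact: differentiable_pair.
by rewrite (diff_pair df dg).
Qed.

Lemma has_diff_coord m n (f : E -> 'M[R]_(m, n)) x w d i j : has_diff f x w d ->
  has_diff (fun x => (f x i j : R^o)) x w (d i j).
Proof.
move=> H; apply: (@has_diff_comp _ _ _ R^o f (fun v => v i j)) H _.
apply: has_diff_lin; first by move=> c a b; rewrite !mxE.
exact: coord_continuous.
Qed.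

Lemma has_diff_row n (f : E -> 'rV[R]_n) x w (d : 'rV[R]_n) :
  (forall j, has_diff (fun x => (f x 0 j : R^o)) x w (d 0 j)) -> has_diff f x w d.
Proof.
move=> H.
rewrite (_ : f = fun x => \sum_j f x 0 j *: delta_mx 0 j); last first.
  by apply/funext => y; rewrite -row_sum_delta.
apply: (@has_diff_eq _ _ _ _ _ _ (\sum_j d 0 j *: delta_mx 0 j)); last first.
  by rewrite -row_sum_delta.
apply: (@has_diff_sum R E 'rV[R]_n 'I_n _ xpredT
  (fun j y => f y 0 j *: delta_mx 0 j)) => j _.
exact: has_diff_scalel.
Qed.

End CkFst.

(** * Local inversion of quadratic maps *)

Section MxNorm.
Variable R : realType.

Lemma mxnorm_entry m n (A : 'M[R]_(m, n)) i j : `|A i j| <= `|A|.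
Proof.
rewrite [leRHS]/Num.norm /= mx_normrE.
exact: (@le_bigmax _ _ _ 0 (fun ij : 'I_m * 'I_n => `|A ij.1 ij.2|) (i, j)).
Qed.

Lemma mxnorm_le m n (A : 'M[R]_(m, n)) c : 0 <= c ->
  (forall i j, `|A i j| <= c) -> `|A| <= c.
Proof.
move=> c0 H; rewrite [leLHS]/Num.norm /= mx_normrE.
by apply/bigmax_leP; split=> // -[i j] _; exact: H.
Qed.

Definition entry_sum m n (B : 'M[R]_(m, n)) : R := \sum_i \sum_j `|B i j|.

Lemma entry_sum_ge0 m n (B : 'M[R]_(m, n)) : 0 <= entry_sum B.
Proof. by apply: sumr_ge0 => i _; apply: sumr_ge0 => j _. Qed.

Lemma norm_mul_row m n (w : 'rV[R]_m) (B : 'M[R]_(m, n)) :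
  `|w *m B| <= `|w| * entry_sum B.
Proof.
apply: mxnorm_le => [|i j]; first by rewrite mulr_ge0 // entry_sum_ge0.
rewrite mxE (le_trans (ler_norm_sum _ _ _)) // /entry_sum mulr_sumr ler_sum // => k _.
rewrite normrM (ord1 i) ler_pM // ?mxnorm_entry //.
by rewrite (bigD1 j) //= lerDl sumr_ge0.
Qed.

Lemma sum_ord_cst m (x : R) : \sum_(i < m) x = m%:R * x.
Proof. by rewrite sumr_const card_ord mulr_natl. Qed.

Lemma small_pos (X y : R) : 0 <= X -> 0 < y -> exists r : R, [/\ 0 < r, r <= 1 & X * r <= y].
Proof.
move=> X0 y0; have X1 : 0 < X + 1 by lra.
exists (Num.min 1 (y / (X + 1))); split.
- by rewrite lt_min ltr01 /= divr_gt0.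
- by rewrite ge_min lexx.
- apply: (@le_trans _ _ (X * (y / (X + 1)))).
    by rewrite ler_wpM2l // ge_min lexx orbT.
  rewrite mulrA ler_pdivrMr //; nra.
Qed.

End MxNorm.

Section Quad.
Variables (R : realType) (m : nat).
Implicit Types (C : 'I_m -> 'M[R]_m) (u v : 'rV[R]_m).

Definition quad_mx C v : 'M[R]_m := \matrix_(j, i) \sum_k C i j k * v 0 k.
Definition quad_map C u : 'rV[R]_m := u *m quad_mx C u.

Definition sym_family C := forall i j k, C i j k = C i k j.

Lemma quad_mapE C u i : quad_map C u 0 i = \sum_j \sum_k C i j k * u 0 j * u 0 k.
Proof.
rewrite mxE; apply: eq_bigr => j _; rewrite mxE mulr_sumr.
by apply: eq_bigr => k _; ring.
Qed.

Lemma quad_mxD C u v : quad_mx C (u + v) = quad_mx C u + quad_mx C v.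
Proof.
apply/matrixP => i j; rewrite !mxE -big_split; apply: eq_bigr => k _ /=.
by rewrite mxE; ring.
Qed.

(** Polarization makes the increment of a quadratic map exactly linear, with
    the derivative taken at the midpoint: no remainder term has to be
    estimated below. *)
Lemma quad_map_sub C u v : sym_family C -> quad_map C u - quad_map C v = (u - v) *m quad_mx C (u + v).
Proof.
move=> sC; have E : u *m quad_mx C v = v *m quad_mx C u.
  apply/rowP => i; rewrite !mxE.
  under eq_bigr do rewrite mxE mulr_sumr.
  rewrite exchange_big /=; apply: eq_bigr => j _; rewrite mxE mulr_sumr.
  by apply: eq_bigr => k _; rewrite sC; ring.
rewrite quad_mxD mulmxDr !mulmxBl E /quad_map.
by rewrite addrA subrK.
Qed.

(** Newton's iteration with the derivative frozen at u0 is a contraction by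
    1/2 of a small ball.  The size of the ball and the constants depend on
    the coefficients only through their distance to C0, so that the solution
    can be followed along a whole segment of parameters.  The last clause
    gives uniqueness in the ball, and continuous dependence. *)
Lemma quad_inverse C0 u0 : sym_family C0 -> quad_mx C0 (u0 + u0) \in unitmx ->
  exists r e K, [/\ 0 < r, 0 < e, 0 <= K &
    forall C, sym_family C -> (forall i j k, `|C i j k - C0 i j k| <= e) ->
    (exists2 u, `|u - u0| <= r & quad_map C u = quad_map C0 u0) /\
    (forall u v, `|u - u0| <= r -> `|v - u0| <= r ->
      quad_mx C (u + v) \in unitmx /\ `|u - v| <= K * `|quad_map C u - quad_map C v|)].
Proof.
move=> sC0; set A := quad_mx C0 _ => uA.
pose N := entry_sum (invmx A); have N0 : 0 <= N by exact: entry_sum_ge0.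
pose K0 := \sum_i \sum_j \sum_k `|C0 i j k|.
have K00 : 0 <= K0.
  by apply: sumr_ge0 => i _; apply: sumr_ge0 => j _; apply: sumr_ge0 => k _.
have C0le i j k : `|C0 i j k| <= K0.
  rewrite /K0 (bigD1 i) //= (bigD1 j) //= (bigD1 k) //= -!addrA lerDl.
  apply: addr_ge0; first exact: sumr_ge0.
  apply: addr_ge0; apply: sumr_ge0 => ? _; first exact: sumr_ge0.
  by apply: sumr_ge0 => ? _; exact: sumr_ge0.
pose c : R := m%:R ^+ 3; pose c2 : R := m%:R ^+ 2.
have c0 : 0 <= c by rewrite exprn_ge0.
have c20 : 0 <= c2 by rewrite exprn_ge0.
have [||r [r0 r1 Hr]] := @small_pos R (c * (2 * K0) * N) (1 / 4); [|lra|].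
  by rewrite !mulr_ge0.
pose U := `|u0|; have U0 : 0 <= U by exact: normr_ge0.
have [||e [e0 e1 He]] := @small_pos R
    (c * (2 * (U + r)) * N + c2 * U ^+ 2 * N) (Num.min (1/4) (r / 2)).
- by rewrite addr_ge0 // !mulr_ge0 // ?addr_ge0 ?sqr_ge0 // ltW.
- by rewrite lt_min !divr_gt0.
have /andP[He1 He2] : (c * (2 * (U + r)) * N * e <= 1 / 4) &&
                      (c2 * U ^+ 2 * N * e <= r / 2).
  move: He; rewrite le_min mulrDl => /andP[h1 h2].
  have p1 : 0 <= c * (2 * (U + r)) * N * e.
    by rewrite !mulr_ge0 // ?addr_ge0 // ltW.
  have p2 : 0 <= c2 * U ^+ 2 * N * e by rewrite !mulr_ge0 // ?sqr_ge0 // ltW.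
  by apply/andP; split; lra.
(* N bounds the inverse derivative, so the contraction by 1/2 makes the
   inverse map Lipschitz with constant 2 N. *)
exists r, e, (2 * N); split => //; first by rewrite mulr_ge0.
move=> C sC CC.
have Dle u v : `|u - u0| <= r -> `|v - u0| <= r ->
    entry_sum (A - quad_mx C (u + v)) * N <= 1 / 2.
  move=> hu hv.
  have E : entry_sum (A - quad_mx C (u + v)) <= c * (2 * K0 * r + e * (2 * (U + r))).
    rewrite /entry_sum; apply: (@le_trans _ _ (\sum_(i < m) \sum_(j < m) \sum_(k < m)
      (2 * K0 * r + e * (2 * (U + r))))); last first.
      rewrite !sum_ord_cst.
      by rewrite /c; rewrite le_eqVlt; apply/orP; left; apply/eqP; ring.
    apply: ler_sum => j _; apply: ler_sum => i _.
    rewrite !mxE -sumrB (le_trans (ler_norm_sum _ _ _)) //.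
    apply: ler_sum => k _; rewrite !mxE.
    have hu' : `|u 0 k - u0 0 k| <= r.
      by apply: le_trans hu; have := mxnorm_entry (u - u0) 0 k; rewrite !mxE.
    have hv' : `|v 0 k - u0 0 k| <= r.
      by apply: le_trans hv; have := mxnorm_entry (v - u0) 0 k; rewrite !mxE.
    have h0 : `|u0 0 k| <= U by exact: mxnorm_entry.
    rewrite (_ : _ - _ = C0 i j k * ((u0 0 k - u 0 k) + (u0 0 k - v 0 k)) +
      (C0 i j k - C i j k) *
        ((u 0 k - u0 0 k) + (v 0 k - u0 0 k) + (u0 0 k + u0 0 k))); last by ring.
    apply: (le_trans (ler_normD _ _)); rewrite !normrM; apply: lerD.
      rewrite (_ : 2 * K0 * r = K0 * (r + r)); last by ring.
      apply: ler_pM => //; apply: (le_trans (ler_normD _ _)).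
      by rewrite lerD // distrC.
    apply: ler_pM => //; first by rewrite distrC.
    apply: (le_trans (ler_normD _ _)).
    have := ler_normD (u 0 k - u0 0 k) (v 0 k - u0 0 k).
    have := ler_normD (u0 0 k) (u0 0 k); lra.
  apply: (@le_trans _ _ (c * (2 * K0 * r + e * (2 * (U + r))) * N)).
    exact: ler_wpM2r.
  by move: Hr He1; rewrite !mulrDr !mulrDl; lra.
have contr u v : `|u - u0| <= r -> `|v - u0| <= r ->
    `|(u - v) - (quad_map C u - quad_map C v) *m invmx A| <= 1 / 2 * `|u - v|.
  move=> hu hv; rewrite quad_map_sub //.
  rewrite -[X in `|X - _|]mulmx1 -(mulmxV uA) mulmxA -mulmxBl -mulmxBr.
  apply: (le_trans (norm_mul_row _ _)).
  apply: (@le_trans _ _ (`|u - v| * entry_sum (A - quad_mx C (u + v)) * N)).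
    by rewrite ler_wpM2r // norm_mul_row.
  by rewrite -mulrA mulrC ler_wpM2r // Dle.
split; last first.
  move=> u v hu hv; split.
    rewrite unitmxE unitfE; apply/negP => /det0P[w w0 wM].
    have : `|w| <= 1 / 2 * `|w|.
      rewrite -[X in `|X| <= _](mulmxK uA) -[X in `|X *m _|]subr0 -wM -mulmxBr.
      apply: (le_trans (norm_mul_row _ _)).
      apply: (@le_trans _ _ (`|w| * entry_sum (A - quad_mx C (u + v)) * N)).
        by rewrite ler_wpM2r // norm_mul_row.
      by rewrite -mulrA mulrC ler_wpM2r // Dle.
    by have : 0 < `|w| by [rewrite normr_gt0]; lra.
  have H := contr u v hu hv; set q := quad_map C u - quad_map C v in H *.
  have H2 := norm_mul_row q (invmx A); rewrite -/N in H2.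
  have H3 : `|u - v| <= `|u - v - q *m invmx A| + `|q *m invmx A|.
    by rewrite -{1}[u - v](subrK (q *m invmx A)) ler_normD.
  lra.
(* The fixed points of f are the solutions. *)
pose f u := u - (quad_map C u - quad_map C0 u0) *m invmx A.
pose B := [set u : 'rV[R]_m | `|u - u0| <= r].
have fd u v : f u - f v = (u - v) - (quad_map C u - quad_map C v) *m invmx A.
  have E (x y a b : 'rV[R]_m) : x - a - (y - b) = x - y - (a - b).
    by rewrite !opprB addrACA [RHS]addrACA [- a + _]addrC.
  by rewrite /f E -mulmxBl; congr (_ - _ *m _); rewrite opprB addrA subrK.
have Bu0 : `|u0 - u0| <= r by rewrite subrr normr0 ltW.
have f0 : `|f u0 - u0| <= r / 2.
  rewrite /f addrAC subrr add0r normrN (le_trans (norm_mul_row _ _)) //.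
  apply: le_trans He2.
  rewrite -mulrA [N * e]mulrC mulrA; apply: ler_wpM2r => //.
  apply: mxnorm_le => [|i j]; first by rewrite !mulr_ge0 // ?sqr_ge0 // ltW.
  rewrite (ord1 i) mxE [X in _ + X]mxE !quad_mapE -sumrB.
  apply: (le_trans (ler_norm_sum _ _ _)).
  apply: (@le_trans _ _ (\sum_(k < m) \sum_(l < m) U ^+ 2 * e)); last first.
    rewrite !sum_ord_cst.
    rewrite /c2.
    by rewrite le_eqVlt; apply/orP; left; apply/eqP; ring.
  apply: ler_sum => k _; rewrite -sumrB (le_trans (ler_norm_sum _ _ _)) //.
  apply: ler_sum => l _; rewrite -!mulrBl !normrM expr2.
  rewrite -mulrA mulrC; apply: ler_pM => //.
  by apply: ler_pM => //; exact: mxnorm_entry.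
have fB : set_fun B B f.
  move=> u hu; rewrite /B /= -(subrK (f u0) (f u)) -addrA.
  apply: (le_trans (ler_normD _ _)).
  have := contr u u0 hu Bu0; rewrite -fd => H; move: hu; rewrite /B /=; lra.
pose T : completeNormedModType R := HB.pack 'rV[R]_m
  (Uniform_isComplete.Build 'rV[R]_m (@mx_complete R 1 m)).
have [|||p Bp pE] := @banach_fixed_point R T B (mkfun_fun fB).
- have q2 : (0 : R) <= 1 / 2 by lra.
  exists (NngNum q2); split => /=; first by lra.
  move=> [u v] [/= Bu Bv]; rewrite /mkfun fd; exact: contr.
- have -> : B = closed_ball_ Num.norm u0 r.
    by rewrite /B /closed_ball_; apply/seteqP; split => u /=; rewrite distrC.
  exact: closed_closed_ball_.
- by exists u0.
exists p => //.
have : (quad_map C p - quad_map C0 u0) *m invmx A = 0.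
  have : p = f p := pE; rewrite /f => /eqP.
  by rewrite eq_sym subr_eq -{1}[p]addr0 (inj_eq (addrI _)) => /eqP <-.
by move/(congr1 (mulmx^~ A)); rewrite mulmxKV // mul0mx => /eqP; rewrite subr_eq0 => /eqP.
Qed.

End Quad.

(** * Smooth solutions of quadratic systems *)

Section EpsDelta.
Variable R : realType.
Variables (E F : normedModType R).

(** Differentiability from an estimate of the increment, when the
    differential is known in advance. *)
Lemma has_diff_eps (f : E -> F) (x : E) (L : E -> F) : linear L -> continuous L ->
  (forall e : R, 0 < e ->
    \forall h \near (0 : E), `|f (h + x) - f x - L h| <= e * `|h|) ->
  forall w, has_diff f x w (L w).
Proof.
move=> lL cL H w.
pose G := GRing.isLinear.Build _ _ _ _ L lL; pose g : {linear E -> F} := HB.pack L G.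
have key : f \o shift x = cst (f x) + g +o_ 0 id.
  apply/eqaddoP => e e0; near=> y.
  rewrite /= !fctE /= opprD addrA; by near: y; exact: H.
have dg : 'd f x = g :> (E -> F) by exact: diff_unique.
split; last by rewrite dg.
by apply/diff_locallyP; rewrite dg.
Unshelve. all: by end_near.
Qed.

Lemma diff_eps (f : E -> F) (x : E) : differentiable f x ->
  forall e : R, 0 < e ->
    \forall h \near (0 : E), `|f (h + x) - f x - 'd f x h| <= e * `|h|.
Proof.
move=> df e e0; have /eqaddoP /(_ e e0) := diff_locally df.
by apply: filterS => h /=; rewrite !fctE /= opprD addrA.
Qed.

End EpsDelta.

Section MulCont.
Variable R : realType.
Variable (E : normedModType R).

(** The product rule needs only continuity of the factor a when the other
    one vanishes at the point.  It differentiates an implicit function,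
    whose increment is a matrix, known only to be continuous, applied to an
    explicit differentiable function. *)
Lemma has_diff_mul_cont (a g : E -> R^o) x w (d : R) :
  {for x, continuous a} -> g x = 0 -> has_diff g x w d ->
  has_diff (fun z => (a z * g z : R^o)) x w (a x * d).
Proof.
move=> ca g0 [dg dE].
pose q z : R^o := (a z - a x) * g z.
have hq : has_diff q x w 0.
  apply: (@has_diff_eps R E R^o q x (fun=> 0)).
  - by move=> c u v; rewrite scaler0 addr0.
  - by move=> z; exact: cvg_cst.
  move=> e e0.
  have [k k0 Hk] := linear_lipschitz (diff_continuous dg).
  have ek : 0 < e / (k + 1) by rewrite divr_gt0 // addr_gt0.
  have cah : \forall h \near (0 : E), `|a (h + x) - a x| <= e / (k + 1).
    have H : (fun y : E => y + x) @ (0 : E) --> 0 + x.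
      by apply: cvgD; [exact: cvg_id|exact: cvg_cst].
    rewrite add0r in H.
    have /cvgrPdist_le /(_ _ ek) := cvg_comp _ _ H ca.
    by apply: filterS => h /=; rewrite distrC.
  have := diff_eps dg ltr01; move: cah; apply: filterS2 => h h1 h2.
  rewrite /q g0 mulr0 !subr0 normrM; move: h2; rewrite g0 subr0 mul1r => h2.
  have h3 : `|g (h + x)| <= (k + 1) * `|h|.
    have := ler_normD (g (h + x) - 'd g x h) ('d g x h); rewrite subrK.
    have := Hk h; lra.
  apply: (@le_trans _ _ (e / (k + 1) * ((k + 1) * `|h|))); first exact: ler_pM.
  by rewrite mulrA divfK // gt_eqF // addr_gt0.
have := has_diff_add (has_diff_scale (a x) (conj dg dE : has_diff g x w d)) hq.
rewrite addr0; congr (has_diff _ _ _ _); apply/funext => z.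
by rewrite /q; ring.
Qed.

Lemma Ck_det k (O : set E) n (M : E -> 'M[R]_n) : open O ->
  (forall i j, Ck k O (fun z => (M z i j : R^o))) ->
  Ck k O (fun z => (\det (M z) : R^o)).
Proof.
move=> oO H; rewrite /determinant.
apply: (@Ck_sum R E R^o k O _ _ xpredT (fun (s : 'S_n) z =>
  (-1) ^+ s * \prod_i M z i (s i) : R^o)) => // s _.
apply: Ck_mul => //; first exact: Ck_cst.
exact: (@Ck_prod R E O oO k _ _ (fun i z => M z i (s i))).
Qed.

Lemma Ck_invmx k (O : set E) n (M : E -> 'M[R]_n) : open O ->
  (forall z, O z -> M z \in unitmx) ->
  (forall i j, Ck k O (fun z => (M z i j : R^o))) ->
  forall i j, Ck k O (fun z => (invmx (M z) i j : R^o)).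
Proof.
move=> oO uM H i j.
apply: (@Ck_ext _ _ _ _ _ (fun z => (\det (M z))^-1 * cofactor (M z) j i)) => //.
  by move=> z Oz; rewrite /invmx uM // !mxE.
apply: Ck_mul => //.
  apply: Ck_inv => //; last exact: Ck_det.
  by move=> z /uM; rewrite unitmxE unitfE.
apply: Ck_mul => //; first exact: Ck_cst.
apply: Ck_det => // i' j'.
by apply: Ck_ext (H _ _) => // z _; rewrite !mxE.
Qed.

End MulCont.

Section Implicit.
Variables (R : realType) (Z : normedModType R) (m : nat).
Variables (O : set Z) (C : Z -> 'I_m -> 'M[R]_m) (U : Z -> 'rV[R]_m).
Variables (sigma : 'rV[R]_m) (K : R).
Hypothesis oO : open O.
Hypothesis sC : forall z, O z -> sym_family (C z).
Hypothesis CC : forall p i j k, Ck p O (fun z => (C z i j k : R^o)).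
Hypothesis UE : forall z, O z -> quad_map (C z) (U z) = sigma.
Hypothesis uM : forall z z', O z -> O z' -> quad_mx (C z) (U z + U z') \in unitmx.
Hypothesis UL : forall z z', O z -> O z' ->
  `|U z - U z'| <= K * `|quad_map (C z) (U z) - quad_map (C z) (U z')|.
Hypothesis K0 : 0 <= K.

Lemma Ck_quad_map p (u : Z -> 'rV[R]_m) i : Ck p O u ->
  Ck p O (fun z => (quad_map (C z) (u z) 0 i : R^o)).
Proof.
move=> Cu; apply: (@Ck_ext _ _ _ _ _
  (fun z => \sum_j \sum_k C z i j k * u z 0 j * u z 0 k)) => //.
  by move=> z _; rewrite quad_mapE.
do 2 (apply: Ck_sum => // ? _); apply: Ck_mul => //; last exact: Ck_coord.
by apply: Ck_mul => //; exact: Ck_coord.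
Qed.

Lemma Ck_quad_mx p (u : Z -> 'rV[R]_m) i j : Ck p O u ->
  Ck p O (fun z => (quad_mx (C z) (u z) i j : R^o)).
Proof.
move=> Cu; apply: (@Ck_ext _ _ _ _ _ (fun z => \sum_k C z j i k * u z 0 k)) => //.
  by move=> z _; rewrite mxE.
by apply: Ck_sum => // k _; apply: Ck_mul => //; exact: Ck_coord.
Qed.

(** The Lipschitz bound UL is applied with the coefficients at z', for which
    both values at U z' and U z are close to sigma. *)
Lemma implicit_cont : Ck 0 O U.
Proof.
move=> z Oz; apply/cvgrPdist_le => e e0.
have c0 : {for z, continuous (fun z' => quad_map (C z') (U z) : 'rV[R]_m)}.
  have := Ck_row oO (fun i => Ck_quad_map i (Ck_cst 0 (U z) oO)).
  by apply.
have K1 : 0 < e / (K + 1) by rewrite divr_gt0 // ltr_wpDl.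
have /cvgrPdist_le /(_ _ K1) := c0.
have : \forall z' \near z, O z' by move: oO; rewrite openE; apply.
apply: filterS2 => z' Oz' /=; rewrite UE // -(UE Oz') => H.
rewrite distrC (le_trans (UL Oz' Oz)) //.
apply: (@le_trans _ _ (K * (e / (K + 1)))); first exact: ler_wpM2l.
by rewrite mulrA ler_pdivrMr ?ltr_wpDl //; nra.
Qed.

Definition dC (z w : Z) (i : 'I_m) : 'M[R]_m :=
  \matrix_(j, k) 'd (fun z => (C z i j k : R^o)) z w.

(** The derivative of the solution, obtained by differentiating the equation
    formally. *)
Definition implicit_d (z w : Z) : 'rV[R]_m :=
  - quad_map (dC z w) (U z) *m invmx (quad_mx (C z) (U z + U z)).

(** The increment U z' - U z equals g z' times the inverse of the matrix of
    the system at U z' + U z, where g z' is the defect of U z at z'; g is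
    differentiable and vanishes at z. *)
Lemma implicit_has_diff z w : O z -> has_diff U z w (implicit_d z w).
Proof.
move=> Oz.
pose g z' := quad_map (C z) (U z) - quad_map (C z') (U z).
pose a z' := invmx (quad_mx (C z') (U z' + U z)).
have UF z' : O z' -> U z' = U z + g z' *m a z'.
  move=> Oz'; rewrite /g (UE Oz) -(UE Oz') quad_map_sub; last exact: sC.
  by rewrite mulmxK ?uM // addrC subrK.
have ca i j : {for z, continuous (fun z' => a z' i j : R^o)}.
  have : Ck 0 O (fun z' => (a z' i j : R^o)).
    apply: Ck_invmx => // [z' Oz'|i' j']; first exact: uM.
    apply: Ck_quad_mx; apply: Ck_add => //; first exact: implicit_cont.
    exact: Ck_cst.
  by apply.
have hg i : has_diff (fun z' => (g z' 0 i : R^o)) z w (- quad_map (dC z w) (U z) 0 i).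
  apply: (@has_diff_eq _ _ _ _ _ _ (0 - quad_map (dC z w) (U z) 0 i)); last by rewrite sub0r.
  rewrite (_ : (fun z' => _) = fun z' => quad_map (C z) (U z) 0 i -
      \sum_j \sum_k C z' i j k * (U z 0 j * U z 0 k)); last first.
    apply/funext => z'; rewrite /g !mxE; congr (_ - _).
    transitivity (quad_map (C z') (U z) 0 i); first by rewrite mxE.
    by rewrite quad_mapE; do 2 (apply: eq_bigr => ? _); rewrite mulrA.
  apply: has_diff_sub; first exact: has_diff_cst.
  rewrite quad_mapE; do 2 (apply: has_diff_sum => ? _).
  rewrite mxE; apply: has_diff_eq; first (apply: has_diff_mul; [|exact: has_diff_cst]).
    exact: (Ck_hasd w (CC 1 _ _ _) Oz).
  by rewrite mulr0 add0r mulrA.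
apply: (@has_diff_near _ _ _ (fun z' => U z + g z' *m a z')).
  by apply: near_open oO _ _ Oz => z' Oz'; rewrite -UF.
apply: (@has_diff_eq _ _ _ _ _ _ (0 + implicit_d z w)); last by rewrite add0r.
apply: has_diff_add; first exact: has_diff_cst.
apply: has_diff_row => j; rewrite mxE.
rewrite (_ : (fun _ => _) = fun z' => \sum_i a z' i j * g z' 0 i); last first.
  by apply/funext => z'; rewrite mxE; apply: eq_bigr => i _; rewrite mulrC.
apply: has_diff_sum => i _; rewrite [X in has_diff _ _ _ X]mulrC.
rewrite [X in _ * X]mxE; apply: has_diff_mul_cont => //.
by rewrite /g subrr mxE.
Qed.

(** Bootstrap: implicit_d is an algebraic expression in U and the
    derivatives of the coefficients, hence as smooth as U is known to be. *)
Lemma implicit_Ck p : Ck p O U.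
Proof.
elim: p => [|p IH]; first exact: implicit_cont.
apply: (Ck_step (df := implicit_d)) => // [z w Oz|w]; first exact: implicit_has_diff.
apply: Ck_row => // j.
apply: (@Ck_ext _ _ _ _ _ (fun z => \sum_i (- quad_map (dC z w) (U z) 0 i) *
    invmx (quad_mx (C z) (U z + U z)) i j)) => //.
  by move=> z _; rewrite mxE; apply: eq_bigr => i _; rewrite [in RHS]mxE.
apply: Ck_sum => // i _; apply: Ck_mul => //; last first.
  apply: Ck_invmx => // [z Oz|i' j']; first exact: uM.
  by apply: Ck_quad_mx; exact: Ck_add.
apply: Ck_opp => //.
apply: (@Ck_ext _ _ _ _ _
  (fun z => \sum_j \sum_k 'd (fun z => (C z i j k : R^o)) z w * U z 0 j * U z 0 k)) => //.
  by move=> z _; rewrite quad_mapE; do 2 (apply: eq_bigr => ? _); rewrite mxE.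
do 2 (apply: Ck_sum => // ? _); apply: Ck_mul => //; last exact: Ck_coord.
apply: Ck_mul => //; last exact: Ck_coord.
exact: (Ck_d w (CC p.+1 _ _ _)).
Qed.

Lemma implicit_eq z w : O z ->
  'd U z w *m quad_mx (C z) (U z + U z) = - quad_map (dC z w) (U z).
Proof.
by move=> Oz; have [_ ->] := implicit_has_diff w Oz; rewrite mulmxKV // uM.
Qed.

End Implicit.

(** * Integrals over the unit interval depending on parameters *)

Section UnitInterval.
Variable R : realType.
Implicit Types g : R -> R.

Definition cont01 g := forall t : R, 0 <= t <= 1 -> {for t, continuous g}.

Definition int01 g : R := \int[@lebesgue_measure R]_(t in `[0, 1]) g t.

Lemma cont01_int g : cont01 g ->
  (@lebesgue_measure R).-integrable `[0, 1] (EFin \o g).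
Proof.
move=> cg; apply: continuous_compact_integrable; first exact: segment_compact.
apply: continuous_in_subspaceT => t; rewrite inE /= in_itv /=; exact: cg.
Qed.

Lemma int01_eq g h : (forall t : R, 0 <= t <= 1 -> g t = h t) -> int01 g = int01 h.
Proof.
by move=> gh; apply: eq_Rintegral => t; rewrite inE /= in_itv /=; exact: gh.
Qed.

Lemma int01_add g h : cont01 g -> cont01 h -> int01 (fun t => g t + h t) = int01 g + int01 h.
Proof.
by move=> cg ch; rewrite /int01 RintegralD //; exact: cont01_int.
Qed.

Lemma int01_sub g h : cont01 g -> cont01 h -> int01 (fun t => g t - h t) = int01 g - int01 h.
Proof.
by move=> cg ch; rewrite /int01 RintegralB //; exact: cont01_int.
Qed.

Lemma int01_scale c g : cont01 g -> int01 (fun t => c * g t) = c * int01 g.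
Proof.
by move=> cg; rewrite /int01 RintegralZl //; exact: cont01_int.
Qed.

Lemma cont01_cst c : cont01 (fun=> c).
Proof. by move=> t _; exact: cvg_cst. Qed.

Lemma cont01_add g h : cont01 g -> cont01 h -> cont01 (fun t => g t + h t).
Proof. by move=> cg ch t t01; apply: cvgD; [exact: cg|exact: ch]. Qed.

Lemma cont01_sub g h : cont01 g -> cont01 h -> cont01 (fun t => g t - h t).
Proof. by move=> cg ch t t01; apply: cvgB; [exact: cg|exact: ch]. Qed.

Lemma cont01_scale c g : cont01 g -> cont01 (fun t => c * g t).
Proof. by move=> cg t t01; apply: cvgM; [exact: cvg_cst|exact: cg]. Qed.

Lemma cont01_sum (I : Type) (r : seq I) (g : I -> R -> R) :
  (forall i, cont01 (g i)) -> cont01 (fun t => \sum_(i <- r) g i t).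
Proof.
move=> cg; elim: r => [|i r IH].
  rewrite (_ : (fun _ => _) = fun=> 0); first exact: cont01_cst.
  by apply/funext => t; rewrite big_nil.
rewrite (_ : (fun _ => _) = fun t => g i t + \sum_(i <- r) g i t).
  exact: cont01_add.
by apply/funext => t; rewrite big_cons.
Qed.

Lemma int01_sum (I : Type) (r : seq I) (g : I -> R -> R) :
  (forall i, cont01 (g i)) ->
  int01 (fun t => \sum_(i <- r) g i t) = \sum_(i <- r) int01 (g i).
Proof.
move=> cg; elim: r => [|i r IH].
  rewrite big_nil; transitivity (int01 (fun=> (0 : R) * 1)).
    by apply: int01_eq => t _; rewrite big_nil mul0r.
  by rewrite int01_scale ?mul0r //; exact: cont01_cst.
rewrite big_cons -IH -int01_add //; last exact: cont01_sum.
by apply: int01_eq => t _; rewrite big_cons.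
Qed.

Lemma int01_bound g (c : R) : cont01 g -> (forall t : R, 0 <= t <= 1 -> `|g t| <= c) ->
  `|int01 g| <= c.
Proof.
move=> cg gc; apply: (@le_trans _ _ (int01 (fun t => `|g t|))).
  by apply: le_normr_Rintegral => //; exact: cont01_int.
have cn : cont01 (fun t => `|g t|).
  move=> t t01; apply: (@continuous_comp _ _ _ g (@Num.norm R R)); first exact: cg.
  exact: norm_continuous.
apply: (@le_trans _ _ (int01 (fun=> c))).
  have i1 := cont01_int cn; have i2 := cont01_int (@cont01_cst c).
  by apply: le_Rintegral => // t /=; rewrite in_itv /=; exact: gc.
rewrite /int01 Rintegral_cst //=; have -> := @lebesgue_measure_itv R `[0, 1]; rewrite /= lte_fin ltr01 /=.
by rewrite subr0 mulr1.
Qed.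

Lemma int01_FTC (G g : R -> R) : cont01 g ->
  (forall t : R, 0 <= t <= 1 -> is_derive t 1 G (g t)) -> int01 g = G 1 - G 0.
Proof.
move=> cg dG; rewrite /int01 /Rintegral (@continuous_FTC2 R g G 0 1) //.
- by apply: continuous_in_subspaceT => t; rewrite inE /= in_itv /=; exact: cg.
- have cG (t : R) : 0 <= t <= 1 -> {for t, continuous G}.
    by move=> /dG [dt _]; apply: differentiable_continuous; exact/derivable1_diffP.
  split.
  + move=> t; rewrite in_itv /= => /andP[t0 t1].
    by have [] : is_derive t 1 G (g t) by apply: dG; rewrite !ltW.
  + by apply: cvg_at_right_filter; apply: cG; rewrite lexx ler01.
  + by apply: cvg_at_left_filter; apply: cG; rewrite lexx ler01.
- move=> t; rewrite in_itv /= => /andP[t0 t1]; rewrite derive1E.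
  by have [_ ->] : is_derive t 1 G (g t) by apply: dG; rewrite !ltW.
Qed.

End UnitInterval.

Section Tube.
Variables (R : realType) (E : normedModType R).

(** Compactness of [0, 1]: a property that holds near each point of a
    segment holds on a neighbourhood of the whole segment. *)
Lemma tube (P : R^o * E -> Prop) (l : E) :
  (forall t : R, 0 <= t <= 1 -> \forall z \near ((t, l) : R^o * E), P z) ->
  \forall l' \near l, forall t : R, 0 <= t <= 1 -> P (t, l').
Proof.
move=> H; have /compact_near_coveringP cpt := @segment_compact R 0 1.
have := cpt E (nbhs l) (fun l' t => P (t, l')) _.
have : forall x : R, [set` `[0, 1]] x -> \forall x' \near x & i \near l, P (x', i).
  move=> t /=; rewrite in_itv /= => t01.
  by have := H t t01; apply: filterS => -[a b].
move=> h1 h2; have := h2 (nbhs_filter l) h1.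
by apply: filterS => l' K t t01; apply: K; rewrite /= in_itv.
Qed.

Lemma cont_set_snd (l : E) : continuous (fun z : R^o * E => (z.1, l) : R^o * E).
Proof.
move=> z; apply: differentiable_continuous.
have [] // : has_diff (fun z : R^o * E => (z.1, l) : R^o * E) z 0 ((0 : R^o * E).1, 0).
by apply: has_diff_pair; [apply: has_diff_fst; exact: has_diff_id|exact: has_diff_cst].
Qed.

Lemma cont_pair_snd (l : E) : continuous (fun t : R^o => (t, l) : R^o * E).
Proof.
move=> z; apply: differentiable_continuous.
have [] // : has_diff (fun t : R^o => (t, l) : R^o * E) z 0 (0, 0).
by apply: has_diff_pair; [exact: has_diff_id|exact: has_diff_cst].
Qed.

Lemma tube_cont (F : normedModType R) (g : R^o * E -> F) (l : E) :
  (forall t : R, 0 <= t <= 1 -> {for ((t, l) : R^o * E), continuous g}) ->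
  forall e : R, 0 < e ->
  \forall l' \near l, forall t : R, 0 <= t <= 1 -> `|g (t, l') - g (t, l)| <= e.
Proof.
move=> cg e e0; apply: (@tube (fun z => `|g z - g (z.1, l)| <= e)) => t t01.
have e2 : 0 < e / 2 by rewrite divr_gt0.
have /cvgrPdist_le /(_ _ e2) H1 := cg t t01.
have H2 : \forall z \near ((t, l) : R^o * E), `|g (t, l) - g (z.1, l)| <= e / 2.
  have c2 : {for ((t, l) : R^o * E), continuous (fun z : R^o * E => g (z.1, l))}.
    apply: (@continuous_comp _ _ _ (fun z : R^o * E => (z.1, l) : R^o * E) g).
      exact: cont_set_snd.
    exact: cg.
  by have /cvgrPdist_le /(_ _ e2) := c2.
move: H1 H2; apply: filterS2 => z h1 h2.
rewrite distrC in h1.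
have := ler_normD (g z - g (t, l)) (g (t, l) - g (z.1, l)).
rewrite addrA subrK; lra.
Qed.

End Tube.

Section Param.
Variables (R : realType) (E : normedModType R).
Variables (I : finType) (b : I -> E) (phi : I -> E -> R).
Hypothesis phiE : forall h, h = \sum_i phi i h *: b i.
Hypothesis phi_le : forall i h, `|phi i h| <= `|h|.
Hypothesis phi_lin : forall i, linear (phi i : E -> R^o).
Hypothesis phi_cont : forall i, continuous (phi i).

Variables (O' : set (R^o * E)) (O : set E).
Hypothesis oO' : open O'.
Hypothesis oO : open O.
Hypothesis OO' : forall (t : R) l, 0 <= t <= 1 -> O l -> O' (t, l).

Lemma cont01_param (f : R^o * E -> R^o) l : Ck 0 O' f -> O l -> cont01 (fun t => f (t, l)).
Proof.
move=> cf Ol t t01; apply: (@continuous_comp _ _ _ (fun t => (t, l) : R^o * E) f).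
  exact: cont_pair_snd.
by apply: cf; exact: OO'.
Qed.

Lemma d_frame (f : R^o * E -> R^o) z h : 
  'd f z (0, h) = \sum_i phi i h * 'd f z (0, b i).
Proof.
rewrite {1}(phiE h).
have -> : ((0, \sum_i phi i h *: b i) : R^o * E) = \sum_i phi i h *: (0, b i).
  elim/big_rec2: _ => // i x y _ <-; congr (_, _).
  by rewrite /= scaler0 add0r.
by rewrite linear_sum; apply: eq_bigr => i _; rewrite linearZ.
Qed.

(** Differentiation under the integral sign.  The mean value theorem on the
    segment from l to l + h bounds the remainder by the variation of the
    partial derivatives along the frame, which is uniformly small in t by
    the tube lemma. *)
Lemma param_has_diff (f : R^o * E -> R^o) l w : Ck 1 O' f -> O l ->
  has_diff (fun l => int01 (fun t => f (t, l)) : R^o) l w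
       (int01 (fun t => 'd f (t, l) (0, w))).
Proof.
move=> Cf Ol.
have cd i l' : O l' -> cont01 (fun t => 'd f (t, l') (0, b i)).
  by move=> Ol'; exact: (cont01_param (Ck_d (0, b i) Cf) Ol').
pose L h := \sum_i phi i h * int01 (fun t => 'd f (t, l) (0, b i)).
have cdw h l' : O l' -> cont01 (fun t => 'd f (t, l') (0, h)).
  move=> Ol'; rewrite (_ : (fun _ => _) = fun t => \sum_i phi i h * 'd f (t, l') (0, b i)).
    by apply: cont01_sum => i; apply: cont01_scale; exact: cd.
  by apply/funext => t; rewrite d_frame.
have LE h : L h = int01 (fun t => 'd f (t, l) (0, h)).
  rewrite (@int01_eq _ _ (fun t => \sum_i phi i h * 'd f (t, l) (0, b i))).
    rewrite int01_sum => [|i]; last by apply: cont01_scale; exact: cd.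
    by apply: eq_bigr => i _; rewrite int01_scale //; exact: cd.
  by move=> t _; rewrite d_frame.
rewrite -LE; apply: (@has_diff_eps R E R^o _ l L).
- move=> c u v; transitivity (c * L u + L v); last by [].
  rewrite /L mulr_sumr -big_split; apply: eq_bigr => i _ /=.
  rewrite (_ : phi i (c *: u + v) = c * phi i u + phi i v); first by ring.
  exact: phi_lin.
- have cL : Ck 0 setT (L : E -> R^o).
    apply: Ck_sum => [|i _]; first exact: openT.
    apply: Ck_mul; first exact: openT; last by apply: Ck_cst; exact: openT.
    by move=> y _; exact: phi_cont.
  by move=> x; exact: cL.
move=> e e0.
pose N := #|I|%:R : R.
have e1 : 0 < e / (N + 1) by rewrite divr_gt0 // ltr_wpDl // ler0n.
have T i : \forall l' \near l, O l' /\ forall t : R, 0 <= t <= 1 ->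
    `|'d f (t, l') (0, b i) - 'd f (t, l) (0, b i)| <= e / (N + 1).
  have h1 : \forall l' \near l, O l' by move: oO; rewrite openE; apply.
  have h2 := @tube_cont R E R^o (fun z => 'd f z (0, b i)) l
    (fun t t01 => Ck_d (0, b i) Cf _ (OO' t01 Ol)) _ e1.
  by move: h1 h2; apply: filterS2.
have {T} : \forall l' \near l, O l' /\ forall i, forall t : R, 0 <= t <= 1 ->
    `|'d f (t, l') (0, b i) - 'd f (t, l) (0, b i)| <= e / (N + 1).
  have h1 : \forall l' \near l, O l' by move: oO; rewrite openE; apply.
  have h2 : \forall l' \near l, forall i, O l' /\ forall t : R, 0 <= t <= 1 ->
    `|'d f (t, l') (0, b i) - 'd f (t, l) (0, b i)| <= e / (N + 1).
    by apply: filter_forall => i; exact: T.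
  by move: h1 h2; apply: filterS2 => l' h1 h2; split=> // i; case: (h2 i).
move=> /nbhs_ballP[r /= r0 Hr].
apply/nbhs_ballP; exists r => //= h; rewrite -ball_normE /= sub0r normrN => hr.
have segO s : 0 <= s <= 1 -> ball l r (s *: h + l).
  move=> /andP[s0 s1]; rewrite -ball_normE /= opprD addrCA subrr addr0 normrN normrZ.
  by rewrite (ger0_norm s0) (le_lt_trans _ hr) // ler_piMl.
have [Ohl _] : O (h + l) /\ True.
  by split=> //; have [] := Hr _ (segO 1 _); rewrite ?scale1r // ler01 lexx.
rewrite LE -int01_sub; [|exact: cont01_param (Ck_S Cf) Ohl|exact: cont01_param (Ck_S Cf) Ol].
rewrite -int01_sub; [|apply: cont01_sub; [exact: cont01_param (Ck_S Cf) Ohl|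
  exact: cont01_param (Ck_S Cf) Ol]|exact: cdw].
apply: int01_bound.
  apply: cont01_sub; last exact: cdw.
  by apply: cont01_sub; [exact: cont01_param (Ck_S Cf) Ohl| exact: cont01_param (Ck_S Cf) Ol].
move=> t t01.
pose F (s : R) : R := f (t, s *: h + l).
have dF (s : R) : 0 <= s <= 1 -> is_derive s 1 F ('d f (t, s *: h + l) (0, h)).
  move=> s01; have [Os _] := Hr _ (segO s s01).
  have Hf := Ck_hasd (0, h) Cf (OO' t01 Os).
  have Hg : has_diff (fun s : R^o => (t, s *: h + l) : R^o * E) s 1 (0, h).
    apply: has_diff_pair; first exact: has_diff_cst.
    apply: has_diff_eq; first apply: has_diff_add.
    - by apply: (@has_diff_scalel R R^o E id h); exact: has_diff_id.
    - exact: has_diff_cst.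
    - by rewrite scale1r addr0.
  have [dc ec] := has_diff_comp Hg Hf.
  have D : derivable F s 1 by exact/derivable1_diffP.
  apply: DeriveDef => //; by rewrite deriveE.
have dF' (s : R) : s \in `]0, 1[ -> is_derive s 1 F ('d f (t, s *: h + l) (0, h)).
  by rewrite in_itv /= => /andP[s0 s1]; apply: dF; rewrite !ltW.
have cF : {within `[0, 1], continuous F}.
  apply: continuous_in_subspaceT => s; rewrite inE /= in_itv /= => /dF [ds _].
  by apply: differentiable_continuous; exact/derivable1_diffP.
have [c c01' cE] := MVT_segment ler01 dF' cF.
have s01 : 0 <= c <= 1 by move: c01'; rewrite in_itv.
rewrite /F in cE; rewrite scale1r scale0r add0r subr0 mulr1 in cE.
  have sE : 'd f (t, c *: h + l) (0, h) - 'd f (t, l) (0, h) = \sum_i phi i h *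
    ('d f (t, c *: h + l) (0, b i) - 'd f (t, l) (0, b i)).
  under [RHS]eq_bigr do rewrite mulrBr.
  by rewrite sumrB; congr (_ - _); exact: d_frame.
rewrite cE sE; apply: (le_trans (ler_norm_sum _ _ _)).
  apply: (@le_trans _ _ (\sum_(i : I) `|h| * (e / (N + 1)))).
    apply: ler_sum => i _; rewrite normrM; apply: ler_pM => //.
    by have [_] := Hr _ (segO c s01); apply.
  rewrite sumr_const -[_ *+ _]mulr_natl -/N.
  have N0 : 0 <= N by rewrite ler0n.
  have K : N * (e / (N + 1)) <= e.
    rewrite mulrCA -[leRHS]mulr1; apply: ler_wpM2l; first exact: ltW.
    by rewrite ler_pdivrMr ?ltr_wpDl // mul1r lerDl ler01.
  by rewrite mulrCA mulrC; apply: ler_wpM2r.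
Qed.

Lemma param_Ck (f : R^o * E -> R^o) : (forall k, Ck k O' f) ->
  forall k, Ck k O (fun l => int01 (fun t => f (t, l)) : R^o).
Proof.
move=> Cf k; elim: k f Cf => [|k IH] f Cf.
  by move=> l Ol; have [dh _] := param_has_diff 0 (Cf 1) Ol; exact: differentiable_continuous.
apply: (Ck_step (df := fun l w => int01 (fun t => 'd f (t, l) (0, w)))) => //.
  by move=> l w Ol; apply: param_has_diff.
by move=> w; apply: (IH (fun z => 'd f z (0, w))) => k'; exact: Ck_d.
Qed.

End Param.

Section Frame.
Variables (R : realType) (m : nat).
Local Notation V := 'rV[R]_m.

Definition vv_basis (i : 'I_m + 'I_m) : V * V :=
  match i with inl j => (delta_mx 0 j, 0) | inr j => (0, delta_mx 0 j) end.

Definition vv_coord (i : 'I_m + 'I_m) (h : V * V) : R :=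
  match i with inl j => h.1 0 j | inr j => h.2 0 j end.

Lemma vv_coordE h : h = \sum_i vv_coord i h *: vv_basis i.
Proof.
rewrite big_sumType /=; case: h => x y /=.
have -> : \sum_i x 0 i *: ((delta_mx 0 i, 0) : V * V) = (x, 0).
  rewrite [in RHS](row_sum_delta x); elim/big_rec2: _ => // i u v _ ->.
  by congr (_, _); rewrite /= scaler0 add0r.
have -> : \sum_i y 0 i *: ((0, delta_mx 0 i) : V * V) = (0, y).
  rewrite [in RHS](row_sum_delta y); elim/big_rec2: _ => // i u v _ ->.
  by congr (_, _); rewrite /= scaler0 add0r.
by congr (_, _); rewrite /= ?addr0 ?add0r.
Qed.

Lemma vv_coord_le i h : `|vv_coord i h| <= `|h|.
Proof.
by case: i => j /=; rewrite [leRHS]/Num.norm /= le_max mxnorm_entry ?orbT.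
Qed.

Lemma vv_coord_has_diff i h w : has_diff (vv_coord i : _ -> R^o) h w (vv_coord i w).
Proof.
by case: i => j; apply: has_diff_coord; [apply: has_diff_fst|apply: has_diff_snd]; exact: has_diff_id.
Qed.

Lemma vv_coord_cont i : continuous (vv_coord i).
Proof.
by move=> h; apply: differentiable_continuous; have [] := vv_coord_has_diff i h 0.
Qed.

Lemma vv_coord_lin i : linear (vv_coord i : V * V -> R^o).
Proof. by case: i => j c u v; rewrite /= !mxE. Qed.

End Frame.

(** * Confocal quadrics: involution and tangency *)

Section Forms.
Variables (R : realType) (m : nat).
Local Notation V := 'rV[R]_m.
Implicit Types (B P W : 'I_m -> R) (x y u v d : V).

Definition bf B x y : R := \sum_i B i * x 0 i * y 0 i.
Definition wm B x : V := \row_i (B i * x 0 i).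

Lemma bfC B x y : bf B x y = bf B y x.
Proof. by apply: eq_bigr => i _; ring. Qed.
Lemma bfDl B x x' y : bf B (x + x') y = bf B x y + bf B x' y.
Proof. by rewrite /bf -big_split; apply: eq_bigr => i _ /=; rewrite mxE; ring. Qed.
Lemma bfZl B c x y : bf B (c *: x) y = c * bf B x y.
Proof. by rewrite /bf mulr_sumr; apply: eq_bigr => i _ /=; rewrite mxE; ring. Qed.
Lemma bfDr B x y y' : bf B x (y + y') = bf B x y + bf B x y'.
Proof. by rewrite bfC bfDl ![bf B _ x]bfC. Qed.
Lemma bfZr B c x y : bf B x (c *: y) = c * bf B x y.
Proof. by rewrite bfC bfZl bfC. Qed.
Lemma bfNl B x y : bf B (- x) y = - bf B x y.
Proof. by rewrite -scaleN1r bfZl mulN1r. Qed.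
Lemma bfNr B x y : bf B x (- y) = - bf B x y.
Proof. by rewrite bfC bfNl bfC. Qed.
Lemma bf0l B y : bf B 0 y = 0.
Proof. by rewrite -(scale0r 0) bfZl mul0r. Qed.
Lemma bf0r B y : bf B y 0 = 0.
Proof. by rewrite bfC bf0l. Qed.

Definition bfE := (bfDl, bfDr, bfNl, bfNr, bfZl, bfZr, bf0l, bf0r).

Lemma bf_wml W B x y : bf W (wm B x) y = bf (fun k => W k * B k) x y.
Proof. by apply: eq_bigr => i _; rewrite mxE; ring. Qed.
Lemma bf_wmr W B x y : bf W x (wm B y) = bf (fun k => W k * B k) x y.
Proof. by rewrite bfC bf_wml bfC. Qed.

Lemma bf_ext B P x y : (forall k, B k = P k) -> bf B x y = bf P x y.
Proof. by move=> E; apply: eq_bigr => i _; rewrite E. Qed.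

Lemma bf1_eq0 x : bf (fun=> 1) x x = 0 -> x = 0.
Proof.
move=> /eqP; rewrite /bf psumr_eq0 => [|i _]; last by rewrite mul1r -expr2 sqr_ge0.
move=> /allP H; apply/rowP => i; rewrite mxE; apply/eqP.
by have := H i (mem_index_enum i); rewrite /= mul1r -expr2 sqrf_eq0.
Qed.

Lemma bf_ge0 B x : (forall k, 0 < B k) -> x != 0 -> 0 < bf B x x.
Proof.
move=> B0 x0; have H0 i : 0 <= B i * x 0 i * x 0 i.
  by rewrite -mulrA -expr2 mulr_ge0 ?sqr_ge0 // ltW.
rewrite lt_neqAle sumr_ge0 ?andbT; last by move=> i _; exact: H0.
apply: contra x0; rewrite eq_sym psumr_eq0; last by move=> i _; exact: H0.
move=> /allP H; apply/eqP/rowP => i; rewrite mxE; apply/eqP.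
by have := H i (mem_index_enum i); rewrite /= -mulrA -expr2 mulf_eq0 sqrf_eq0 gt_eqF.
Qed.

(** The discriminant of the restriction to the line x + t u of the quadratic
    equation bf B y y = 1.  As a function of the point x and the covector u
    it is homogeneous of degree 2 in u and constant along the line, and its
    Hamiltonian flow moves lines tangent to the quadric among themselves. *)
Definition Phi B x u : R := bf B x u ^+ 2 - bf B u u * (bf B x x - 1).

(** The partial differentials of Phi with respect to the point, the
    direction and the weights B. *)
Definition dPx B x u dx : R := 2 * (bf B x u * bf B u dx - bf B u u * bf B x dx).
Definition dPu B x u du : R :=
  2 * (bf B x u * bf B x du - (bf B x x - 1) * bf B u du).
Definition dPB B x u dB : R :=
  2 * (bf B x u * bf dB x u) - bf dB u u * (bf B x x - 1) - bf B u u * bf dB x x.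

Lemma Phi_shift B x u t : Phi B (x + t *: u) u = Phi B x u.
Proof. by rewrite /Phi !bfE (bfC B u x); ring. Qed.

Lemma Phi_scale B x u t : Phi B x (t *: u) = t ^+ 2 * Phi B x u.
Proof. by rewrite /Phi !bfE; ring. Qed.

Lemma dPu_self B x u : dPu B x u u = 2 * Phi B x u.
Proof. by rewrite /dPu /Phi; ring. Qed.

Lemma dPx_self B x u : dPx B x u u = 0.
Proof. by rewrite /dPx; ring. Qed.

Lemma dPx_shift B x u t dx : dPx B (x + t *: u) u dx = dPx B x u dx.
Proof. by rewrite /dPx !bfE; ring. Qed.

Lemma dPu_shift B x u t du : dPu B (x + t *: u) u du = dPu B x u du - t * dPx B x u du.
Proof. by rewrite /dPu /dPx !bfE (bfC B u x); ring. Qed.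

(** The gradients of Phi, in the sense that they represent dPx and dPu for
    the Euclidean product. *)
Definition gPx B x u : V := 2 *: (bf B x u *: wm B u - bf B u u *: wm B x).
Definition gPu B x u : V := 2 *: (bf B x u *: wm B x - (bf B x x - 1) *: wm B u).

Lemma gPxE B x u d : bf (fun=> 1) (gPx B x u) d = dPx B x u d.
Proof.
rewrite /gPx /dPx !bfE !bf_wml; congr (2 * (_ * _ - _ * _)).
  by apply: bf_ext => k; rewrite mul1r.
by apply: bf_ext => k; rewrite mul1r.
Qed.

Lemma gPuE B x u d : bf (fun=> 1) (gPu B x u) d = dPu B x u d.
Proof.
rewrite /gPu /dPu !bfE !bf_wml; congr (2 * (_ * _ - _ * _)).
  by apply: bf_ext => k; rewrite mul1r.
by apply: bf_ext => k; rewrite mul1r.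
Qed.

Variable s : 'I_m -> R.
Hypothesis s2 : forall k, s k * s k = 1.

(** The relation between the weights of two quadrics of the family; it is
    the resolvent identity for the diagonal matrices of the quadrics. *)
Definition pencil B P := exists2 dl, dl != 0 & forall k, s k * (B k * P k) = (P k - B k) / dl.

(** The mixed forms that occur in Poisson brackets of the discriminants
    reduce to the forms of the two quadrics. *)
Lemma pencil_bf B P : pencil B P ->
  exists dl, forall x y, bf (fun k => s k * B k * P k) x y = dl * (bf P x y - bf B x y).
Proof.
move=> [dl dl0 E]; exists dl^-1 => x y.
rewrite /bf -sumrB mulr_sumr; apply: eq_bigr => k _.
by rewrite -[s k * _ * _]mulrA E; field.
Qed.

(** The Poisson bracket of the discriminants of two quadrics of the family
    vanishes: after pencil_bf all terms cancel. *)
Lemma bracket_Phi B P x u : pencil B P ->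
  bf s (gPx B x u) (gPu P x u) = bf s (gPu B x u) (gPx P x u).
Proof.
move=> /pencil_bf [dl E].
rewrite /gPx /gPu !bfE !bf_wml !bf_wmr !E !(bfC _ u x).
ring.
Qed.

(** The discriminants are constant along the null geodesics, that is, they
    commute with the energy. *)
Lemma bracket_null B x u : bf s (gPx B x u) (2 *: wm s u) = 0.
Proof.
rewrite bfZr bf_wmr (@bf_ext _ (fun=> 1)); last by move=> k; rewrite s2.
by rewrite gPxE dPx_self mulr0.
Qed.

(** The Euclidean normal of the quadric at the point where the line touches
    it, which is at parameter - bf B x u / bf B u u. *)
Definition tnormal B x u : V := wm B (x - (bf B x u / bf B u u) *: u).

Lemma tnormalE B x u d : bf (fun=> 1) (tnormal B x u) d =
  bf B x d - (bf B x u / bf B u u) * bf B u d.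
Proof.
rewrite /tnormal bf_wml (@bf_ext _ B) => [|k]; last by rewrite mul1r.
by rewrite !bfE.
Qed.

Lemma tnormal_dir B x u : bf B u u != 0 -> bf (fun=> 1) (tnormal B x u) u = 0.
Proof. by move=> b0; rewrite tnormalE; field. Qed.

Lemma tnormal_pt B x u : bf B u u != 0 -> Phi B x u = 0 ->
  bf (fun=> 1) (tnormal B x u) x = 1.
Proof.
move=> b0; rewrite /Phi tnormalE (bfC B u x) => /eqP; rewrite subr_eq0 => /eqP E.
by rewrite mulrAC -expr2 E; field.
Qed.

Lemma tnormal_neq0 B x u : bf B u u != 0 -> Phi B x u = 0 -> tnormal B x u != 0.
Proof.
move=> b0 P0; apply/eqP => N0; have := tnormal_pt b0 P0.
by rewrite N0 bf0l => /eqP; rewrite eq_sym oner_eq0.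
Qed.

Lemma dPx_tnormal B x u d : bf B u u != 0 ->
  dPx B x u d = - 2 * bf B u u * bf (fun=> 1) (tnormal B x u) d.
Proof. by move=> b0; rewrite tnormalE /dPx; field. Qed.

Lemma dPu_tnormal B x u d : bf B u u != 0 -> Phi B x u = 0 ->
  dPu B x u d = 2 * bf B x u * bf (fun=> 1) (tnormal B x u) d.
Proof.
move=> b0 PB.
have eB : bf B x x = bf B x u ^+ 2 / bf B u u + 1.
  by move/eqP: PB; rewrite subr_eq0 => /eqP ->; field.
by rewrite tnormalE /dPu eB; field.
Qed.

(** For the pseudo-Euclidean product two quadrics of the family tangent to
    the same line have orthogonal normals at the points of tangency, whether
    or not these points coincide. *)
Lemma tnormal_orth B P x u : pencil B P -> bf B u u != 0 -> bf P u u != 0 ->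
  Phi B x u = 0 -> Phi P x u = 0 -> bf s (tnormal B x u) (tnormal P x u) = 0.
Proof.
move=> pBP b0 p0 PB PP; have [dl E] := pencil_bf pBP.
rewrite /tnormal bf_wml bf_wmr E !bfE !(bfC _ u x).
have eB : bf B x x = bf B x u ^+ 2 / bf B u u + 1.
  by move/eqP: PB; rewrite subr_eq0 => /eqP ->; field.
have eP : bf P x x = bf P x u ^+ 2 / bf P u u + 1.
  by move/eqP: PP; rewrite subr_eq0 => /eqP ->; field.
by rewrite eB eP; field; rewrite b0 p0.
Qed.

(** The left side is the derivative of the discriminant with respect to the
    parameter of the family, because the weights 1 / (b k + s k mu) have
    derivative - s k B k ^+ 2.  Hence a tangent quadric is a simple root of
    the discriminant exactly when its normal is not null. *)
Lemma tnormal_sq B x u : bf B u u != 0 -> Phi B x u = 0 ->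
  dPB B x u (fun k => - s k * B k ^+ 2) =
  bf B u u * bf s (tnormal B x u) (tnormal B x u).
Proof.
move=> b0 PB.
have eB : bf B x x = bf B x u ^+ 2 / bf B u u + 1.
  by move/eqP: PB; rewrite subr_eq0 => /eqP ->; field.
rewrite /tnormal bf_wml bf_wmr !bfE.
have E y z : bf (fun k => - s k * B k ^+ 2) y z = - bf (fun k => s k * B k * B k) y z.
  by rewrite /bf -sumrN; apply: eq_bigr => k _; ring.
by rewrite /dPB !E eB (bfC _ u x); field.
Qed.

(** A Lagrangian subspace is isotropic.  The rows of G and P are the
    differentials in x and in u of m functions in involution, independent in
    u.  A motion (v, U) annihilated by all of them satisfies U = - S v for a
    matrix S that involution makes symmetric for the form s.  This is the
    reason why the eikonal form U . dx is closed on leaves. *)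
Lemma isotropy (G P : 'M[R]_m) (v U v' U' : V) :
  P \in unitmx ->
  (forall i j, bf s (row i G) (row j P) = bf s (row i P) (row j G)) ->
  (forall i, bf (fun=> 1) (row i G) v + bf (fun=> 1) (row i P) U = 0) ->
  (forall i, bf (fun=> 1) (row i G) v' + bf (fun=> 1) (row i P) U' = 0) ->
  bf s U v' = bf s U' v.
Proof.
move=> uP br h h'.
pose S : 'M[R]_m := diag_mx (\row_k s k).
have SS : S *m S = 1%:M.
  rewrite mulmx_diag; apply/matrixP => i j; rewrite !mxE; case: eqP => // _.
  by rewrite s2.
have bS x y : bf s x y = (x *m S *m y^T) 0 0.
  rewrite mxE; apply: eq_bigr => k _; rewrite mul_mx_diag !mxE; ring.
have b1 (M : 'M[R]_m) i x : bf (fun=> 1) (row i M) x = (x *m M^T) 0 i.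
  by rewrite mxE; apply: eq_bigr => k _; rewrite !mxE; ring.
have key (w W : V) : (forall i, bf (fun=> 1) (row i G) w + bf (fun=> 1) (row i P) W = 0) ->
    W = - (w *m (G^T *m invmx P^T)).
  move=> H; have : w *m G^T + W *m P^T = 0.
    by apply/rowP => i; rewrite mxE [RHS]mxE -!b1.
  move/eqP; rewrite addr_eq0 => /eqP E.
  by rewrite mulmxA E mulNmx opprK mulmxK // unitmx_tr.
have brM : G *m S *m P^T = P *m S *m G^T.
  apply/matrixP => i j; have := br i j; rewrite !bS.
  have E (M N : 'M[R]_m) : (row i M *m S *m (row j N)^T) 0 0 = (M *m S *m N^T) i j.
    rewrite -row_mul [LHS]mxE [RHS]mxE; apply: eq_bigr => k _.
    by congr (_ * _); rewrite [LHS]mxE // [RHS]mxE [LHS]mxE.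
  by rewrite !E.
set X := G^T *m invmx P^T in key.
have XS : X^T *m S = S *m X.
  rewrite /X trmx_mul trmxK -trmx_inv trmxK.
  have : invmx P *m (G *m S *m P^T) *m invmx P^T = invmx P *m (P *m S *m G^T) *m invmx P^T.
    by rewrite brM.
  rewrite !mulmxA mulmxK ?unitmx_tr // mulVmx // mul1mx => ->.
  by rewrite trmx_inv.
clearbody X.
have XS' : X *m S = S *m X^T.
  have := congr1 (fun M => S *m M *m S) XS.
  by rewrite /= !mulmxA SS mul1mx -[_ *m S *m S]mulmxA SS mulmx1 => ->.
rewrite (key _ _ h) (key _ _ h') !bfNl; congr (- _); rewrite !bS.
have tS : S^T = S by rewrite /S tr_diag_mx.
have -> : v *m X *m S *m v'^T = (v' *m X *m S *m v^T)^T.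
  by rewrite !trmx_mul trmxK tS -!mulmxA; congr (v *m _); rewrite !mulmxA XS'.
by rewrite mxE.
Qed.

End Forms.

(** * Counting the quadrics tangent to a null line *)

Section Spectral.
Variables (R : realType) (n : nat).
Local Notation m := n.+1.
Variables (s b : 'I_m -> R).
Hypothesis s2 : forall k, s k * s k = 1.
Local Notation V := 'rV[R]_m.

Definition qw (mu : R) (k : 'I_m) : R := (b k + s k * mu)^-1.
Definition adm (mu : R) : Prop := forall k, b k + s k * mu != 0.

Let s0 k : s k != 0.
Proof. by apply/eqP => E; have := s2 k; rewrite E mul0r => /eqP; rewrite eq_sym oner_eq0. Qed.

Lemma qw_pencil mu nu : mu != nu -> adm mu -> adm nu -> pencil s (qw mu) (qw nu).
Proof.
move=> mn am an; exists (mu - nu); first by rewrite subr_eq0.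
have mn0 : mu - nu != 0 by rewrite subr_eq0.
by move=> k; rewrite /qw; field; rewrite mn0 am an.
Qed.

Variables (x u : V).
Hypothesis u0 : bf s u u = 0.

Local Notation DX k := ('X + (s k * b k)%:P : {poly R}).
Let DXE k : DX k = 'X - (- (s k * b k))%:P.
Proof. by rewrite polyCN opprK. Qed.
Local Notation Pi := (\prod_k DX k).
Local Notation Pi1 i := (\prod_(k | k != i) DX k).
Local Notation Pi2 i j := (\prod_(k | (k != i) && (k != j)) DX k).
Let al : {poly R} := \sum_i (s i * x 0 i * u 0 i) *: Pi1 i.
Let be : {poly R} := \sum_i (s i * u 0 i * u 0 i) *: Pi1 i.
Let ga : {poly R} := \sum_i (s i * x 0 i * x 0 i) *: Pi1 i.

(** Up to the product of the denominators, Phi is a polynomial in the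
    parameter of the family.  The partial fraction expansion of the
    discriminant has no double poles, so that one factor of each denominator
    suffices; the sum over j <> i shows this. *)
Definition specpoly : {poly R} :=
  \sum_i (s i * u 0 i * u 0 i) *: Pi1 i + \sum_i \sum_(j | j != i)
    (s i * s j * (x 0 i * u 0 i * (x 0 j * u 0 j) - u 0 i ^+ 2 * x 0 j ^+ 2)) *: Pi2 i j.

Let Pi1E i : Pi = DX i * Pi1 i.
Proof. by rewrite (bigD1 i). Qed.

Let Pi12 i j : j != i -> Pi1 i * Pi1 j = Pi * Pi2 i j.
Proof.
move=> ji; rewrite (Pi1E i) (bigD1 j) //= (@bigD1 _ _ _ _ i (fun k => k != j)) /=; last first.
  by rewrite eq_sym.
have -> : Pi2 j i = Pi2 i j by apply: eq_bigl => k; rewrite andbC.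
by ring.
Qed.

(** The terms with i = j cancel in al ^+ 2 - be * ga, which leaves a
    multiple of the product Pi of all the linear factors. *)
Lemma specpolyE : Pi * specpoly = al ^+ 2 - be * (ga - Pi).
Proof.
have E : al * al - be * ga = Pi * \sum_i \sum_(j | j != i)
    (s i * s j * (x 0 i * u 0 i * (x 0 j * u 0 j) - u 0 i ^+ 2 * x 0 j ^+ 2)) *: Pi2 i j.
  rewrite /al /be /ga !big_distrlr -sumrB mulr_sumr; apply: eq_bigr => i _ /=.
  rewrite -sumrB mulr_sumr (bigD1 i) //= [X in X + _](_ : _ = 0) ?add0r; last first.
    by rewrite -!mul_polyC !polyCM; ring.
  apply: eq_bigr => j ji; rewrite -[RHS]scalerAr -Pi12 //.
  by rewrite -!mul_polyC !(polyCM, polyCB, expr2); ring.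
by rewrite /specpoly -/be mulrDr -E; ring.
Qed.

Lemma size_Pi2 i j : j != i -> (size (Pi2 i j) <= n)%N.
Proof.
move=> ji; apply: (leq_trans (size_prod_leq _ _)).
under eq_bigr do rewrite DXE size_XsubC.
rewrite sum_nat_const.
have : (#|[pred k | (k != i) && (k != j)]| + 2 = m)%N.
  rewrite -[RHS]card_ord -(cardC [pred k | (k != i) && (k != j)]); congr (_ + _)%N.
  rewrite (_ : 2 = #|pred2 i j|)%N; last by rewrite card2 eq_sym ji.
  by apply: eq_card => k; rewrite !inE negb_and !negbK.
have aux (c : nat) : (c + 2 = m -> (c * 2).+1 - c <= n)%N by lia.
exact: aux.
Qed.

Lemma size_Pi1 i : size (Pi1 i) = m.
Proof.
rewrite size_prod => [|k _]; last by rewrite DXE polyXsubC_eq0.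
under eq_bigr do rewrite DXE size_XsubC.
rewrite sum_nat_const.
have : (#|[pred k : 'I_m | k != i]| + 1 = m)%N.
  rewrite -[RHS]card_ord -(cardC [pred k | k != i]); congr (_ + _)%N.
  rewrite -(card1 i); apply: eq_card => k; rewrite !inE negbK //.
have aux (c : nat) : (c + 1 = m -> (c * 2).+1 - c = m)%N by lia.
exact: aux.
Qed.

(** Nullity of the direction kills the coefficient of degree n of the first
    sum.  So at most n - 1 quadrics are tangent to a null line, one fewer
    than to a general line. *)
Lemma size_specpoly : (size specpoly <= n)%N.
Proof.
apply: (leq_trans (size_polyD _ _)); rewrite geq_max; apply/andP; split; last first.
  apply: (leq_trans (size_sum _ _ _)); apply/bigmax_leqP => i _.
  apply: (leq_trans (size_sum _ _ _)); apply/bigmax_leqP => j ji.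
  by apply: (leq_trans (size_scale_leq _ _)); exact: size_Pi2.
apply/leq_sizeP => j; rewrite leq_eqVlt => /orP[/eqP <-|nj].
  rewrite coef_sum -[RHS]u0; apply: eq_bigr => i _; rewrite coefZ.
  have : Pi1 i \is monic by apply: monic_prod => k _; rewrite DXE monicXsubC.
  by rewrite monicE lead_coefE size_Pi1 /= => /eqP ->; rewrite mulr1.
rewrite coef_sum big1 // => i _; rewrite coefZ nth_default ?mulr0 //.
by rewrite size_Pi1.
Qed.

Section At.
Variable mu : R.
Hypothesis amu : adm mu.

Let D0 k : (DX k).[mu] != 0.
Proof.
rewrite !hornerE; have := amu k; apply: contra => /eqP E.
by rewrite -[b k]mul1r -(s2 k) -mulrA -mulrDr addrC E mulr0.
Qed.

Let qwE k : qw mu k = s k / (DX k).[mu].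
Proof.
rewrite /qw -[LHS]mul1r; apply/eqP; rewrite eqr_div ?D0 // !hornerE ?mul1r; apply/eqP.
have := s2 k; move: (s k) => t t2; ring: t2.
Qed.

Lemma Pi_neq0 : Pi.[mu] != 0.
Proof. by rewrite horner_prod; apply/prodf_neq0 => k _; exact: D0. Qed.

Let Pi1_at i : (Pi1 i).[mu] = Pi.[mu] / (DX i).[mu].
Proof. by rewrite (Pi1E i) hornerM mulrC mulKf. Qed.

Let bf_at (y z : V) :
  (\sum_i (s i * y 0 i * z 0 i) *: Pi1 i).[mu] = Pi.[mu] * bf (qw mu) y z.
Proof.
rewrite horner_sum /bf mulr_sumr; apply: eq_bigr => i _.
by rewrite hornerZ Pi1_at qwE; ring.
Qed.

Lemma specpoly_at : specpoly.[mu] = Pi.[mu] * Phi (qw mu) x u.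
Proof.
apply: (mulfI Pi_neq0); rewrite -hornerM specpolyE.
by rewrite expr2 !(hornerM, hornerD, hornerN) !bf_at /Phi; ring.
Qed.

(** The coefficients of the quadratic equation are the values of al, be and
    ga - Pi at mu, up to the nonzero factor Pi.[mu].  When the line lies in
    the quadric, mu is a root of all three. *)
Lemma specpoly_double : bf (qw mu) x u = 0 -> bf (qw mu) u u = 0 -> bf (qw mu) x x = 1 ->
  ('X - mu%:P) ^+ 2 %| specpoly.
Proof.
move=> a0 b0 c1.
have Pm : coprimep (('X - mu%:P) ^+ 2) Pi.
  by rewrite coprimep_expl // coprimep_sym coprimep_XsubC /root Pi_neq0.
rewrite -(Gauss_dvdpr _ Pm) specpolyE expr2.
have d (p : {poly R}) : p.[mu] = 0 -> 'X - mu%:P %| p.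
  by move=> h; rewrite dvdp_XsubCl /root h.
have a0' : 'X - mu%:P %| al by apply: d; rewrite bf_at a0 mulr0.
have b0' : 'X - mu%:P %| be by apply: d; rewrite bf_at b0 mulr0.
have c1' : 'X - mu%:P %| ga - Pi.
  by apply: d; rewrite hornerD hornerN bf_at c1 mulr1 subrr.
by apply: dvdp_sub; rewrite ?expr2; apply: dvdp_mul.
Qed.

End At.
End Spectral.

Section Roots.
Variables (R : realType) (n : nat).
Local Notation m := n.+1.
Variables (s b : 'I_m -> R).
Hypothesis s2 : forall k, s k * s k = 1.
Hypothesis b0 : forall k, 0 < b k.
Local Notation V := 'rV[R]_m.
Variables (x u : V).
Hypothesis u0 : bf s u u = 0.
Hypothesis un0 : u != 0.
Variable mu : 'I_n.-1 -> R.
Hypothesis mu_inj : injective mu.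
Local Notation Q := (qw s b).
Local Notation adm := (adm s b).
Hypothesis mu_tan : forall i, [/\ adm (mu i), Phi (Q (mu i)) x u = 0 &
  bf (Q (mu i)) u u = 0 -> bf (Q (mu i)) x x = 1].
Hypothesis tan_mu : forall c, adm c -> bf (Q c) u u != 0 -> Phi (Q c) x u = 0 ->
  exists i, c = mu i.

Let mu_uniq : uniq (codom mu).
Proof. by rewrite /codom /image_mem map_inj_uniq ?enum_uniq. Qed.

Let mu_size : size (codom mu) = n.-1.
Proof. by rewrite size_codom card_ord. Qed.

Let s_abs k : `|s k| = 1.
Proof.
have := s2 k; rewrite -expr2 => /eqP.
by rewrite sqrf_eq1 => /orP[] /eqP ->; rewrite ?normrN normr1.
Qed.

(** For small mu the quadric is an ellipsoid, for which bf (Q mu) u u is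
    positive.  Among n such values one is not the parameter of a tangent
    quadric. *)
Lemma exists_nu : exists nu, [/\ adm nu, 0 < bf (Q nu) u u & Phi (Q nu) x u != 0].
Proof.
pose B := \sum_k (b k)^-1 + 1.
have B1 : 1 <= B by rewrite /B lerDr sumr_ge0 // => k _; rewrite invr_ge0 ltW.
have B0 : 0 < B by apply: lt_le_trans B1.
(* B exceeds every 1 / b k, so that nu j < b k for all k. *)
pose nu (j : nat) := (B * j.+1%:R)^-1.
have nub j k : 0 < b k + s k * nu j.
  have bk : b k = ((b k)^-1)^-1 by rewrite invrK.
  have h : nu j < b k.
    rewrite bk /nu ltf_pV2 ?posrE ?invr_gt0 ?mulr_gt0 ?ltr0n //.
    apply: (@lt_le_trans _ _ B).
      rewrite /B (bigD1 k) //= -addrA ltrDl ltr_wpDl // sumr_ge0 // => i _.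
      by rewrite invr_ge0 ltW.
    by apply: ler_peMr; [exact: ltW|rewrite ler1n].
  have nu0 : 0 <= nu j by rewrite invr_ge0 mulr_ge0 ?ler0n // ltW.
  have : - `|s k * nu j| <= s k * nu j by rewrite lerNl -normrN ler_norm.
  by rewrite normrM s_abs mul1r (ger0_norm nu0) => h2; lra.
have anu j : adm (nu j) by move=> k; rewrite gt_eqF.
have bnu j : 0 < bf (Q (nu j)) u u.
  by apply: bf_ge0 => // k; rewrite /qw invr_gt0.
have nu_inj : injective nu.
  move=> i j /invr_inj /(mulfI (lt0r_neq0 B0)) /eqP; rewrite eqr_nat => /eqP.
  by move=> [].
have [/existsP [j Pj]|] := boolP [exists j : 'I_n.-1.+1, Phi (Q (nu j)) x u != 0].
  by exists (nu j).
rewrite negb_exists => /forallP H; exfalso.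
have sub : {subset [seq nu j | j : 'I_n.-1.+1] <= codom mu}.
  move=> c /mapP[j _ ->]; have := H j; rewrite negbK => /eqP P0.
  have [i ->] := tan_mu (anu j) (lt0r_neq0 (bnu j)) P0.
  exact: codom_f.
have U : uniq [seq nu j | j : 'I_n.-1.+1].
  by rewrite map_inj_uniq ?enum_uniq // => i j /nu_inj /val_inj.
have := uniq_leq_size U sub; rewrite mu_size size_map -cardE card_ord ltnn //.
Qed.

Let N := specpoly s b x u.

Lemma specpoly_neq0 : N != 0.
Proof.
have [nu [anu _ P0]] := exists_nu; apply/eqP => N0.
have := specpoly_at s2 x u anu; rewrite -/N N0 horner0 => /eqP.
by rewrite eq_sym mulf_eq0 (negbTE (Pi_neq0 s2 anu)) (negbTE P0).
Qed.

Lemma root_specpoly c : adm c -> Phi (Q c) x u = 0 -> root N c.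
Proof. by move=> ac P0; rewrite /root /N specpoly_at // P0 mulr0. Qed.

Lemma all_roots : all (root N) (codom mu).
Proof.
apply/allP => c /codomP[i ->]; have [ai P0 _] := mu_tan i.
exact: root_specpoly.
Qed.

(** The polynomial already has n - 1 roots mu i, the most that its degree
    permits. *)
Lemma root_is_mu c : adm c -> Phi (Q c) x u = 0 -> exists i, c = mu i.
Proof.
move=> ac P0; have [/codomP //|cmu] := boolP (c \in codom mu).
have := @max_poly_roots _ N (c :: codom mu) specpoly_neq0.
rewrite /= all_roots root_specpoly // cmu mu_uniq => /(_ isT isT).
rewrite mu_size => h; have := @size_specpoly R n s b x u u0; rewrite -/N.
have aux (k z : nat) : (k.-1.+1 < z -> z <= k -> False)%N by case: k => /= [|k]; lia.
by move=> h2; case: (aux _ _ h h2).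
Qed.

(** None of the quadrics contains the line or touches it at infinity:
    otherwise mu i would be a double root, one more than the degree permits. *)
Lemma tangent_dir_neq0 i : bf (Q (mu i)) u u != 0.
Proof.
apply/eqP => be0; have [ai P0 /(_ be0) ga0] := mu_tan i.
have al0 : bf (Q (mu i)) x u = 0.
  by move: P0; rewrite /Phi be0 mul0r subr0 => /eqP; rewrite sqrf_eq0 => /eqP.
have := specpoly_double s2 ai al0 be0 ga0; rewrite -/N expr2 => /dvdpP[M NE].
pose M' := M * ('X - (mu i)%:P).
have {}NE : N = M' * ('X - (mu i)%:P) by rewrite /M' -mulrA.
have M0 : M' != 0 by apply/eqP => M0; have := specpoly_neq0; rewrite NE M0 mul0r eqxx.
have rM : all (root M') (codom mu).
  apply/allP => c /codomP[j ->]; have [->|ji] := eqVneq j i.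
    by rewrite /M' rootM root_XsubC eqxx orbT.
  have /allP /(_ (mu j) (codom_f mu j)) := all_roots.
  by rewrite NE rootM root_XsubC (inj_eq mu_inj) (negbTE ji) orbF.
have := max_poly_roots M0 rM mu_uniq; rewrite mu_size.
have := @size_specpoly R n s b x u u0; rewrite -/N NE size_mul ?polyXsubC_eq0 //.
rewrite size_XsubC => h h2.
have aux (k z : nat) : ((z + 2).-1 <= k -> k.-1 < z -> False)%N by case: k => /= [|k]; lia.
exact: aux h h2.
Qed.

End Roots.

(** * The manifold of null lines and its foliation by common tangent quadrics *)

Section BfCalc.
Variables (R : realType) (m : nat) (Z : normedModType R).
Local Notation V := 'rV[R]_m.

Lemma has_diff_bf (B : 'I_m -> Z -> R^o) (x y : Z -> V) z w dB dx dy :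
  (forall k, has_diff (B k) z w (dB k)) -> has_diff x z w dx -> has_diff y z w dy ->
  has_diff (fun z => bf (B^~ z) (x z) (y z) : R^o) z w
    (bf dB (x z) (y z) + bf (B^~ z) dx (y z) + bf (B^~ z) (x z) dy).
Proof.
move=> hB hx hy.
rewrite /bf -!big_split; apply: has_diff_sum => k _ /=.
apply: has_diff_eq; first apply: has_diff_mul; first apply: has_diff_mul.
- exact: hB.
- exact: has_diff_coord hx.
- exact: has_diff_coord hy.
- by rewrite /=; ring.
Qed.

Lemma has_diff_bfc (B : 'I_m -> R) (x y : Z -> V) z w dx dy :
  has_diff x z w dx -> has_diff y z w dy ->
  has_diff (fun z => bf B (x z) (y z) : R^o) z w (bf B dx (y z) + bf B (x z) dy).
Proof.
move=> hx hy; apply: has_diff_eq.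
  by apply: (@has_diff_bf (fun k _ => B k)) hx hy => k; exact: has_diff_cst.
rewrite [X in X + _ + _]big1 ?add0r // => k _; by rewrite !mul0r.
Qed.

Lemma has_diff_Phi (B : 'I_m -> Z -> R^o) (x u : Z -> V) z w dB dx du :
  (forall k, has_diff (B k) z w (dB k)) -> has_diff x z w dx -> has_diff u z w du ->
  has_diff (fun z => Phi (B^~ z) (x z) (u z) : R^o) z w
    (dPB (B^~ z) (x z) (u z) dB + dPx (B^~ z) (x z) (u z) dx
     + dPu (B^~ z) (x z) (u z) du).
Proof.
move=> hB hx hu; apply: has_diff_eq.
  apply: has_diff_sub; first by apply: has_diff_sqr; exact: (has_diff_bf hB hx hu).
  apply: has_diff_mul; first exact: (has_diff_bf hB hu hu).
  by apply: has_diff_sub; [exact: (has_diff_bf hB hx hx)|exact: has_diff_cst].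
rewrite /dPB /dPx /dPu (bfC _ dx (u z)) (bfC _ dx (x z)) (bfC _ du (u z)).
by ring.
Qed.

Lemma has_diff_Phic (B : 'I_m -> R) (x u : Z -> V) z w dx du :
  has_diff x z w dx -> has_diff u z w du ->
  has_diff (fun z => Phi B (x z) (u z) : R^o) z w
    (dPx B (x z) (u z) dx + dPu B (x z) (u z) du).
Proof.
move=> hx hu; apply: has_diff_eq.
  by apply: (@has_diff_Phi (fun k _ => B k)) hx hu => k; exact: has_diff_cst.
have E y y' : bf (fun _ : 'I_m => 0 : R) y y' = 0.
  by rewrite /bf big1 // => k _; rewrite !mul0r.
by rewrite /dPB !E; ring.
Qed.

Variable O : set Z.
Hypothesis oO : open O.

Lemma Ck_bf k (B : 'I_m -> Z -> R^o) (x y : Z -> V) :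
  (forall i, Ck k O (B i)) -> Ck k O x -> Ck k O y ->
  Ck k O (fun z => bf (B^~ z) (x z) (y z) : R^o).
Proof.
move=> CB Cx Cy; apply: Ck_sum => // i _; apply: Ck_mul => //; last exact: Ck_coord.
by apply: Ck_mul => //; exact: Ck_coord.
Qed.

Lemma Ck_bfc k (B : 'I_m -> R) (x y : Z -> V) : Ck k O x -> Ck k O y ->
  Ck k O (fun z => bf B (x z) (y z) : R^o).
Proof. by move=> Cx Cy; apply: (@Ck_bf k (fun i _ => B i)) => // i; exact: Ck_cst. Qed.

Lemma Ck_Phic k (B : 'I_m -> R) (x y : Z -> V) : Ck k O x -> Ck k O y ->
  Ck k O (fun z => Phi B (x z) (y z) : R^o).
Proof.
move=> Cx Cy; apply: Ck_subr => //.
  by rewrite /=; apply: (@Ck_mul _ _ _ oO k (fun z => bf B (x z) (y z))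
    (fun z => bf B (x z) (y z))); exact: Ck_bfc.
apply: Ck_mul => //; first exact: Ck_bfc.
by apply: Ck_subr => //; [exact: Ck_bfc|exact: Ck_cst].
Qed.

Lemma Ck_wm k (B : 'I_m -> R) (x : Z -> V) : Ck k O x -> Ck k O (fun z => wm B (x z)).
Proof.
move=> Cx; apply: Ck_row => // j.
apply: (@Ck_ext _ _ _ _ _ (fun z => B j * x z 0 j : R^o)) => //.
  by move=> z _; rewrite mxE.
by apply: Ck_mul => //; [exact: Ck_cst|exact: Ck_coord].
Qed.

Lemma Ck_scalev k (f : Z -> R^o) (x : Z -> V) : Ck k O f -> Ck k O x ->
  Ck k O (fun z => f z *: x z).
Proof.
move=> Cf Cx; apply: Ck_row => // j.
apply: (@Ck_ext _ _ _ _ _ (fun z => f z * x z 0 j : R^o)) => //.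
  by move=> z _; rewrite mxE.
by apply: Ck_mul => //; exact: Ck_coord.
Qed.

End BfCalc.

Lemma has_diff_scalev (R : realType) (m : nat) (Z : normedModType R)
  (f : Z -> R^o) (x : Z -> 'rV[R]_m) z w (df : R) dx :
  has_diff f z w df -> has_diff x z w dx ->
  has_diff (fun z => f z *: x z) z w (df *: x z + f z *: dx).
Proof.
move=> hf hx; apply: has_diff_row => j.
rewrite (_ : (fun _ => _) = fun z => (f z * x z 0 j : R^o)); last first.
  by apply/funext => y; rewrite mxE.
apply: has_diff_eq; first by apply: has_diff_mul; [exact: hf|exact: has_diff_coord hx].
by rewrite !mxE; ring.
Qed.

Section NullLines.
Variables (R : realType) (n p : nat) (a : 'I_n.+1 -> R).
Hypothesis ha : forall i, 0 < a i.
Local Notation m := n.+1.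
Local Notation V := 'rV[R]_m.
Local Notation s := (@sgn R m p).
Local Notation b := (fun k => a k ^+ 2).
Local Notation Q := (qw s b).
Local Notation M := (@nullLines R m p).
Local Notation TM := (@tgNull R m p).
Local Notation I1 := (fun=> (1 : R)).
Implicit Types (l w z : V * V).

Lemma s2 k : s k * s k = 1.
Proof. by rewrite /sgn; case: ifP => _; ring. Qed.

Lemma dotE (x y : V) : dot x y = bf I1 x y.
Proof. by apply: eq_bigr => k _; rewrite mul1r. Qed.

Lemma EmapE (x : V) : Emap p x = wm s x.
Proof. by apply/rowP => k; rewrite !mxE. Qed.

Lemma pdotE (x y : V) : pdot p x y = bf s x y.
Proof.
by rewrite /pdot dotE EmapE bf_wml; apply: bf_ext => k; rewrite mul1r.
Qed.

Lemma BmapE mu (x : V) : Bmap p a mu x = wm (Q mu) x.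
Proof. by apply/rowP => k; rewrite !mxE mulrC. Qed.

Lemma AmapE (x : V) : Amap a x = wm (Q 0) x.
Proof. by apply/rowP => k; rewrite !mxE /qw mulr0 addr0 mulrC. Qed.

Lemma wm1 B (x y : V) : bf I1 (wm B x) y = bf B x y.
Proof. by rewrite bf_wml; apply: bf_ext => k; rewrite mul1r. Qed.

Lemma wm1r B (x y : V) : bf I1 x (wm B y) = bf B x y.
Proof. by rewrite bfC wm1 bfC. Qed.

Lemma wmss (x y : V) : bf s x (wm s y) = bf I1 x y.
Proof. by rewrite bf_wmr; apply: bf_ext => i; rewrite s2. Qed.

Lemma dot_Bmap mu (x y : V) : dot (Bmap p a mu x) y = bf (Q mu) x y.
Proof. by rewrite dotE BmapE wm1. Qed.

Lemma dot_Amap (x y : V) : dot (Amap a x) y = bf (Q 0) x y.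
Proof. by rewrite dotE AmapE wm1. Qed.

Lemma adm0 : adm s b 0.
Proof. by move=> k; rewrite mulr0 addr0 sqrf_eq0 gt_eqF. Qed.

Lemma Q0_gt0 k : 0 < Q 0 k.
Proof. by rewrite /qw mulr0 addr0 invr_gt0 exprn_gt0. Qed.

Lemma nullLinesP l : M l <-> [/\ bf I1 l.2 l.2 = 1, bf I1 l.1 l.2 = 0 & bf s l.2 l.2 = 0].
Proof. by rewrite /nullLines /= !dotE pdotE. Qed.

Lemma has_diff_l1 l w : has_diff (fun z : V * V => z.1) l w w.1.
Proof. by apply: has_diff_fst; exact: has_diff_id. Qed.

Lemma has_diff_l2 l w : has_diff (fun z : V * V => z.2) l w w.2.
Proof. by apply: has_diff_snd; exact: has_diff_id. Qed.

Lemma tgNullP l w : TM l w <->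
  [/\ bf I1 l.2 w.2 = 0, bf I1 w.1 l.2 + bf I1 l.1 w.2 = 0 & bf s l.2 w.2 = 0].
Proof.
have e1 : (fun z : V * V => dot z.2 z.2 : R^o) = fun z => bf I1 z.2 z.2.
  by apply/funext => z; rewrite dotE.
have e2 : (fun z : V * V => dot z.1 z.2 : R^o) = fun z => bf I1 z.1 z.2.
  by apply/funext => z; rewrite dotE.
have e3 : (fun z : V * V => pdot p z.2 z.2 : R^o) = fun z => bf s z.2 z.2.
  by apply/funext => z; rewrite pdotE.
have [_ h1] := has_diff_bfc I1 (has_diff_l2 l w) (has_diff_l2 l w).
have [_ h2] := has_diff_bfc I1 (has_diff_l1 l w) (has_diff_l2 l w).
have [_ h3] := has_diff_bfc s (has_diff_l2 l w) (has_diff_l2 l w).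
rewrite -e1 (bfC I1 w.2) in h1; rewrite -e2 in h2; rewrite -e3 (bfC s w.2) in h3.
split=> [[t1 t2 t3]|[t1 t2 t3]].
  have {}t1 := etrans (esym h1) t1; have {}t2 := etrans (esym h2) t2.
  have {}t3 := etrans (esym h3) t3; clear h1 h2 h3.
  by split; [lra|exact: t2|lra].
split; [apply: (etrans h1)|exact: (etrans h2)|apply: (etrans h3)].
  by rewrite t1 addr0.
by rewrite t3 addr0.
Qed.

Lemma contactNullP l w : contactNull p l w <-> (TM l w /\ bf s l.2 w.1 = 0).
Proof. by rewrite /contactNull /= pdotE. Qed.

Lemma M_u0 l : M l -> l.2 != 0.
Proof.
move=> /nullLinesP[h _ _]; apply/eqP => u0; move: h; rewrite u0 bf0l => /eqP.
by rewrite eq_sym oner_eq0.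
Qed.

(** Add t w to the line, then restore the three equations: on the
    coordinates with sign + and on those with sign - the direction is
    divided by its new length relative to that block, which restores nullity
    and unit length together, and the base point is projected orthogonally
    to the direction.  These corrections are of order 2 in t because w is
    tangent to M. *)
Lemma M_curve l w : M l -> TM l w ->
  exists g : R^o -> V * V, [/\ g 0 = l, has_diff g 0 1 w & forall t, M (g t)].
Proof.
case: l w => x v [dx dv] /nullLinesP[/= v1 xv nv] /tgNullP[/= vdv tx ndv].
(* r k t is the squared length of the block of k, relative to its initial
   value 1/2: the block of sign e of dv has squared length (A + e S) / 2. *)
pose A := bf I1 dv dv; pose S := bf s dv dv.
pose r (k : 'I_m) (t : R) : R := 1 + t ^+ 2 * (A + s k * S).
have AS e : e * e = 1 -> 0 <= A + e * S.
  move=> e2; rewrite /A /S /bf mulr_sumr -big_split sumr_ge0 // => k _ /=.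
  rewrite (_ : _ + _ = (1 + e * s k) * dv 0 k ^+ 2); last by ring.
  rewrite mulr_ge0 ?sqr_ge0 //.
  have : (e * s k) ^+ 2 = 1 by rewrite exprMn !expr2 e2 s2 mulr1.
  by move: (e * s k) => q q2; nra.
have r1 e t : e * e = 1 -> 0 < 1 + t ^+ 2 * (A + e * S).
  by move=> e2; have := AS e e2; have := sqr_ge0 t; nra.
have r0 k t : 0 < r k t by exact/r1/s2.
pose u (t : R) : V := \row_k ((Num.sqrt (r k t))^-1 * (v 0 k + t * dv 0 k)).
pose y (t : R) : V := x + t *: dx.
pose g (t : R^o) : V * V := (y t - bf I1 (y t) (u t) *: u t, u t).
have rt k : r k 0 = 1 by rewrite /r expr0n /= mul0r addr0.
have u0 : u 0 = v.
  by apply/rowP => k; rewrite !mxE rt // sqrtr1 invr1 mul1r mul0r addr0.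
have y0 : y 0 = x by rewrite /y scale0r addr0.
have bfu W t : bf W (u t) (u t) =
    \sum_k W k * (v 0 k + t * dv 0 k) ^+ 2 / r k t.
  apply: eq_bigr => k _; rewrite !mxE.
  rewrite -[in RHS](@sqr_sqrtr _ (r k t)) ?ltW //.
  by field; rewrite gt_eqF // sqrtr_gt0.
pose rp t := 1 + t ^+ 2 * (A + 1 * S); pose rm t := 1 + t ^+ 2 * (A + - 1 * S).
have rp0 t : rp t != 0 by rewrite gt_eqF // r1 // mul1r.
have rm0 t : rm t != 0 by rewrite gt_eqF // r1 // mulrNN mul1r.
(* The two values of 1 / r k t combined into an affine function of the sign
   s k, so that the sums over the blocks become values of the forms bf I1
   and bf s. *)
have rinv k t : (r k t)^-1 = ((rp t)^-1 + (rm t)^-1) / 2 + s k * (((rp t)^-1 - (rm t)^-1) / 2).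
  have E : r k t = if (k < p)%N then rp t else rm t by rewrite /r /rp /rm /sgn; case: ifP.
  by rewrite E /sgn; case: ifP => _; field; rewrite ?rp0 ?rm0.
have z1 t : \sum_k (v 0 k + t * dv 0 k) ^+ 2 = 1 + t ^+ 2 * A.
  transitivity (bf I1 (v + t *: dv) (v + t *: dv)).
    by apply: eq_bigr => k _; rewrite !mxE mul1r expr2.
  by rewrite !bfE v1 vdv (bfC _ dv v) vdv -/A; ring.
have zs t : \sum_k s k * (v 0 k + t * dv 0 k) ^+ 2 = t ^+ 2 * S.
  transitivity (bf s (v + t *: dv) (v + t *: dv)).
    by apply: eq_bigr => k _; rewrite !mxE expr2 mulrA.
  by rewrite !bfE nv ndv (bfC _ dv v) ndv -/S; ring.
have eA t : 1 + t ^+ 2 * A = (rp t + rm t) / 2 by rewrite /rp /rm; field.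
have eS t : t ^+ 2 * S = (rp t - rm t) / 2 by rewrite /rp /rm; field.
have uu t : bf I1 (u t) (u t) = 1.
  rewrite bfu.
  under eq_bigr => k _ do rewrite mul1r rinv mulrDr.
  rewrite big_split /= -mulr_suml z1.
  under eq_bigr => k _ do rewrite mulrA [_ * s k]mulrC.
  rewrite -mulr_suml zs eA eS; have := rp0 t; have := rm0 t.
  by move: (rp t) (rm t) => P N h1 h2; field; rewrite h1 h2.
have us t : bf s (u t) (u t) = 0.
  rewrite bfu.
  under eq_bigr => k _ do rewrite rinv mulrDr.
  rewrite big_split /= -mulr_suml zs.
  under eq_bigr => k _ do rewrite mulrACA s2 mul1r.
  rewrite -mulr_suml z1 eA eS; have := rp0 t; have := rm0 t.
  by move: (rp t) (rm t) => P N h1 h2; field; rewrite h1 h2.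
exists g; split.
- by rewrite /g u0 y0 xv scale0r subr0.
- have hr k : has_diff (r k : R^o -> R^o) 0 1 0.
    apply: has_diff_eq.
      apply: has_diff_add; first exact: has_diff_cst.
      apply: has_diff_mul; last exact: has_diff_cst.
      by apply: has_diff_sqr; exact: has_diff_id.
    by rewrite /=; ring.
  have hu : has_diff (u : R^o -> V) 0 1 dv.
    apply: has_diff_row => k.
    rewrite (_ : (fun _ => _) = fun t : R^o => ((Num.sqrt (r k t))^-1 * (v 0 k + t * dv 0 k) : R^o)).
      apply: has_diff_eq.
        apply: has_diff_mul.
          apply: has_diff_inv; last by apply: has_diff_sqrt; [exact: r0|exact: hr].
          by rewrite gt_eqF // sqrtr_gt0.
        apply: has_diff_add; first exact: has_diff_cst.
        by apply: has_diff_mul; [exact: has_diff_id|exact: has_diff_cst].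
      by rewrite /= !rt sqrtr1 invr1; ring.
    by apply/funext => t; rewrite mxE.
  have hy : has_diff (y : R^o -> V) 0 1 dx.
    apply: has_diff_eq.
      apply: has_diff_add; first exact: has_diff_cst.
      by apply: (@has_diff_scalel R R^o V id dx); exact: has_diff_id.
    by rewrite add0r scale1r.
  apply: has_diff_pair; last exact: hu.
  apply: has_diff_eq.
    apply: has_diff_sub; first exact: hy.
    by apply: has_diff_scalev; [exact: (has_diff_bfc I1 hy hu)|exact: hu].
  by rewrite /= u0 y0 tx xv !scale0r addr0 subr0.
- move=> t; apply/nullLinesP; split=> //=.
  by rewrite !bfE uu mulr1 subrr.
Qed.

(** This transfers an identity between functions on M, such as Phi (Q (mu i
    l)) l.1 l.2 = 0, to an identity between their differentials on tangent
    vectors of M. *)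
Lemma M_const (F : normedModType R) (f : V * V -> F) l w d c : M l -> TM l w ->
  (\forall z \near l, M z -> f z = c) -> has_diff f l w d -> d = 0.
Proof.
move=> Ml Tw fc hf; have [g [g0 hg gM]] := M_curve Ml Tw.
rewrite -g0 in hf.
have h1 := has_diff_comp hg hf.
have h2 : has_diff (fun t : R^o => f (g t)) 0 1 0.
  apply: has_diff_near (has_diff_cst c (0 : R^o) 1).
  have cg : g @ (0 : R^o) --> g 0 by apply: differentiable_continuous; case: hg.
  rewrite g0 in cg.
  have H : \forall t \near (0 : R^o), M (g t) -> f (g t) = c := cg _ fc.
  by near=> t; symmetry; apply: (near H t) => //; exact: gM.
exact: has_diff_fun h1 h2.
Unshelve. all: by end_near.
Qed.

Definition dPhi B l w : R := dPx B l.1 l.2 w.1 + dPu B l.1 l.2 w.2.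

Lemma has_diff_Phil B l w : has_diff (fun z : V * V => Phi B z.1 z.2 : R^o) l w (dPhi B l w).
Proof. exact: (has_diff_Phic B (has_diff_l1 l w) (has_diff_l2 l w)). Qed.

Lemma tangent_toP l c : tangent_to p a l c ->
  [/\ adm s b c, Phi (Q c) l.1 l.2 = 0 &
    bf (Q c) l.2 l.2 = 0 -> bf (Q c) l.1 l.1 = 1].
Proof.
move=> [ac [t]]; rewrite /= !dot_Bmap => -[].
rewrite !bfE (bfC _ l.2 l.1) => h1 h2; split=> //.
- rewrite /Phi; move: (bf _ l.1 l.1) (bf _ l.1 l.2) (bf _ l.2 l.2) h1 h2 => X Y Z0 h1 h2.
  have -> : Y = - (t * Z0) by lra.
  have -> : X = 1 - t * Y - t * (Y + t * Z0) by lra.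
  have -> : Y = - (t * Z0) by lra.
  ring.
- by move=> h3; move: h1 h2; rewrite h3; nra.
Qed.

Lemma tangent_toI l c : adm s b c -> bf (Q c) l.2 l.2 != 0 ->
  Phi (Q c) l.1 l.2 = 0 -> tangent_to p a l c.
Proof.
move=> ac b0 P0; split=> //; exists (- (bf (Q c) l.1 l.2 / bf (Q c) l.2 l.2)).
rewrite /= !dot_Bmap !bfE (bfC _ l.2 l.1); split; last by field.
move/eqP: P0; rewrite /Phi subr_eq0 => /eqP P0.
have -> : bf (Q c) l.1 l.1 = bf (Q c) l.1 l.2 ^+ 2 / bf (Q c) l.2 l.2 + 1.
  by rewrite P0; field.
by field.
Qed.

Section Chart.
Variables (O : set (V * V)) (mu : 'I_n.-1 -> V * V -> R).
Hypothesis ch : confocal_chart p a O mu.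
Variable z : V * V.
Hypotheses (Oz : O z) (Mz : M z).

Let b0 k : 0 < b k. Proof. exact: exprn_gt0. Qed.

Let chz : [/\ injective (fun i => mu i z),
            forall c, tangent_to p a z c <-> exists i, c = mu i z &
            submersion_at TM mu z].
Proof. by case: ch => _ _; apply. Qed.

Let inj : injective (fun i => mu i z). Proof. by case: chz. Qed.
Let tanz c : tangent_to p a z c <-> exists i, c = mu i z. Proof. by case: chz. Qed.

Lemma chart_tan i : tangent_to p a z (mu i z).
Proof. by apply/tanz; exists i. Qed.

Let mu_tan i := tangent_toP (chart_tan i).
Let tan_mu c : adm s b c -> bf (Q c) z.2 z.2 != 0 -> Phi (Q c) z.1 z.2 = 0 ->
  exists i, c = mu i z.
Proof. by move=> ac bc P0; apply/tanz; exact: tangent_toI. Qed.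

Let u0 : bf s z.2 z.2 = 0. Proof. by case/nullLinesP: Mz. Qed.
Let un0 : z.2 != 0. Proof. exact: M_u0. Qed.

Lemma chart_be i : bf (Q (mu i z)) z.2 z.2 != 0.
Proof. exact: (tangent_dir_neq0 s2 b0 u0 un0 inj mu_tan tan_mu). Qed.

Lemma chart_adm i : adm s b (mu i z).
Proof. by case: (mu_tan i). Qed.

Lemma chart_Phi i : Phi (Q (mu i z)) z.1 z.2 = 0.
Proof. by case: (mu_tan i). Qed.

Lemma chart_root c : adm s b c -> Phi (Q c) z.1 z.2 = 0 -> exists i, c = mu i z.
Proof. exact: (root_is_mu s2 b0 u0 un0 inj mu_tan tan_mu). Qed.

Lemma chart_nu : exists nu, [/\ adm s b nu, 0 < bf (Q nu) z.2 z.2 &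
  Phi (Q nu) z.1 z.2 != 0].
Proof. exact: (exists_nu s2 b0 un0 tan_mu). Qed.

Lemma has_diff_qw (c : V * V -> R^o) l w (dc : R) k : adm s b (c l) -> has_diff c l w dc ->
  has_diff (fun z => Q (c z) k : R^o) l w (- s k * Q (c l) k ^+ 2 * dc).
Proof.
move=> ac hc; apply: has_diff_eq.
  apply: has_diff_inv; first exact: ac.
  by apply: has_diff_add; [exact: has_diff_cst|apply: has_diff_scale; exact: hc].
by rewrite /qw exprVn; ring.
Qed.

Let D i := dPB (Q (mu i z)) z.1 z.2 (fun k => - s k * Q (mu i z) k ^+ 2).

(** Differentiate Phi (Q (mu i l)) l.1 l.2 = 0 along M. *)
Lemma chart_dmu i w : TM z w ->
  D i * 'd (mu i : V * V -> R^o) z w + dPhi (Q (mu i z)) z w = 0.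
Proof.
move=> Tw; case: (ch) => oO sm chO.
have hm : has_diff (mu i : V * V -> R^o) z w ('d (mu i : V * V -> R^o) z w).
  by case: (sm i) => _ /(_ 1%N) C; exact: (Ck_hasd w C Oz).
have h := has_diff_Phi (fun k => has_diff_qw k (chart_adm i) hm) (has_diff_l1 z w) (has_diff_l2 z w).
have := M_const (c := 0) Mz Tw _ h.
rewrite /dPhi addrA => <-; last first.
  have : \forall l \near z, O l by move: oO; rewrite openE; apply.
  apply: filterS => l Ol Ml; have [_ tl _] := chO l Ol Ml.
  by have /tangent_toP[] : tangent_to p a l (mu i l) by apply/tl; exists i.
congr (_ + _ + _); rewrite /D /dPB.
set q := 'd _ _ _.
have E x y : bf (fun k => - s k * Q (mu i z) k ^+ 2 * q) x y =
  q * bf (fun k => - s k * Q (mu i z) k ^+ 2) x y.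
  by rewrite /bf mulr_sumr; apply: eq_bigr => k _; ring.
by rewrite !E; ring.
Qed.

(** If the derivative with respect to the parameter vanished, so would dPhi
    on all of the tangent space.  But displacing the line parallelly along
    the normal at the point of tangency changes Phi. *)
Lemma chart_D i : D i != 0.
Proof.
apply/eqP => D0.
pose N := tnormal (Q (mu i z)) z.1 z.2.
have Tw : TM z (N, 0).
  apply/tgNullP; rewrite /= !bf0r addr0; split=> //.
  exact: tnormal_dir (chart_be i).
have := chart_dmu i Tw; rewrite D0 mul0r add0r /dPhi /=.
rewrite (dPx_tnormal _ _ (chart_be i)) -/N /dPu !bf0r !mulr0 subrr mulr0 addr0.
move/eqP; rewrite !mulf_eq0 oppr_eq0 pnatr_eq0 /= (negbTE (chart_be i)) /=.
move/eqP/bf1_eq0/eqP; apply/negP.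
exact: (tnormal_neq0 (chart_be i) (chart_Phi i)).
Qed.

(** With tnormal_sq this says that all the n - 1 roots are simple. *)
Lemma chart_N i : bf s (tnormal (Q (mu i z)) z.1 z.2) (tnormal (Q (mu i z)) z.1 z.2) != 0.
Proof.
have := chart_D i; rewrite /D (tnormal_sq s (chart_be i) (chart_Phi i)).
by rewrite mulf_eq0 negb_or => /andP[].
Qed.

Lemma chart_dmu0 i w : TM z w ->
  ('d (mu i : V * V -> R^o) z w = 0) <-> (dPhi (Q (mu i z)) z w = 0).
Proof.
move=> /(chart_dmu i) E; split=> h; rewrite h in E.
  by move: E; rewrite mulr0 add0r.
by move/eqP: E; rewrite addr0 mulf_eq0 (negbTE (chart_D i)) => /eqP.
Qed.

Lemma chart_tanE c : tangent_to p a z c <-> (adm s b c /\ Phi (Q c) z.1 z.2 = 0).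
Proof.
split=> [/tangent_toP[ac P0 _]|[ac P0]]; first by [].

by have [i ->] := chart_root ac P0; exact: chart_tan.
Qed.

End Chart.

(** The tangent space of the foliation is given by the discriminants of the
    tangent quadrics with fixed parameters, without reference to a chart. *)
Lemma tgF_discr l w : foliated p a n.-1 l ->
  tgF p a n.-1 l w <-> (TM l w /\ forall c, adm s b c ->
    Phi (Q c) l.1 l.2 = 0 -> dPhi (Q c) l w = 0).
Proof.
move=> [Ml [W0 [mu [Ol ch]]]]; split.
  move=> [Tw [W [mu' [Ol' ch' H]]]]; split=> // c ac P0.
  have [i ->] := chart_root ch' Ol' Ml ac P0.
  by apply/(chart_dmu0 ch' Ol' Ml i Tw); exact: H.
move=> [Tw H]; split=> //; exists W0, mu; split=> // i.
apply/(chart_dmu0 ch Ol Ml i Tw); apply: H.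
  exact: (chart_adm ch).
exact: (chart_Phi ch).
Qed.

Lemma TF_chart O (mu : 'I_n.-1 -> V * V -> R) l w : confocal_chart p a O mu ->
  O l -> M l -> tgF p a n.-1 l w <->
    (TM l w /\ forall i, 'd (mu i : V * V -> R^o) l w = 0).
Proof.
move=> ch Ol Ml; rewrite tgF_discr; last by split=> //; exists O, mu.
split=> -[Tw H]; split=> //.
  move=> i; apply/(chart_dmu0 ch Ol Ml i Tw); apply: H.
    exact: (chart_adm ch).
  exact: (chart_Phi ch).
move=> c ac P0; have [i ->] := chart_root ch Ol Ml ac P0.
by apply/(chart_dmu0 ch Ol Ml i Tw).
Qed.

Lemma fol_tanE l c : foliated p a n.-1 l ->
  tangent_to p a l c <-> (adm s b c /\ Phi (Q c) l.1 l.2 = 0).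
Proof. by move=> [Ml [W0 [mu [Ol ch]]]]; exact: (chart_tanE ch). Qed.

End NullLines.

(** * The eikonal function of a leaf *)

Lemma open_near (T : topologicalType) (O : set T) :
  (forall x, O x -> \forall y \near x, O y) -> open O.
Proof. by move=> H; rewrite openE => x /H. Qed.

Lemma near_of_open (T : topologicalType) (O : set T) x : open O -> O x -> \forall y \near x, O y.
Proof. by rewrite openE => oO Ox; exact: oO. Qed.

Lemma Ck_near_lt (R : realType) (E : normedModType R) (O : set E) (f : E -> R^o) (c : R) x :
  Ck 0 O f -> O x -> c < f x -> \forall y \near x, c < f y.
Proof. by move=> cf Ox lt; exact: (@cvgr_gt R E (nbhs x) _ f (f x) (cf x Ox) c lt). Qed.

Lemma Ck_near_neq (R : realType) (E : normedModType R) (O : set E) (f : E -> R^o) x :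
  Ck 0 O f -> O x -> f x != 0 -> \forall y \near x, f y != 0.
Proof. by move=> cf Ox lt; exact: (@cvgr_neq0 _ R^o E (nbhs x) _ f (f x) (cf x Ox) lt). Qed.

Section Transversal.
Variables (R : realType) (k p : nat) (a : 'I_k.+2 -> R).
Hypothesis ha : forall i, 0 < a i.
Local Notation m := k.+2.
Local Notation n := k.+1.
Local Notation V := 'rV[R]_m.
Local Notation E := (V * V)%type.
Local Notation s := (@sgn R m p).
Local Notation b := (fun i => a i ^+ 2).
Local Notation Q := (qw s b).
Local Notation M := (@nullLines R m p).
Local Notation TM := (@tgNull R m p).
Local Notation I1 := (fun=> (1 : R)).

(** The matrix of the quadratic form Phi B y. *)
Definition discr_mx (B : 'I_m -> R) (y : V) : 'M[R]_m :=
  \matrix_(j, l) (B j * B l * (y 0 j * y 0 l) - (j == l)%:R * (B j * (bf B y y - 1))).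
Definition null_mx : 'M[R]_m := \matrix_(j, l) ((j == l)%:R * s j).

(** The k.+2 equations are indexed by nullity, the normalization by the
    auxiliary quadric nu, and tangency to the k quadrics of the chart. *)
Definition idx (i : 'I_m) : option (option 'I_k) :=
  omap (fun i' => unlift ord0 i') (unlift ord0 i).

Lemma idx0 : idx ord0 = None. Proof. by rewrite /idx unlift_none. Qed.
Lemma idx1 : idx (lift ord0 ord0) = Some None.
Proof. by rewrite /idx liftK /= unlift_none. Qed.
Lemma idx2 r : idx (lift ord0 (lift ord0 r)) = Some (Some r).
Proof. by rewrite /idx liftK /= liftK. Qed.

Variables (O : set E) (mu : 'I_k -> E -> R).
Hypothesis ch : @confocal_chart R m p a k O mu.
Variable l0 : E.
Hypotheses (Ol0 : O l0) (Ml0 : M l0).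
Variable nu : R.
Hypothesis anu : adm s b nu.
Hypothesis Pnu : Phi (Q nu) l0.1 l0.2 != 0.
Variable t0 : R.
Hypothesis t0P : forall i, bf (Q (mu i l0)) l0.1 l0.2 + t0 * bf (Q (mu i l0)) l0.2 l0.2 != 0.

Local Notation Z := (R^o * E)%type.
(** The base point on the line is moved to parameter t0, away from all the
    points of tangency; there the equations are independent in the
    direction. *)
Definition yl (l : E) : V := l.1 + t0 *: l.2.
Local Notation y0 := (yl l0).
Local Notation u0 := l0.2.
(** The segment from the base point of l0 to that of l, along which the
    eikonal form is integrated. *)
Definition yt (z : Z) : V := y0 + z.1 *: (yl z.2 - y0).

Definition wt (o : option 'I_k) (l : E) : 'I_m -> R :=
  match o with None => Q nu | Some r => Q (mu r l) end.

(** The system for the direction at the point yt z of a null line tangent to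
    the quadrics mu i of the line z.2.  At time 1 this line is z.2 itself,
    up to the scale of the direction. *)
Definition eq_mx (z : Z) (i : 'I_m) : 'M[R]_m :=
  match idx i with None => null_mx | Some o => discr_mx (wt o z.2) (yt z) end.

Definition eq_grad_u (z : Z) (u : V) (i : 'I_m) : V :=
  match idx i with None => 2 *: wm s u | Some o => gPu (wt o z.2) (yt z) u end.
Definition eq_grad_x (z : Z) (u : V) (i : 'I_m) : V :=
  match idx i with None => 0 | Some o => gPx (wt o z.2) (yt z) u end.
Definition eq_val (z : Z) (u : V) (i : 'I_m) : R :=
  match idx i with None => bf s u u | Some o => Phi (wt o z.2) (yt z) u end.

Let sum_delta (j : 'I_m) (F : 'I_m -> R) : \sum_l (j == l)%:R * F l = F j.
Proof.
rewrite (bigD1 j) //= eqxx mul1r big1 ?addr0 // => l lj.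
by rewrite eq_sym (negbTE lj) mul0r.
Qed.

Lemma eq_mx_sym z : sym_family (eq_mx z).
Proof.
move=> i j l; rewrite /eq_mx; case: (idx i) => [ o|]; rewrite !mxE.
  have [->//|jl] := eqVneq j l; rewrite !mul0r !subr0.
  by ring.
by have [->//|jl] := eqVneq j l; rewrite !mul0r.
Qed.

Lemma eq_mx_row z (u : V) i j : \sum_l eq_mx z i j l * (u 0 l + u 0 l) = eq_grad_u z u i 0 j.
Proof.
rewrite /eq_mx /eq_grad_u; case: (idx i) => [ o|].
  transitivity (2 * ((wt o z.2 j * yt z 0 j) * \sum_l wt o z.2 l * yt z 0 l * u 0 l) -
    2 * \sum_l (j == l)%:R * (wt o z.2 j * (bf (wt o z.2) (yt z) (yt z) - 1) * u 0 l)).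
    rewrite !mulr_sumr -sumrB; apply: eq_bigr => l _; rewrite !mxE; ring.
  by rewrite sum_delta !mxE -/(bf (wt o z.2) (yt z) u); ring.
transitivity (2 * \sum_l (j == l)%:R * (s j * u 0 l)).
  by rewrite mulr_sumr; apply: eq_bigr => l _; rewrite !mxE; ring.
by rewrite sum_delta !mxE.
Qed.

Lemma quad_mx_eq z (u : V) i j : quad_mx (eq_mx z) (u + u) j i = eq_grad_u z u i 0 j.
Proof. by rewrite mxE -eq_mx_row; apply: eq_bigr => l _; rewrite mxE. Qed.

Lemma bf1_eq_grad_u z (u : V) i d : bf I1 (eq_grad_u z u i) d = match idx i with
  None => 2 * bf s u d | Some o => dPu (wt o z.2) (yt z) u d end.
Proof.
rewrite /eq_grad_u; case: (idx i) => [ o|]; first exact: gPuE.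
by rewrite bfZl wm1.
Qed.

Lemma quad_map_eq z (u : V) i : quad_map (eq_mx z) u 0 i = eq_val z u i.
Proof.
have : 2 * quad_map (eq_mx z) u 0 i = bf I1 (eq_grad_u z u i) u.
  rewrite mxE mulr_sumr /bf; apply: eq_bigr => j _; rewrite mxE -eq_mx_row mul1r.
  rewrite mulrCA mulrC; congr (_ * _); rewrite mulr_sumr.
  by apply: eq_bigr => l _; ring.
have two : (2 : R) != 0 by rewrite pnatr_eq0.
rewrite bf1_eq_grad_u /eq_val; case: (idx i) => [ o|]; last by move=> H; apply: (mulfI two).
by rewrite dPu_self => H; apply: (mulfI two).
Qed.

Definition adm_dom : set E := [set l | O l /\ forall r i, b i + s i * mu r l != 0].

Let oO : open O. Proof. by case: ch. Qed.
Let mu_Ck r q : Ck q O (mu r : E -> R^o).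
Proof. by case: ch => _ + _ => /(_ r) [_]; apply. Qed.

Lemma adm_domM l : O l -> M l -> adm_dom l.
Proof. by move=> Ol Ml; split=> // r; exact: (chart_adm ch Ol Ml). Qed.

Lemma open_adm_dom : open adm_dom.
Proof.
apply: open_near => l [ Ol H].
have h1 := near_of_open oO Ol.
have h3 r i : \forall l' \near l, b i + s i * mu r l' != 0.
  apply: (@Ck_near_neq _ _ O (fun l => b i + s i * mu r l : R^o)) => //.
  apply: Ck_add => //; first exact: Ck_cst.
  by apply: (Ck_mul oO (Ck_cst 0 (s i : R^o) oO)); exact: mu_Ck.
have h4 r := @filter_forall _ _ _ _ (nbhs_filter l) (h3 r).
have h2 := @filter_forall _ _ _ _ (nbhs_filter l) h4.
by move: h1 h2; apply: filterS2.
Qed.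

Definition adm_domZ : set Z := [set z | adm_dom z.2].

Lemma open_adm_domZ : open adm_domZ.
Proof.
apply: (@open_comp Z E snd adm_dom); last exact: open_adm_dom.
by move=> z _; exact: cvg_snd.
Qed.

Lemma ylz_Ck q W : open W -> Ck q W (fun z : Z => yl z.2).
Proof.
move=> oW.
have C2 : Ck q W (fun z : Z => z.2) by apply: Ck_snd => //; exact: Ck_id.
apply: Ck_add => //; first exact: Ck_fst.
by apply: Ck_scalev => //; [exact: Ck_cst|exact: Ck_snd].
Qed.

Lemma yt_Ck q W : open W -> Ck q W yt.
Proof.
move=> oW; apply: Ck_add => //; first exact: Ck_cst.
apply: Ck_scalev => //; first by apply: Ck_fst => //; exact: Ck_id.
by apply: Ck_subr => //; [exact: ylz_Ck|exact: Ck_cst].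
Qed.

Lemma wt_Ck q o i : Ck q adm_domZ (fun z : Z => wt o z.2 i : R^o).
Proof.
case: o => [r|] /=; last by apply: Ck_cst; exact: open_adm_domZ.
apply: Ck_inv; [exact: open_adm_domZ|by move=> z [_]; apply|].
apply: Ck_add; [exact: open_adm_domZ|by apply: Ck_cst; exact: open_adm_domZ|].
apply: (Ck_mul open_adm_domZ (Ck_cst q (s i : R^o) open_adm_domZ)).
apply: (@Ck_pre _ _ _ _ q O adm_domZ (mu r : E -> R^o) snd open_adm_domZ) => //.
  by move=> z [].
by move=> z; exact: cvg_snd.
Qed.

Lemma eq_mx_Ck q i j l : Ck q adm_domZ (fun z => eq_mx z i j l : R^o).
Proof.
have oZ := open_adm_domZ.
rewrite /eq_mx; case: (idx i) => [ o|]; last exact: Ck_cst.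
apply: (@Ck_ext _ _ _ _ _ (fun z => wt o z.2 j * wt o z.2 l * (yt z 0 j * yt z 0 l) -
   (j == l)%:R * (wt o z.2 j * (bf (wt o z.2) (yt z) (yt z) - 1)) : R^o)) => //.
  by move=> z _; rewrite [RHS]mxE.
apply: Ck_subr => //.
  apply: (@Ck_mul _ _ _ oZ q (fun z => wt o z.2 j * wt o z.2 l)).
    by apply: Ck_mul => //; exact: wt_Ck.
  by apply: Ck_mul => //; apply: Ck_coord => //; exact: yt_Ck.
apply: (@Ck_mul _ _ _ oZ q (fun z => (j == l)%:R)); first exact: Ck_cst.
apply: Ck_mul => //; first exact: wt_Ck.
apply: Ck_subr => //; last exact: Ck_cst.
apply: (@Ck_bf _ _ _ _ oZ q (fun i z => wt o z.2 i)); try exact: yt_Ck.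
by move=> i'; exact: wt_Ck.
Qed.

Lemma yt_l0 t : yt (t, l0) = y0.
Proof. by rewrite /yt /= subrr scaler0 addr0. Qed.

Lemma eq_mx_l0 t : eq_mx (t, l0) = eq_mx (0, l0).
Proof. by apply/funext => i; rewrite /eq_mx !yt_l0. Qed.

Lemma yt_1 l : yt (1, l) = yl l.
Proof. by rewrite /yt /= scale1r addrC subrK. Qed.

Lemma sum3 (F : 'I_m -> R) : \sum_i F i = F ord0 + (F (lift ord0 ord0) +
  \sum_r F (lift ord0 (lift ord0 r))).
Proof. by rewrite big_ord_recl big_ord_recl. Qed.

(** Suppose that a combination of the differentials in u of the equations
    vanishes.  Applied to u0 itself it isolates the coefficient of the
    auxiliary quadric, since the other functions vanish on l0 and are
    homogeneous.  The differentials of the others are multiples of the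
    normals at the points of tangency and of the isotropic covector of u0;
    the normals are orthogonal to each other and to u0, and not null, so
    that pairing with them kills their coefficients. *)
Lemma quad_mx_unit : quad_mx (eq_mx (0, l0)) (u0 + u0) \in unitmx.
Proof.
have Ol := Ol0; have Ml := Ml0.
rewrite -unitmx_tr unitmxE unitfE; apply/negP => /det0P[c c0 cM].
have H d : \sum_i c 0 i * bf I1 (eq_grad_u (0, l0) u0 i) d = 0.
  have := congr1 (fun v : V => \sum_j v 0 j * d 0 j) cM.
  rewrite [RHS]big1; last by move=> j _; rewrite mxE mul0r.
  move=> H0; rewrite -[RHS]H0; transitivity (\sum_i \sum_j c 0 i * (1 * eq_grad_u (0, l0) u0 i 0 j * d 0 j)).
    by apply: eq_bigr => i _; rewrite /bf mulr_sumr.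
  rewrite exchange_big; apply: eq_bigr => j _ /=; rewrite mxE mulr_suml.
  by apply: eq_bigr => i _; rewrite -quad_mx_eq !mxE; ring.
have [nu0 _ nun] : [/\ bf s u0 u0 = 0, True & True] by case/nullLinesP: Ml0.
have b0 i := chart_be ha ch Ol Ml i.
have P0 i := chart_Phi ch Ol Ml i.
have bfy B : bf B y0 u0 = bf B l0.1 u0 + t0 * bf B u0 u0 by rewrite !bfE.
have c1 : c 0 (lift ord0 ord0) = 0.
  have := H u0; rewrite sum3 !bf1_eq_grad_u idx0 idx1 nu0 mulr0 mulr0 add0r /=.
  rewrite big1 => [|r _]; last first.
    by rewrite bf1_eq_grad_u idx2 /= yt_l0 dPu_self Phi_shift P0 !mulr0.
  rewrite addr0 yt_l0 dPu_self Phi_shift => /eqP.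
  by rewrite !mulf_eq0 pnatr_eq0 (negbTE Pnu) !orbF => /eqP.
pose N i := tnormal (Q (mu i l0)) l0.1 u0.
have dPuN r d : dPu (Q (mu r l0)) y0 u0 d =
    2 * (bf (Q (mu r l0)) l0.1 u0 + t0 * bf (Q (mu r l0)) u0 u0) * bf I1 (N r) d.
  rewrite dPu_shift (dPu_tnormal _ (b0 r) (P0 r)) (dPx_tnormal _ _ (b0 r)) -/(N r).
  by ring.
have cr r : c 0 (lift ord0 (lift ord0 r)) = 0.
  have := H (wm s (N r)); rewrite sum3 !bf1_eq_grad_u idx0 c1 mul0r add0r.
  rewrite wmss (bfC I1 u0) (tnormal_dir _ (b0 r)) mulr0 mulr0 add0r.
  rewrite (bigD1 r) //= big1 => [|j jr].
    rewrite addr0 bf1_eq_grad_u idx2 /= yt_l0 dPuN wm1r => /eqP.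
    rewrite !mulf_eq0 pnatr_eq0 (negbTE (t0P r)) /=.
    by rewrite (negbTE (chart_N ha ch Ol Ml r)) orbF => /eqP.
  rewrite bf1_eq_grad_u idx2 /= yt_l0 dPuN wm1r.
  rewrite (tnormal_orth _ (b0 j) (b0 r) (P0 j) (P0 r)) ?mulr0 //.
  apply: qw_pencil; try exact: (chart_adm ch Ol Ml).
  case: (ch) => _ _ /(_ l0 Ol Ml) [inj _ _]; apply: contra jr => /eqP E.
  by apply/eqP; exact: inj.
have cn : c 0 ord0 = 0.
  have := H (wm s u0); rewrite sum3 c1 mul0r add0r big1 ?addr0 => [|r _]; last first.
    by rewrite cr mul0r.
  rewrite bf1_eq_grad_u idx0 wmss.
  have [-> _ _] : [/\ bf I1 u0 u0 = 1, True & True] by case/nullLinesP: Ml0.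
  by rewrite mulr1 => /eqP; rewrite mulf_eq0 pnatr_eq0 orbF => /eqP.
move/eqP: c0; apply; apply/rowP => i; rewrite mxE.
case: (unliftP ord0 i) => [i'|] -> //; by case: (unliftP ord0 i') => [r|] ->.
Qed.

Lemma grad_bracket z (u : V) i j : O z.2 -> M z.2 -> Phi (Q nu) z.2.1 z.2.2 != 0 ->
  bf s (eq_grad_x z u i) (eq_grad_u z u j) = bf s (eq_grad_u z u i) (eq_grad_x z u j).
Proof.
move=> Ol Mz Pz; rewrite /eq_grad_u /eq_grad_x.
have nul B (x : V) : bf s (2 *: wm s u) (gPx B x u) = 0.
  by rewrite bfC bracket_null //; exact: s2.
case: (idx i) => [ o|]; case: (idx j) => [ o'|]; rewrite ?bf0l ?bf0r ?nul //; last first.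
  by apply: bracket_null; exact: s2.
have [->|oo] := eqVneq o o'; first by rewrite bfC.
apply: bracket_Phi.
have mu_nu q : mu q z.2 != nu.
  by apply: contra Pz => /eqP <-; rewrite (chart_Phi ch Ol Mz).
have aq q : adm s b (mu q z.2) by exact: (chart_adm ch Ol Mz).
case: o o' oo => [q|] [q'|] //= oo; apply: qw_pencil => //; try exact: s2; last first.
  by rewrite eq_sym.
case: (ch) => _ _ /(_ _ Ol Mz) [inj _ _]; apply: contra oo => /eqP E'.
by apply/eqP; congr Some; exact: inj.
Qed.

(** The vectors w and w' are made to annihilate the discriminant of nu as
    well by adding multiples of the Euler field (0, u0); then isotropy
    applies. *)
Lemma leaf_isotropic w w' : TM l0 w -> TM l0 w' ->
  (forall q, dPhi (Q (mu q l0)) l0 w = 0) ->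
  (forall q, dPhi (Q (mu q l0)) l0 w' = 0) ->
  let c := dPhi (Q nu) l0 w / (2 * Phi (Q nu) l0.1 l0.2) in
  let c' := dPhi (Q nu) l0 w' / (2 * Phi (Q nu) l0.1 l0.2) in
  bf s w.2 w'.1 - bf s w'.2 w.1 = c * bf s l0.2 w'.1 - c' * bf s l0.2 w.1.
Proof.
move=> Tw Tw' h h' c c'.
have nl0 : bf s u0 u0 = 0 by case/nullLinesP: Ml0.
pose z : Z := (0, l0).
pose P : 'M[R]_m := \matrix_(i, j) eq_grad_u z u0 i 0 j.
pose G : 'M[R]_m := \matrix_(i, j) eq_grad_x z u0 i 0 j.
have rP i : row i P = eq_grad_u z u0 i by apply/rowP => j; rewrite !mxE.
have rG i : row i G = eq_grad_x z u0 i by apply/rowP => j; rewrite !mxE.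
have eq1 v : TM l0 v -> (forall q, dPhi (Q (mu q l0)) l0 v = 0) ->
  forall i, bf I1 (row i G) (v.1 + t0 *: v.2) + bf I1 (row i P)
    (v.2 - (dPhi (Q nu) l0 v / (2 * Phi (Q nu) l0.1 l0.2)) *: u0) = 0.
  move=> /tgNullP[_ _ t3] hv i; rewrite rG rP bf1_eq_grad_u /eq_grad_x.
  case: (idx i) => [ o|]; last by rewrite bf0l !bfE t3 nl0; ring.
  rewrite gPxE yt_l0 dPx_shift dPu_shift.
  have D1 B x y y' t : dPx B x u0 (y + t *: y') = dPx B x u0 y + t * dPx B x u0 y'.
    by rewrite /dPx !bfE; ring.
  have D2 B x y t : dPu B x u0 (y - t *: u0) = dPu B x u0 y - t * (2 * Phi B x u0).
    by rewrite -dPu_self /dPu !bfE; ring.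
  have D3 B x y t : dPx B x u0 (y - t *: u0) = dPx B x u0 y.
    by rewrite /dPx !bfE; ring.
  rewrite D1 D2 D3; case: o => [q|] /=.
    by have := hv q; rewrite /dPhi (chart_Phi ch Ol0 Ml0) => hq; lra.
  rewrite /dPhi; field; exact: Pnu.
have := @isotropy _ _ s (@s2 R k.+1 p) G P (w.1 + t0 *: w.2) (w.2 - c *: u0)
  (w'.1 + t0 *: w'.2) (w'.2 - c' *: u0) _ _ (eq1 w Tw h) (eq1 w' Tw' h').
rewrite !bfE => H.
have {H} := H _ _; move: Tw Tw' => /tgNullP[_ _ t3] /tgNullP[_ _ t3'].
rewrite (bfC _ w'.2 w.2) t3 t3' => H.
suff : bf s w.2 w'.1 + t0 * bf s w.2 w'.2 - (c * bf s u0 w'.1 + c * (t0 * 0)) =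
  bf s w'.2 w.1 + t0 * bf s w.2 w'.2 - (c' * bf s u0 w.1 + c' * (t0 * 0)) by lra.
have H1 : P \in unitmx.
  rewrite -unitmx_tr (_ : P^T = quad_mx (eq_mx z) (u0 + u0)); first exact: quad_mx_unit.
  by apply/matrixP => i j; rewrite quad_mx_eq !mxE.
have H2 i j : bf s (row i G) (row j P) = bf s (row i P) (row j G).
  by rewrite !rP !rG; exact: grad_bracket.
have := H H1 H2; lra.
Qed.

Section Solution.
Variables (r e K : R).
Hypotheses (r0 : 0 < r) (e0 : 0 < e) (K0 : 0 <= K).
Local Notation C0 := (eq_mx (0, l0)).
Local Notation sigma := (quad_map C0 u0).
Hypothesis HC : forall C : 'I_m -> 'M[R]_m, sym_family C ->
  (forall i j l, `|C i j l - C0 i j l| <= e) ->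
  (exists2 u, `|u - u0| <= r & quad_map C u = sigma) /\
  (forall u v, `|u - u0| <= r -> `|v - u0| <= r ->
    quad_mx C (u + v) \in unitmx /\ `|u - v| <= K * `|quad_map C u - quad_map C v|).

Definition sol_dom : set Z := [set z | adm_domZ z /\
  forall i j l, `|eq_mx z i j l - C0 i j l| < e].

Lemma open_sol_dom : open sol_dom.
Proof.
apply: open_near => z [OZz Hz].
have h1 := near_of_open open_adm_domZ OZz.
have h2 i j l : \forall z' \near z, `|eq_mx z' i j l - C0 i j l| < e.
  have c1 : Ck 0 adm_domZ (fun z => eq_mx z i j l - C0 i j l : R^o).
    by apply: Ck_subr; [exact: open_adm_domZ|exact: eq_mx_Ck|apply: Ck_cst; exact: open_adm_domZ].
  have c2 : (fun z' => `|eq_mx z' i j l - C0 i j l|) @ z --> `|eq_mx z i j l - C0 i j l|.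
    by apply: cvg_norm; exact: (c1 z OZz).
  exact: (@cvgr_lt R Z (nbhs z) _ _ _ c2 e (Hz i j l)).
have h3 i j := @filter_forall _ _ _ _ (nbhs_filter z) (h2 i j).
have h4 i := @filter_forall _ _ _ _ (nbhs_filter z) (h3 i).
have h5 := @filter_forall _ _ _ _ (nbhs_filter z) h4.
by move: h1 h5; apply: filterS2.
Qed.

Lemma sol_dom_l0 t : sol_dom (t, l0).
Proof.
split; first exact: adm_domM.
by move=> i j l; rewrite eq_mx_l0 subrr normr0.
Qed.

(** The direction of the null line through yt z, near u0, that solves the
    system. *)
Definition U (z : Z) : V := xget u0 [set u | `|u - u0| <= r /\ quad_map (eq_mx z) u = sigma].

Lemma U_spec z : sol_dom z -> `|U z - u0| <= r /\ quad_map (eq_mx z) (U z) = sigma.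
Proof.
move=> [OZz Hz]; have [[u ur uE] _] := HC (eq_mx_sym z) (fun i j l => ltW (Hz i j l)).
exact: (@xgetPex _ u0 [set u | `|u - u0| <= r /\ quad_map (eq_mx z) u = sigma] (ex_intro _ u (conj ur uE))).
Qed.

Lemma U_unit z z' : sol_dom z -> sol_dom z' -> quad_mx (eq_mx z) (U z + U z') \in unitmx.
Proof.
move=> Oz Oz'; have [OZz Hz] := Oz.
have [_ H] := HC (eq_mx_sym z) (fun i j l => ltW (Hz i j l)).
by have [] := H _ _ (U_spec Oz).1 (U_spec Oz').1.
Qed.

Lemma U_lip z z' : sol_dom z -> sol_dom z' ->
  `|U z - U z'| <= K * `|quad_map (eq_mx z) (U z) - quad_map (eq_mx z) (U z')|.
Proof.
move=> Oz Oz'; have [OZz Hz] := Oz.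
have [_ H] := HC (eq_mx_sym z) (fun i j l => ltW (Hz i j l)).
by have [] := H _ _ (U_spec Oz).1 (U_spec Oz').1.
Qed.

Lemma U_unique z u : sol_dom z -> `|u - u0| <= r -> quad_map (eq_mx z) u = sigma -> U z = u.
Proof.
move=> Oz ur uE; have [OZz Hz] := Oz.
have [_ H] := HC (eq_mx_sym z) (fun i j l => ltW (Hz i j l)).
have [_] := H _ _ (U_spec Oz).1 ur.
by rewrite (U_spec Oz).2 uE subrr normr0 mulr0 normr_le0 subr_eq0 => /eqP.
Qed.

Let CZS q i j l : Ck q sol_dom (fun z => eq_mx z i j l : R^o).
Proof. by apply: Ck_sub (eq_mx_Ck q i j l) => z []. Qed.

Lemma U_Ck q : Ck q sol_dom U.
Proof.
exact: (implicit_Ck open_sol_dom (fun z _ => eq_mx_sym z) CZS (fun z Oz => (U_spec Oz).2)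
  U_unit U_lip K0).
Qed.

Definition dyt (z w : Z) : V := w.1 *: (yl z.2 - y0) + z.1 *: (w.2.1 + t0 *: w.2.2).

Lemma has_diff_yl (l w : E) : has_diff yl l w (w.1 + t0 *: w.2).
Proof.
apply: has_diff_add; first exact: has_diff_l1.
apply: has_diff_eq; first by apply: has_diff_scalev; [exact: has_diff_cst|exact: has_diff_l2].
by rewrite scale0r add0r.
Qed.

Lemma has_diff_ylz (z w : Z) : has_diff (fun z : Z => yl z.2) z w (w.2.1 + t0 *: w.2.2).
Proof. by apply: (has_diff_comp (has_diff_snd (has_diff_id z w))); exact: has_diff_yl. Qed.

Lemma has_diff_yt (z w : Z) : has_diff yt z w (dyt z w).
Proof.
apply: has_diff_eq.
  apply: has_diff_add; first exact: has_diff_cst.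
  apply: has_diff_scalev; first by apply: has_diff_fst; exact: has_diff_id.
  by apply: has_diff_sub; [exact: has_diff_ylz|exact: has_diff_cst].
by rewrite add0r subr0.
Qed.

Definition flat (l w : E) : Prop := forall q, 'd (mu q : E -> R^o) l w = 0.

Lemma U_variation (z w : Z) i : sol_dom z ->
  flat z.2 w.2 ->
  bf I1 (eq_grad_x z (U z) i) (dyt z w) + bf I1 (eq_grad_u z (U z) i) ('d U z w) = 0.
Proof.
move=> Oz dmu; have [[ Ol adml] _] := Oz.
have := implicit_eq open_sol_dom (fun z _ => eq_mx_sym z) CZS (fun z Oz => (U_spec Oz).2)
  U_unit U_lip K0 w Oz.
move=> /(congr1 (fun v : V => v 0 i)); rewrite [LHS]mxE [RHS]mxE.
have -> : \sum_j 'd U z w 0 j * quad_mx (eq_mx z) (U z + U z) j i = bf I1 (eq_grad_u z (U z) i) ('d U z w).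
  by apply: eq_bigr => j _; rewrite quad_mx_eq mul1r mulrC.
move=> ->; apply/eqP; rewrite subr_eq0; apply/eqP.
set u := U z.
have h1 : has_diff (fun z' => eq_val z' u i : R^o) z w (quad_map (dC eq_mx z w) u 0 i).
  rewrite (_ : (fun _ => _) = fun z' => \sum_j \sum_l eq_mx z' i j l * (u 0 j * u 0 l)); last first.
    by apply/funext => z'; rewrite -quad_map_eq quad_mapE; do 2 (apply: eq_bigr => ? _); rewrite mulrA.
  rewrite quad_mapE; do 2 (apply: has_diff_sum => ? _).
  rewrite mxE; apply: has_diff_eq; first (apply: has_diff_mul; [|exact: has_diff_cst]).
    exact: (Ck_hasd w (CZS 1 _ _ _) Oz).
  by rewrite mulr0 add0r mulrA.
have h2 : has_diff (fun z' => eq_val z' u i : R^o) z w (bf I1 (eq_grad_x z u i) (dyt z w)).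
  rewrite /eq_val /eq_grad_x; case: (idx i) => [ o|]; last by rewrite bf0l; exact: has_diff_cst.
  rewrite gPxE; apply: has_diff_eq.
    apply: (@has_diff_Phi _ _ _ (fun j z => wt o z.2 j) yt (fun=> u) z w (fun=> 0)).
    - move=> j; case: o => [q|] /=; last exact: has_diff_cst.
      apply: (@has_diff_comp _ _ _ _ (fun z : Z => z.2) (fun l => Q (mu q l) j) z w w.2).
        by apply: has_diff_snd; exact: has_diff_id.
      have hm : has_diff (mu q : E -> R^o) z.2 w.2 0.
        by apply: has_diff_eq (Ck_hasd w.2 (mu_Ck q 1) Ol) (dmu q).
      apply: has_diff_eq (@has_diff_qw _ _ p a (mu q) z.2 w.2 0 j (adml q) hm) _.
      by rewrite mulr0.
    - exact: has_diff_yt.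
    - exact: has_diff_cst.
  have E0 x y : bf (fun _ : 'I_m => 0 : R) x y = 0 by rewrite /bf big1 // => q _; rewrite !mul0r.
  by rewrite /dPB /dPu !E0 !bf0r; ring.
exact: has_diff_fun h2 h1.
Qed.

(** On each leaf the form U . dx is closed; in this form the statement
    involves only first derivatives of U. *)
Lemma U_closed (z w w' : Z) : sol_dom z -> M z.2 -> Phi (Q nu) z.2.1 z.2.2 != 0 ->
  flat z.2 w.2 ->
  flat z.2 w'.2 ->
  bf s ('d U z w) (dyt z w') = bf s ('d U z w') (dyt z w).
Proof.
move=> Oz Mz Pz h h'; have [[ Ol adml] _] := Oz.
pose P : 'M[R]_m := \matrix_(i, j) eq_grad_u z (U z) i 0 j.
pose G : 'M[R]_m := \matrix_(i, j) eq_grad_x z (U z) i 0 j.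
have rP i : row i P = eq_grad_u z (U z) i by apply/rowP => j; rewrite !mxE.
have rG i : row i G = eq_grad_x z (U z) i by apply/rowP => j; rewrite !mxE.
apply: (@isotropy _ _ s (@s2 R k.+1 p) G P).
- rewrite -unitmx_tr (_ : P^T = quad_mx (eq_mx z) (U z + U z)) ?U_unit //.
  by apply/matrixP => i j; rewrite quad_mx_eq !mxE.
- by move=> i j; rewrite !rP !rG; exact: grad_bracket.
- by move=> i; rewrite rG rP; exact: U_variation.
- by move=> i; rewrite rG rP; exact: U_variation.
Qed.

(** The value of the eikonal form U . dx on the velocity of the segment yt. *)
Definition leaf_integrand (z : Z) : R^o := bf s (U z) (yl z.2 - y0).

Lemma leaf_integrand_Ck q : Ck q sol_dom leaf_integrand.
Proof.
apply: Ck_bfc; [exact: open_sol_dom|exact: U_Ck|].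
by apply: Ck_subr; [exact: open_sol_dom|apply: ylz_Ck; exact: open_sol_dom|apply: Ck_cst; exact: open_sol_dom].
Qed.

(** The factor that gives the auxiliary discriminant the same value on l as
    on l0.  The system of l at time 1 has then the solution rescale l *:
    l.2. *)
Definition rescale (l : E) : R := Num.sqrt (Phi (Q nu) l0.1 l0.2 / Phi (Q nu) l.1 l.2).

Definition prim_dom : set E := [set l | [/\ O l, forall t : R, 0 <= t <= 1 -> sol_dom (t, l),
  0 < Phi (Q nu) l0.1 l0.2 / Phi (Q nu) l.1 l.2 & `|rescale l *: l.2 - u0| <= r]].

Lemma prim_dom_near : \forall l \near l0, prim_dom l.
Proof.
have n1 := near_of_open oO Ol0.
have n2 := @tube R E sol_dom l0 (fun t _ => near_of_open open_sol_dom (sol_dom_l0 t)).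
have oT : open [set: E] := openT.
have cP q : Ck q setT (fun l : E => Phi (Q nu) l.1 l.2 : R^o).
  by apply: Ck_Phic => //; [apply: Ck_fst|apply: Ck_snd] => //; exact: Ck_id.
pose O2 := [set l : E | Phi (Q nu) l.1 l.2 != 0].
have oO2 : open O2.
  by apply: open_near => l /= h; exact: (Ck_near_neq (cP 0) _ h).
have cq q : Ck q O2 (fun l : E => Phi (Q nu) l0.1 l0.2 / Phi (Q nu) l.1 l.2 : R^o).
  apply: Ck_mul => //; first exact: Ck_cst.
  by apply: Ck_inv => //; apply: Ck_sub (cP q) => l.
have l01 : Phi (Q nu) l0.1 l0.2 / Phi (Q nu) l0.1 l0.2 = 1 by rewrite divff.
have n3 : \forall l \near l0, 0 < Phi (Q nu) l0.1 l0.2 / Phi (Q nu) l.1 l.2.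
  by apply: (Ck_near_lt (cq 0) (x := l0) Pnu); rewrite l01.
pose O3 := [set l : E | O2 l /\ 0 < Phi (Q nu) l0.1 l0.2 / Phi (Q nu) l.1 l.2].
have oO3 : open O3.
  apply: open_near => l [ O2l h].
  have h1 := near_of_open oO2 O2l; have h2 := Ck_near_lt (cq 0) O2l h.
  by move: h1 h2; apply: filterS2.
have cr : Ck 0 O3 (fun l : E => rescale l *: l.2).
  apply: (Ck_scalev oO3); last by apply: (Ck_snd oO3); exact: Ck_id.
  apply: (Ck_sqrt oO3); first by move=> l [].
  by apply: Ck_sub (cq 0) => l [].
have O3l0 : O3 l0 by split => //; rewrite l01.
have n4 : \forall l \near l0, `|rescale l *: l.2 - u0| <= r.
  have := cr l0 O3l0; rewrite /prop_for /continuous_at {2}/rescale l01 sqrtr1 scale1r.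
  move=> /cvgrPdist_le /(_ r r0); apply: filterS => l /=; by rewrite distrC.
by near=> l; split; near: l.
Unshelve. all: by end_near.
Qed.

Definition leaf_prim (l : E) : R^o := int01 (fun t => leaf_integrand (t, l)).

Lemma U_end l : prim_dom l -> M l -> U (1, l) = rescale l *: l.2.
Proof.
move=> [ Ol OSl pos near] Ml; apply: U_unique => //.
  by apply: OSl; rewrite ler01 lexx.
have [_ _ nl] : [/\ True, True & bf s l.2 l.2 = 0] by case/nullLinesP: Ml.
have [_ _ nl0] : [/\ True, True & bf s u0 u0 = 0] by case/nullLinesP: Ml0.
apply/rowP => i; rewrite !quad_map_eq /eq_val; case: (idx i) => [ o|]; last first.
  by rewrite !bfE nl nl0 !mulr0.
rewrite yt_1 yt_l0 Phi_scale !Phi_shift; case: o => [q|] /=.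
  by rewrite (chart_Phi ch Ol Ml) (chart_Phi ch Ol0 Ml0) mulr0.
rewrite /rescale sqr_sqrtr; last exact: ltW.
by rewrite divfK //; apply/eqP => E; move: pos; rewrite E invr0 mulr0 ltxx.
Qed.

(** By closedness the derivative of the integrand in the direction of the
    leaf is the derivative in t of t times the form evaluated on the
    displacement of the end point. *)
Lemma leaf_prim_d l w : (prim_dom°) l -> M l -> flat l w ->
  'd leaf_prim l w = rescale l * (bf s l.2 w.1 + t0 * bf s l.2 w.2).
Proof.
move=> gl Ml dmu; have gl' := interior_subset gl.
have [ Ol OSl pos near] := gl'.
have Pl : Phi (Q nu) l.1 l.2 != 0.
  by apply/eqP => E; move: pos; rewrite E invr0 mulr0 ltxx.
have [_ ->] := @param_has_diff R E _ _ _ (@vv_coordE R m) (@vv_coord_le R m)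
  (@vv_coord_lin R m) (@vv_coord_cont R m) sol_dom (prim_dom°) (@open_interior _ _)
  (fun t l t01 gl => match interior_subset gl with And4 _ H _ _ => H t t01 end)
  leaf_integrand l w (leaf_integrand_Ck 1) gl.
pose dy : V := w.1 + t0 *: w.2.
have hU (t : R) w' : 0 <= t <= 1 -> has_diff U (t, l) w' ('d U (t, l) w').
  by move=> t01; exact: (Ck_hasd w' (U_Ck 1) (OSl t t01)).
(* g is the derivative of t times the form evaluated on the displacement dy. *)
pose g (t : R) : R := t * bf s ('d U (t, l) (1, 0)) dy + bf s (U (t, l)) dy.
have dE (t : R) : 0 <= t <= 1 -> 'd leaf_integrand (t, l) (0, w) = g t.
  move=> t01.
  have [_ ->] := has_diff_bfc s (hU t (0, w) t01)
    (has_diff_sub (has_diff_ylz (t, l) (0, w)) (has_diff_cst y0 _ _)).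
  rewrite subr0 -/dy /g /=; congr (_ + _).
  have := @U_closed (t, l) (0, w) (1, 0) (OSl t t01) Ml Pl dmu.
  rewrite /dyt /= !(scale0r, scaler0, addr0, add0r, scale1r) -/dy bfZr => -> //.
  by move=> q; exact: linear0.
rewrite (int01_eq dE).
have cU w' : cont01 (fun t => bf s ('d U (t, l) w') dy).
  apply: (@cont01_param R E sol_dom (prim_dom°)
    (fun t l t01 gl => match interior_subset gl with And4 _ H _ _ => H t t01 end)
    (fun z => bf s ('d U z w') dy)) gl.
  by apply: Ck_bfc; [exact: open_sol_dom|exact: (Ck_d w' (U_Ck 1))|apply: Ck_cst; exact: open_sol_dom].
have cg : cont01 g.
  move=> t t01; apply: cvgD; first by apply: cvgM; [exact: cvg_id|exact: cU].
  have c2 : cont01 (fun t => bf s (U (t, l)) dy).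
    apply: (@cont01_param R E sol_dom (prim_dom°)
      (fun t l t01 gl => match interior_subset gl with And4 _ H _ _ => H t t01 end)
      (fun z => bf s (U z) dy)) gl.
    by apply: Ck_bfc; [exact: open_sol_dom|exact: (U_Ck 0)|apply: Ck_cst; exact: open_sol_dom].
  exact: c2.
have dG (t : R) : 0 <= t <= 1 -> is_derive t 1 (fun t : R => t * bf s (U (t, l)) dy) (g t).
  move=> t01.
  have hp : has_diff (fun t : R^o => (t, l) : Z) t 1 (1, 0).
    by apply: has_diff_pair; [exact: has_diff_id|exact: has_diff_cst].
  have hc : has_diff (fun t : R^o => t * bf s (U (t, l)) dy : R^o) t 1 (g t).
    apply: has_diff_eq.
      apply: has_diff_mul; first exact: has_diff_id.
      by apply: has_diff_bfc; [exact: (has_diff_comp hp (hU t (1, 0) t01))|exact: has_diff_cst].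
    by rewrite bf0r addr0 /g mul1r.
  have [dc ec] := hc.
  have D : derivable (fun t : R => t * bf s (U (t, l)) dy) t 1 by exact/derivable1_diffP.
  by apply: DeriveDef => //; rewrite deriveE.
rewrite (int01_FTC cg dG).
by rewrite mul1r mul0r subr0 U_end // /dy !bfE; ring.
Qed.

End Solution.

(** On the leaves the contact structure is the kernel of an exact form.  The
    primitive is a complete integral of the eikonal equation: in the
    separating coordinates it would be a sum of hyperelliptic integrals, and
    here it is the integral of U . dx along segments. *)
Lemma leaf_primitive : exists (W : set E) (h : E -> R), [/\ open W, W l0,
  smooth W (h : E -> R^o) & forall l, W l -> M l ->
    O l /\ exists2 c : R, 0 < c & forall w, TM l w ->
      (forall q, 'd (mu q : E -> R^o) l w = 0) ->
      'd (h : E -> R^o) l w = c * bf s l.2 w.1].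
Proof.
have [r [e [K [r0 e0 K0 HC]]]] := quad_inverse (eq_mx_sym (0, l0)) quad_mx_unit.
exists ((prim_dom r e)°), (leaf_prim r); split.
- exact: open_interior.
- exact: (prim_dom_near r0 e0).
- split; first exact: open_interior.
  exact: (@param_Ck R E _ _ _ (@vv_coordE R m) (@vv_coord_le R m)
    (@vv_coord_lin R m) (@vv_coord_cont R m) (sol_dom e) ((prim_dom r e)°)
    (@open_interior _ _)
    (fun t l t01 gl => match interior_subset gl with And4 _ H _ _ => H t t01 end)
    (leaf_integrand r) (leaf_integrand_Ck K0 HC)).
- move=> l gl Ml; have [ Ol _ pos _] := interior_subset gl; split=> //.
  exists (rescale l); first by rewrite sqrtr_gt0.
  move=> w /tgNullP[_ _ tw] dmu.
  by rewrite (leaf_prim_d K0 HC gl Ml dmu) tw mulr0 addr0.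
Qed.

End Transversal.

(** * The contact form and its Reeb field *)

Section Contact.
Variables (R : realType) (n p : nat) (a : 'I_n.+1 -> R).
Hypothesis ha : forall i, 0 < a i.
Local Notation m := n.+1.
Local Notation V := 'rV[R]_m.
Local Notation E := (V * V)%type.
Local Notation s := (@sgn R m p).
Local Notation b := (fun k => a k ^+ 2).
Local Notation Q := (qw s b).
Local Notation M := (@nullLines R m p).
Local Notation TM := (@tgNull R m p).
Local Notation xi := (@contactNull R m p).
Local Notation ent := (@entering R m p a).
Local Notation fol := (@foliated R m p a n.-1).
Local Notation TF := (@tgF R m p a n.-1).
Local Notation I1 := (fun=> (1 : R)).
Implicit Types (l w z : E).

Definition theta l w : R := bf s l.2 w.1.
(** The exterior derivative of theta, which on all of V * V is the
    symplectic form of the space of covectors. *)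
Definition dtheta w w' : R := bf s w.2 w'.1 - bf s w'.2 w.1.

(** The coefficient of the Euler field (0, l.2) in ham; the coefficient of
    (l.2, 0) is chosen so that the base point stays orthogonal to the
    direction.  Both corrections preserve the discriminants that vanish on
    the line, the first by homogeneity and the second because the
    discriminants are constant along lines. *)
Definition hamb B l : R := bf s (gPx B l.1 l.2) l.2.
Definition ham B l : E :=
  let w2 := - wm s (gPx B l.1 l.2) + hamb B l *: l.2 in
  let X := wm s (gPu B l.1 l.2) in
  (X - (bf I1 X l.2 + bf I1 l.1 w2) *: l.2, w2).

Lemma bfs_wml (x y : V) : bf s (wm s x) y = bf I1 x y.
Proof. by rewrite bf_wml; apply: bf_ext => k; rewrite s2. Qed.

Lemma ham_TM B l : M l -> TM l (ham B l).
Proof.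
move=> /nullLinesP[u1 xu nu]; apply/tgNullP; split=> /=.
- rewrite bfDr bfNr bfZr u1 mulr1 wm1r /hamb.
  by rewrite (bfC s l.2) addNr.
- set W := - _ + _; rewrite bfDl bfNl bfZl u1 mulr1; ring.
- rewrite bfDr bfNr bfZr nu mulr0 addr0 bfC bfs_wml gPxE dPx_self oppr0 //.
Qed.

Lemma ham_theta B l : M l -> theta l (ham B l) = 2 * Phi B l.1 l.2.
Proof.
move=> /nullLinesP[u1 xu nu]; rewrite /theta /ham /= bfDr bfNr bfZr nu mulr0 subr0.
by rewrite bfC bfs_wml gPuE dPu_self.
Qed.

Lemma dPhi_ham B P l : bf s (gPx P l.1 l.2) (gPu B l.1 l.2) =
    bf s (gPu P l.1 l.2) (gPx B l.1 l.2) ->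
  dPhi P l (ham B l) = 2 * hamb B l * Phi P l.1 l.2.
Proof.
move=> br; rewrite /dPhi /ham /= -gPxE -gPuE !(bfDr, bfNr, bfZr) !wm1r br.
by rewrite gPxE dPx_self gPuE dPu_self; ring.
Qed.

Lemma dtheta_ham B l w : TM l w ->
  dtheta (ham B l) w = - dPhi B l w + hamb B l * theta l w.
Proof.
move=> /tgNullP[t1 t2 t3]; rewrite /dtheta /ham /= !(bfDr, bfDl, bfNr, bfNl, bfZl, bfZr).
rewrite (bfC s w.2 l.2) t3 mulr0 subr0 bfs_wml gPxE.
by rewrite (bfC s w.2) bfs_wml gPuE /dPhi /theta; ring.
Qed.

Lemma fol_M l : fol l -> M l. Proof. by case. Qed.

Lemma TF_scale l c w : fol l -> TF l w -> TF l (c *: w).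
Proof.
move=> fl /(tgF_discr ha _ fl)[/tgNullP[t1 t2 t3] H]; apply/(tgF_discr ha _ fl); split.
  apply/tgNullP; rewrite /= !bfZl !bfZr t1 t3 !mulr0; split=> //.
  by rewrite -mulrDr t2 mulr0.
move=> q aq Pq; have := H q aq Pq; rewrite /dPhi /dPx /dPu /= !bfZr => h.
by rewrite -[RHS](mulr0 c) -h; ring.
Qed.

Lemma ham_TF nu l : fol l -> adm s b nu -> Phi (Q nu) l.1 l.2 != 0 -> TF l (ham (Q nu) l).
Proof.
move=> fl an Pn; apply/(tgF_discr ha _ fl); split; first exact/ham_TM/fol_M.
move=> c ac Pc; rewrite dPhi_ham ?Pc ?mulr0 //.
apply: bracket_Phi; apply: qw_pencil => //.
by apply: contra Pn => /eqP <-; rewrite Pc.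
Qed.

Lemma fol_nu l : fol l -> exists nu, adm s b nu /\ Phi (Q nu) l.1 l.2 != 0.
Proof.
move=> [Ml [W [mu [Wl ch]]]]; have [nu [an _ Pn]] := chart_nu ha ch Wl Ml.
by exists nu.
Qed.

Lemma xi_theta l w : xi l w <-> (TM l w /\ theta l w = 0).
Proof. exact: contactNullP. Qed.

(** The Hamiltonian field of an auxiliary discriminant that does not vanish
    on the line is tangent to the leaf, by involution, and transverse to the
    contact structure, by homogeneity of degree 2. *)
Lemma fol_transverse : transverse_dist TM fol TF xi.
Proof.
move=> l fl w Tw; have [nu [an Pn]] := fol_nu fl.
have Ml := fol_M fl.
pose h := ham (Q nu) l; have Th : TF l h by exact: ham_TF.
have th : theta l h != 0.
  by rewrite ham_theta // mulf_neq0 // pnatr_eq0.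
exists ((theta l w / theta l h) *: h), (w - (theta l w / theta l h) *: h); split.
- exact: TF_scale.
- apply/xi_theta; have /tgNullP[h1 h2 h3] := ham_TM (Q nu) Ml.
  move: (Tw) => /tgNullP[t1 t2 t3]; split; last first.
    rewrite -[LHS]/(bf s l.2 (w.1 - (theta l w / theta l h) *: h.1)).
    by rewrite bfDr bfNr bfZr -/(theta l h) -/(theta l w) divfK // subrr.
  apply/tgNullP; rewrite /= !bfE t1 t3 -/h in h1 h2 h3 *; rewrite h1 h3; split; try by ring.
  by have := congr1 (fun x => theta l w / theta l h * x) h2; rewrite mulr0 mulrDr; lra.
- by rewrite addrC subrK.
Qed.

Lemma fol_integrable : integrable_dist TM fol n.-1 TF.
Proof.
move=> l [Ml [W [mu [Wl ch]]]]; exists W, mu; case: (ch) => oW sm chW; split=> //.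
move=> z Wz [Mz _]; have [_ _ sub] := chW z Wz Mz; split=> // w.
exact: (TF_chart ha w ch Wz Mz).
Qed.

Local Notation P0 l := (Phi (Q 0) l.1 l.2).

(** The contact form of the scale in which the covector has discriminant 1
    for the ellipsoid.  Where the line enters the ellipsoid the square root
    of the discriminant is the product of the direction with the conormal A
    y at the exit point, and the reflection preserves it up to sign. *)
Definition contact_lam l w : R := theta l w / Num.sqrt (P0 l).
(** The discriminant of the ellipsoid is positive exactly when the line has
    points inside it. *)
Definition hitting : set E := [set l | 0 < P0 l].

Lemma P0_Ck q (O : set E) : open O -> Ck q O (fun l : E => P0 l : R^o).
Proof.
by move=> oO; apply: Ck_Phic => //; [apply: Ck_fst|apply: Ck_snd] => //; exact: Ck_id.
Qed.

Lemma open_hitting : open hitting.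
Proof.
apply: open_near => l h; exact: (Ck_near_lt (P0_Ck 0 openT) I h).
Qed.

Lemma enteringP l : ent l <-> (M l /\ hitting l).
Proof.
split=> [[Ml [t]]|[Ml Ol]].
  rewrite /= (@dot_Amap R n p a) => H; split=> //; rewrite /hitting /=.
  have be0 : 0 < bf (Q 0) l.2 l.2.
    by apply: bf_ge0; [exact: Q0_gt0|exact: M_u0 Ml].
  move: H; rewrite !bfE (bfC _ l.2 l.1) /Phi.
  move: (bf _ l.1 l.1) (bf _ l.1 l.2) (bf _ l.2 l.2) be0 => X Y W W0 H.
  have H1 : 0 < W * (1 - (X + t * Y + t * (Y + t * W))) by rewrite mulr_gt0 // subr_gt0; lra.
  have H2 := sqr_ge0 (Y + t * W).
  rewrite (_ : _ - _ = (Y + t * W) ^+ 2 + W * (1 - (X + t * Y + t * (Y + t * W)))); first lra.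
  by ring.
split=> //; exists (- bf (Q 0) l.1 l.2 / bf (Q 0) l.2 l.2) => /=.
have be0 : 0 < bf (Q 0) l.2 l.2.
  by apply: bf_ge0; [exact: Q0_gt0|exact: M_u0 Ml].
rewrite (@dot_Amap R n p a) !bfE (bfC _ l.2 l.1); move: Ol; rewrite /hitting /Phi /= => h.
rewrite -subr_lt0 (_ : _ - 1 = - (P0 l) / bf (Q 0) l.2 l.2).
  by rewrite mulNr oppr_lt0 divr_gt0.
by rewrite /Phi; field; rewrite gt_eqF.
Qed.

Lemma has_diff_theta w' l w : has_diff (fun z : E => theta z w' : R^o) l w (bf s w.2 w'.1).
Proof.
apply: has_diff_eq; first by apply: has_diff_bfc; [exact: has_diff_l2|exact: has_diff_cst].
by rewrite bf0r addr0.
Qed.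

Lemma has_diff_isqrt l w : hitting l -> has_diff (fun z : E => (Num.sqrt (P0 z))^-1 : R^o) l w
  (- (dPhi (Q 0) l w / (2 * P0 l)) / Num.sqrt (P0 l)).
Proof.
move=> Ol; have sq : Num.sqrt (P0 l) != 0 by rewrite gt_eqF // sqrtr_gt0.
apply: has_diff_eq.
  by apply: has_diff_inv => //; apply: has_diff_sqrt; [exact: Ol|exact: has_diff_Phil].
have EP := sqr_sqrtr (ltW Ol); set q := Num.sqrt _ in EP sq *.
by rewrite /= -[in RHS]EP; field.
Qed.

Lemma has_diff_contact_lam w' l w : hitting l -> has_diff (fun z : E => contact_lam z w' : R^o) l w
  ((bf s w.2 w'.1 - theta l w' * (dPhi (Q 0) l w / (2 * P0 l))) / Num.sqrt (P0 l)).
Proof.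
move=> Ol; apply: has_diff_eq.
  by apply: has_diff_mul; [exact: has_diff_theta|exact: has_diff_isqrt].
by rewrite /=; ring.
Qed.

Lemma ext_d_lam l w w' : hitting l -> ext_d contact_lam l w w' =
  (dtheta w w' - theta l w' * (dPhi (Q 0) l w / (2 * P0 l))
           + theta l w * (dPhi (Q 0) l w' / (2 * P0 l))) / Num.sqrt (P0 l).
Proof.
move=> Ol; rewrite /ext_d.
have [_ h1] := has_diff_contact_lam w' w Ol; have [_ h2] := has_diff_contact_lam w w' Ol.
transitivity ((bf s w.2 w'.1 - theta l w' * (dPhi (Q 0) l w / (2 * P0 l))) / Num.sqrt (P0 l) -
  (bf s w'.2 w.1 - theta l w * (dPhi (Q 0) l w' / (2 * P0 l))) / Num.sqrt (P0 l)).
  by congr (_ - _).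
by rewrite /dtheta; ring.
Qed.

Lemma contact_lam_one_form : one_form hitting contact_lam.
Proof.
split; first exact: open_hitting.
  move=> l _ c u v; by rewrite /contact_lam /theta /= !bfE; ring.
move=> w; split; first exact: open_hitting.
move=> q; apply: Ck_mul; first exact: open_hitting.
  apply: Ck_bfc; first exact: open_hitting.
    by apply: Ck_snd; [exact: open_hitting|apply: Ck_id; exact: open_hitting].
  by apply: Ck_cst; exact: open_hitting.
apply: Ck_inv; first exact: open_hitting.
  by move=> l Ol; rewrite gt_eqF // sqrtr_gt0.
by apply: Ck_sqrt; [exact: open_hitting| |apply: P0_Ck; exact: open_hitting].
Qed.

(** The Hamiltonian field of the square root of the discriminant of the
    ellipsoid, whose restriction to its unit level is the Reeb field. *)
Definition reeb l : E := (2 * Num.sqrt (P0 l))^-1 *: ham (Q 0) l.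

Lemma contact_lam_reeb l : M l -> hitting l -> contact_lam l (reeb l) = 1.
Proof.
move=> Ml Ol; rewrite /contact_lam /theta /reeb /= bfZr -/(theta l (ham (Q 0) l)) ham_theta //.
have sq : Num.sqrt (P0 l) != 0 by rewrite gt_eqF // sqrtr_gt0.
have EP := sqr_sqrtr (ltW Ol); set q := Num.sqrt _ in EP sq *.
by rewrite -EP; field.
Qed.

Lemma TM_scale l c w : TM l w -> TM l (c *: w).
Proof.
move=> /tgNullP[t1 t2 t3]; apply/tgNullP; rewrite /= !bfZl !bfZr t1 t3 !mulr0; split=> //.
by rewrite -mulrDr t2 mulr0.
Qed.

Lemma dPhi_scale B l c w : dPhi B l (c *: w) = c * dPhi B l w.
Proof. by rewrite /dPhi /dPx /dPu /= !bfZr; ring. Qed.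

Lemma reeb_lam : reeb_field TM ent contact_lam reeb.
Proof.
move=> l /enteringP[Ml Ol]; split.
- exact/TM_scale/ham_TM.
- exact: contact_lam_reeb.
move=> w Tw; rewrite ext_d_lam //.
have -> : dtheta (reeb l) w = (2 * Num.sqrt (P0 l))^-1 * dtheta (ham (Q 0) l) w.
  by rewrite /dtheta /reeb /= !bfE; ring.
rewrite dtheta_ham // /reeb dPhi_scale dPhi_ham; last by rewrite bfC.
have -> : theta l ((2 * Num.sqrt (P0 l))^-1 *: ham (Q 0) l) =
    (2 * Num.sqrt (P0 l))^-1 * (2 * P0 l) by rewrite -ham_theta // /theta /= bfZr.
have sq : Num.sqrt (P0 l) != 0 by rewrite gt_eqF // sqrtr_gt0.
have EP := sqr_sqrtr (ltW Ol); set q := Num.sqrt _ in EP sq *.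
by rewrite -EP; field.
Qed.

(** Two families of test vectors suffice: (S u', 0) for the direction
    component u' of w, and then, when this is zero, a vector whose direction
    component is S x' for the point component x' of w, with S the diagonal
    matrix of the signs. *)
Lemma dtheta_nondeg l w : M l -> xi l w -> (forall w', xi l w' -> dtheta w w' = 0) -> w = 0.
Proof.
move=> /nullLinesP[u1 xu nu] /xi_theta[/tgNullP[t1 t2 t3] tw] H.
(* Test vector (S w.2, 0). *)
have w20 : w.2 = 0.
  apply: bf1_eq0; have X : xi l (wm s w.2, 0).
    apply/xi_theta; split; last by rewrite /theta /= wmss.
    by apply/tgNullP; rewrite /= !bf0r addr0 wm1 bfC.
  by have := H _ X; rewrite /dtheta /= bf0l subr0 wmss.
(* The multiple of l.2 makes the test vector tangent to M. *)
have w10 : w.1 = 0.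
  rewrite w20 bf0r addr0 in t2.
  apply: bf1_eq0.
  pose y := wm s w.1.
  have X : xi l (- bf I1 l.1 y *: l.2, y).
    apply/xi_theta; split; last by rewrite /theta /= bfZr nu mulr0.
    apply/tgNullP; rewrite /= bfZl u1 mulr1 addNr; split=> //.
      by rewrite wm1r; exact: tw.
    by rewrite wmss bfC.
  have := H _ X; rewrite /dtheta /= w20 bf0l sub0r /y bfs_wml => /eqP.
  by rewrite oppr_eq0 => /eqP.
by rewrite [w]surjective_pairing w20 w10.
Qed.

Lemma contact_lam_contact_form : contact_form TM xi ent contact_lam.
Proof.
exists hitting; split; [by move=> l /enteringP[]|exact: contact_lam_one_form|].
move=> l /enteringP[Ml Ol].
have sq : Num.sqrt (P0 l) != 0 by rewrite gt_eqF // sqrtr_gt0.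
have l0 w : contact_lam l w = 0 <-> theta l w = 0.
  rewrite /contact_lam; split=> [/eqP|->]; last by rewrite mul0r.
  by rewrite mulf_eq0 invr_eq0 (negbTE sq) orbF => /eqP.
split.
- exists (reeb l); first exact/TM_scale/ham_TM.
  by rewrite contact_lam_reeb // oner_eq0.
- by move=> w; split=> [/xi_theta[Tw /l0 h]|[Tw /l0 h]]; [|apply/xi_theta].
- move=> w xw H; apply: (dtheta_nondeg Ml xw) => w' xw'.
  have := H w' xw'; rewrite ext_d_lam //.
  have /xi_theta[_ ->] := xw; have /xi_theta[_ ->] := xw'.
  rewrite !mul0r subr0 addr0 => /eqP.
  by rewrite mulf_eq0 invr_eq0 (negbTE sq) orbF => /eqP.
Qed.

Lemma reeb_TF l : fol l -> ent l -> TF l (reeb l).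
Proof.
move=> fl /enteringP[Ml Ol]; apply: TF_scale => //; apply: ham_TF => //.
  exact: adm0.
by rewrite gt_eqF.
Qed.

Lemma fol_open l : fol l -> \forall z \near l, M z -> fol z.
Proof.
move=> [Ml [W [mu [Wl ch]]]]; case: (ch) => oW _ _.
have := near_of_open oW Wl; apply: filterS => z Wz Mz; split=> //.
by exists W, mu.
Qed.

End Contact.

(** * The Legendrian foliation *)

Section Leaves.
Variables (R : realType).

(** On a line the metric is definite, so that there are no null directions;
    this settles the case n = 0. *)
Lemma nullLines1 (p : nat) (l : 'rV[R]_1 * 'rV[R]_1) : ~ @nullLines R 1 p l.
Proof.
move=> /nullLinesP[]; rewrite /bf !big_ord1 mul1r => u1 _.
rewrite -mulrA u1 mulr1 => s0; have := @s2 R 0 p ord0.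
by rewrite s0 mul0r => /eqP; rewrite eq_sym oner_eq0.
Qed.

Lemma exists_t0 (I : finType) (al be : I -> R) : (forall i, be i != 0) ->
  exists t, forall i, al i + t * be i != 0.
Proof.
(* A value larger than all the |al i / be i|, hence different from the
   excluded values. *)
move=> b0; exists (\sum_i `|al i / be i| + 1) => i; apply/eqP => E.
have E2 : \sum_i `|al i / be i| + 1 = - (al i / be i).
  apply: (mulIf (b0 i)); rewrite mulNr divfK //; lra.
have : - (al i / be i) <= `|al i / be i| by rewrite -normrN ler_norm.
have : `|al i / be i| <= \sum_i `|al i / be i| by rewrite (bigD1 i) //= lerDl sumr_ge0.
rewrite -E2; lra.
Qed.

Variables (n p : nat) (a : 'I_n.+1 -> R).
Hypothesis ha : forall i, 0 < a i.
Local Notation m := n.+1.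
Local Notation V := 'rV[R]_m.
Local Notation E := (V * V)%type.
Local Notation s := (@sgn R m p).
Local Notation b := (fun k => a k ^+ 2).
Local Notation Q := (qw s b).
Local Notation M := (@nullLines R m p).
Local Notation TM := (@tgNull R m p).
Local Notation xi := (@contactNull R m p).
Local Notation ent := (@entering R m p a).
Local Notation fol := (@foliated R m p a n.-1).
Local Notation TF := (@tgF R m p a n.-1).
Implicit Types (l w z : E).

(** The form theta is not closed on the leaves, but its multiple by the
    inverse square root of any nonzero discriminant Phi (Q nu) is. *)
Lemma TF_isotropic nu l w w' : fol l -> adm s b nu -> Phi (Q nu) l.1 l.2 != 0 ->
  TF l w -> TF l w' ->
  let c := dPhi (Q nu) l w / (2 * Phi (Q nu) l.1 l.2) in
  let c' := dPhi (Q nu) l w' / (2 * Phi (Q nu) l.1 l.2) in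
  dtheta p w w' = c * theta p l w' - c' * theta p l w.
Proof.
move: a ha l w w'; case: n => [|k] a' ha' l w w'.
  by move=> [Ml _]; case: (nullLines1 Ml).
move=> fl an Pn /(tgF_discr ha' _ fl)[Tw H] /(tgF_discr ha' _ fl)[Tw' H'].
have [Ml [W [mu [Wl ch]]]] := fl.
have [t0 t0P] := exists_t0 (fun i => bf (qw (@sgn R k.+2 p) (fun k => a' k ^+ 2) (mu i l)) l.1 l.2)
  (fun i => chart_be ha' ch Wl Ml i).
have ac i := chart_adm ch Wl Ml i; have Pc i := chart_Phi ch Wl Ml i.
exact: (leaf_isotropic ha' ch Wl Ml an Pn t0P Tw Tw' (fun q => H _ (ac q) (Pc q))
  (fun q => H' _ (ac q) (Pc q))).
Qed.

(** The leaves are the joint level sets of the parameters of the tangent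
    quadrics and of the primitive of leaf_primitive. *)
Lemma leg_integrable : integrable_dist TM fol n (capD TF xi).
Proof.
move: a ha; case: n => [|k] a' ha'; first by move=> l [Ml _]; case: (nullLines1 Ml).
move=> l fl; have [Ml [W [mu [Wl ch]]]] := fl.
have [nu [an Pn]] := fol_nu ha' fl.
have [t0 t0P] := exists_t0 (fun i => bf (qw (@sgn R k.+2 p) (fun k => a' k ^+ 2) (mu i l)) l.1 l.2)
  (fun i => chart_be ha' ch Wl Ml i).
have [W' [h [oW' W'l smh hW']]] := leaf_primitive ha' ch Wl Ml an Pn t0P.
have [oW smu chW] := ch.
exists (W `&` W'), (fun i => oapp mu h (unlift ord0 i)); split.
- exact: openI.
- by [].
- move=> i; split; first exact: openI.
  case: (unlift ord0 i) => [r|] /= q; last first.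
    by case: smh => _ /(_ q); apply: Ck_sub => z [].
  by case: (smu r) => _ /(_ q); apply: Ck_sub => z [].
move=> z [Wz W'z] fz; have Mz := fol_M fz.
have [_ [c c0 hc]] := hW' z W'z Mz.
have [_ _ sub] := chW z Wz Mz.
have TFz (w : 'rV[R]_k.+2 * 'rV[R]_k.+2) := TF_chart ha' w ch Wz Mz.
split; last first.
  move=> w; split.
    move=> [/TFz[Tw dmu] /xi_theta[_ th]]; split=> // i.
    case: (unlift ord0 i) => [r|] /=; first exact: dmu.
    by apply: (etrans (hc w Tw dmu)); rewrite -/(theta p z w) th mulr0.
  move=> [Tw H].
  have dmu q : 'd (mu q : 'rV[R]_k.+2 * 'rV[R]_k.+2 -> R^o) z w = 0.
    by have := H (lift ord0 q); rewrite liftK.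
  split; first exact/TFz.
  apply/xi_theta; split=> //.
  have := H ord0; rewrite unlift_none /= => h0.
  have := etrans (esym (hc w Tw dmu)) h0 => /eqP.
  by rewrite mulf_eq0 gt_eqF //= => /eqP.
move=> y.
have [w0 Tw0 w0E] := sub (fun r => y (lift ord0 r)).
have [nu' [an' Pn']] := fol_nu ha' fz.
have /TFz[Tw1 dw1] := ham_TF ha' fz an' Pn'.
set w1 := ham _ _ _ in Tw1 dw1.
have th1 : theta p z w1 != 0 by rewrite ham_theta // mulf_neq0 // pnatr_eq0.
have e1 : 'd (h : 'rV[R]_k.+2 * 'rV[R]_k.+2 -> R^o) z w1 = c * theta p z w1 := hc w1 Tw1 dw1.
(* The Hamiltonian vector w1 adjusts the value of the primitive without
   changing those of the parameters. *)
pose cc := (y ord0 - 'd (h : 'rV[R]_k.+2 * 'rV[R]_k.+2 -> R^o) z w0) / (c * theta p z w1).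
clearbody w1; exists (cc *: w1 + w0).
  move: Tw0 Tw1 => /tgNullP[t1 t2 t3] /tgNullP[t1' t2' t3']; apply/tgNullP.
  rewrite /= !bfE t1 t3 t1' t3' !mulr0 !addr0; split=> //.
  have : cc * (bf (fun=> 1) w1.1 z.2 + bf (fun=> 1) z.1 w1.2) = 0 by rewrite t2' mulr0.
  by move: t2; lra.
move=> i; case: (unliftP ord0 i) => [r|] -> /=.
  rewrite linearP; apply: (etrans (congr2 +%R (congr1 ( *:%R cc) (dw1 r)) (w0E r))).
  by rewrite scaler0 add0r.
rewrite linearP; apply: (etrans (congr2 +%R (congr1 ( *:%R cc) e1) erefl)).
rewrite -[cc *: _]/(cc * _) /cc divfK ?subrK // mulf_neq0 //.
by rewrite gt_eqF.
Qed.

Lemma fol_co_legendrian : co_legendrian TM xi n fol TF.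
Proof.
split; [exact: fol_integrable|exact: fol_transverse|exact: leg_integrable].
Qed.

Lemma integrable_sub S S' k (D : E -> set E) : S' `<=` S ->
  integrable_dist TM S k D -> integrable_dist TM S' k D.
Proof.
move=> SS H l /SS Sl; have [W [h [oW Wl sm hW]]] := H l Sl.
by exists W, h; split=> // z Wz /SS; exact: hW.
Qed.

Lemma transverse_sub S S' (D D' : E -> set E) : S' `<=` S ->
  transverse_dist TM S D D' -> transverse_dist TM S' D D'.
Proof. by move=> SS H l /SS; exact: H. Qed.

(** For the Lie derivative use Cartan's formula: the form vanishes on fields
    u tangent to the Legendrian foliation, and its exterior derivative
    vanishes on pairs of vectors tangent to the leaf. *)
Lemma contact_lam_measure : transverse_measure (fol `&` ent) TF (capD TF xi) (contact_lam p a).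
Proof.
split.
  exists (hitting p a); last exact: contact_lam_one_form.
  by move=> l [_ /(enteringP p ha)[]].
move=> l [fl el]; have /(enteringP p ha)[Ml Ol] := el.
have sq : Num.sqrt (Phi (Q 0) l.1 l.2) != 0 by rewrite gt_eqF // sqrtr_gt0.
split.
- exists (reeb p a l); first exact: (reeb_TF ha fl el).
  by rewrite contact_lam_reeb // oner_eq0.
- move=> w; split.
    by move=> [Tw /xi_theta[_ th]]; split=> //; rewrite /contact_lam th mul0r.
  move=> [Tw /eqP]; rewrite mulf_eq0 invr_eq0 (negbTE sq) orbF => /eqP th.
  by split=> //; apply/xi_theta; split=> //; case/(tgF_discr ha _ fl): Tw.
- move=> W u Wl [oW smu] uG w Tw.
  have hu : has_diff u l w ('d u l w) by exact: (Ck_hasd w (smu 1%N) Wl).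
  have Tu : TF l (u l) by case: (uG l Wl (conj fl el)).
  have tu : theta p l (u l) = 0.
    by case: (uG l Wl (conj fl el)) => _ /xi_theta[].
  have TMw : TM l w by case/(tgF_discr ha _ fl): Tw.
  (* differentiating theta (u) = 0 along the leaf *)
  have ht : has_diff (fun z : E => theta p z (u z) : R^o) l w
      (bf s w.2 (u l).1 + theta p l ('d u l w)).
    by apply: has_diff_bfc; [exact: has_diff_l2|exact: (has_diff_fst hu)].
  have H : bf s w.2 (u l).1 + theta p l ('d u l w) = 0.
    apply: (M_const (c := 0) Ml TMw _ ht).
    have n1 := near_of_open oW Wl; have n2 := fol_open fl.
    have n3 := near_of_open (@open_hitting R n p a) Ol.
    near=> z => Mz.
    have Wz : W z by near: z.
    have fz : fol z by apply: (near n2 z) => //; near: z.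
    have Oz : hitting p a z by near: z.
    have Sz : (fol `&` ent) z by split=> //; apply/(enteringP p ha).
    by have [_ /xi_theta[]] := uG z Wz Sz.
  have [_ hl] := has_diff_contact_lam w (u l) Ol.
  rewrite /lie_d; apply: (etrans (congr2 +%R hl erefl)).
  have := TF_isotropic fl (adm0 p ha) (lt0r_neq0 Ol) Tu Tw.
  rewrite /= tu mulr0 subr0 /dtheta /contact_lam => iso.
  have -> : theta p l ('d u l w) = - bf s w.2 (u l).1 by apply/eqP; rewrite -addr_eq0 addrC H.
  rewrite -mulrDl (_ : _ + _ = 0) ?mul0r //.
  by move: iso; lra.
Unshelve. all: by end_near.
Qed.

Lemma contact_lam_ci : completely_integrable TM xi n (fol `&` ent) TF (contact_lam p a).
Proof.
split; last exact: contact_lam_measure.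
have [h1 h2 h3] := fol_co_legendrian.
have ss : fol `&` ent `<=` fol by move=> l [].
by split; [exact: integrable_sub h1|exact: transverse_sub h2|exact: integrable_sub h3].
Qed.

End Leaves.

(** * The billiard map *)

Section Billiard.
Variables (R : realType) (n p : nat) (a : 'I_n.+1 -> R).
Hypothesis ha : forall i, 0 < a i.
Local Notation m := n.+1.
Local Notation V := 'rV[R]_m.
Local Notation E := (V * V)%type.
Local Notation s := (@sgn R m p).
Local Notation b := (fun k => a k ^+ 2).
Local Notation Q := (qw s b).
Local Notation M := (@nullLines R m p).
Local Notation TM := (@tgNull R m p).
Local Notation xi := (@contactNull R m p).
Local Notation ent := (@entering R m p a).
Local Notation fol := (@foliated R m p a n.-1).
Local Notation TF := (@tgF R m p a n.-1).
Local Notation I1 := (fun=> (1 : R)).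
Local Notation T := (@billiard R m p a).
Local Notation y := (@exit_point R m a).
Local Notation P0 l := (Phi (Q 0) l.1 l.2).
Local Notation OE := (@hitting R n p a).
Implicit Types (l w z : E) (v : V).

Definition normal_vec v : V := wm s (wm (Q 0) v).
Definition normal_sq v : R := bf s (normal_vec v) (normal_vec v).
Definition eta v u : R := 2 * bf (Q 0) v u / normal_sq v.

Lemma bf_normal_vec v u : bf s (normal_vec v) u = bf (Q 0) v u.
Proof. by rewrite /normal_vec bfs_wml wm1. Qed.

Lemma normalE v : normal p a v = normal_vec v.
Proof. by rewrite /normal EmapE (@AmapE R n p a). Qed.

Lemma reflectE v u : Defs.reflect p a v u = u - eta v u *: normal_vec v.
Proof. by rewrite /Defs.reflect normalE !pdotE bf_normal_vec. Qed.

Definition tau l : R := (- bf (Q 0) l.1 l.2 + Num.sqrt (P0 l)) / bf (Q 0) l.2 l.2.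

Lemma exit_pointE l : y l = l.1 + tau l *: l.2.
Proof.
by case: l => x u; rewrite /exit_point /exit_time /tau !(@dot_Amap R n p a).
Qed.

(** The reflected velocity, before normalization. *)
Definition reflected l : V := l.2 - eta (y l) l.2 *: normal_vec (y l).
Definition rho l : R := (Num.sqrt (bf I1 (reflected l) (reflected l)))^-1.

Lemma billiardE l : T l = (y l - bf I1 (y l) (rho l *: reflected l) *: (rho l *: reflected l), rho l *: reflected l).
Proof. by rewrite /billiard /oline reflectE -/(reflected l) !dotE. Qed.

Definition reflecting : set E := [set l | OE l /\ normal_sq (y l) != 0].

Lemma OE_be l : OE l -> 0 < bf (Q 0) l.2 l.2.
Proof.
move=> Ol; apply: bf_ge0; first exact: Q0_gt0.
by apply/eqP => u0; move: Ol; rewrite /hitting /= /Phi u0 !bf0r expr0n /= mul0r subr0 ltxx.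
Qed.

Lemma y_on l : OE l -> bf (Q 0) (y l) (y l) = 1.
Proof.
move=> Ol; have be0 := OE_be Ol.
have be1 : bf (Q 0) l.2 l.2 != 0 by rewrite gt_eqF.
rewrite exit_pointE !bfE (bfC _ l.2 l.1) /tau.
have := sqr_sqrtr (ltW Ol); move: (Num.sqrt _) => q; rewrite /Phi => E'.
have -> : bf (Q 0) l.1 l.1 = (bf (Q 0) l.1 l.2 ^+ 2 - q ^+ 2) / bf (Q 0) l.2 l.2 + 1.
  by rewrite E'; field.
by field.
Qed.

Lemma y_dir l : OE l -> bf (Q 0) (y l) l.2 = Num.sqrt (P0 l).
Proof.
move=> Ol; have be0 := OE_be Ol.
have be1 : bf (Q 0) l.2 l.2 != 0 by rewrite gt_eqF.
by rewrite exit_pointE !bfE /tau; field.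
Qed.

(** The reflected line therefore enters the ellipsoid at y l. *)
Lemma y_reflected l : reflecting l -> bf (Q 0) (y l) (reflected l) = - Num.sqrt (P0 l).
Proof.
move=> [Ol n0]; rewrite /reflected bfDr bfNr bfZr -(y_dir Ol) -(bf_normal_vec (y l) (normal_vec (y l))) -/(normal_sq (y l)).
by rewrite /eta; field.
Qed.

Lemma reflected_neq0 l : reflecting l -> reflected l != 0.
Proof.
move=> Ol; apply/eqP => v0; have := y_reflected Ol; rewrite v0 bf0r => /eqP.
by rewrite eq_sym oppr_eq0 gt_eqF // sqrtr_gt0; case: Ol.
Qed.

Lemma reflected_sq_gt0 l : reflecting l -> 0 < bf I1 (reflected l) (reflected l).
Proof. by move=> Ol; apply: bf_ge0 => //; exact: reflected_neq0. Qed.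

Lemma rho_gt0 l : reflecting l -> 0 < rho l.
Proof. by move=> Ol; rewrite invr_gt0 sqrtr_gt0 reflected_sq_gt0. Qed.

Lemma reflected_pdot l : reflecting l -> bf s (reflected l) (reflected l) = bf s l.2 l.2.
Proof.
move=> [Ol n0]; rewrite /reflected !bfE (bfC s l.2 (normal_vec _)) !bf_normal_vec.
by rewrite -(bf_normal_vec (y l) (normal_vec (y l))) -/(normal_sq (y l)) /eta; field.
Qed.

(** At a point of the ellipsoid the discriminants of all the confocal
    quadrics are invariant under reflection, for every direction.  The
    resolvent identity with the ellipsoid expresses the products with the
    normal in terms of those with v. *)
Lemma Phi_reflect mu v u : adm s b mu -> bf (Q 0) v v = 1 -> normal_sq v != 0 ->
  Phi (Q mu) v (u - eta v u *: normal_vec v) = Phi (Q mu) v u.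
Proof.
move=> am v1 n0; have [->|mu0] := eqVneq mu 0.
  rewrite /Phi v1 subrr !mulr0 !subr0 !bfE -(bf_normal_vec v (normal_vec v)) -/(normal_sq v).
  by rewrite /eta; field.
have pen : forall k, s k * (Q mu k * Q 0 k) = (Q 0 k - Q mu k) / mu.
  move=> k; have a1 : a k != 0 by rewrite gt_eqF.
  by move: (am k); rewrite /qw mulr0 addr0 => h1; field; rewrite ?mu0 ?h1 ?a1.
have bn x : bf (Q mu) (normal_vec v) x = (bf (Q 0) v x - bf (Q mu) v x) / mu.
  rewrite /normal_vec /bf -sumrB mulr_suml; apply: eq_bigr => k _; rewrite !mxE.
  transitivity (s k * (Q mu k * Q 0 k) * (v 0 k * x 0 k)); first by ring.
  by rewrite (pen k); ring.
have nnE : normal_sq v = bf (Q 0) v (normal_vec v) by rewrite /normal_sq bf_normal_vec.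
rewrite /Phi !bfE (bfC (Q mu) u (normal_vec v)) (bfC (Q mu) v (normal_vec v)) !bn -nnE.
rewrite ?(bfC (Q mu) v (normal_vec v)) ?bn v1 /eta.
move: n0; move: (normal_sq v) => N n0.
rewrite (bfC (Q mu) v u).
by field; rewrite n0 mu0.
Qed.

(** Reflection preserves the discriminants, and normalizing the velocity
    multiplies them by rho l ^+ 2. *)
Lemma Phi_T mu l : adm s b mu -> reflecting l ->
  Phi (Q mu) (T l).1 (T l).2 = rho l ^+ 2 * Phi (Q mu) l.1 l.2.
Proof.
move=> am [Ol n0]; rewrite billiardE /= -scaleNr Phi_scale.
have E' (x u : V) t r : Phi (Q mu) (x + t *: (r *: u)) u = Phi (Q mu) x u.
  by rewrite scalerA Phi_shift.
rewrite E' /reflected Phi_reflect //; last exact: y_on.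
by rewrite exit_pointE Phi_shift.
Qed.

Lemma T_M l : reflecting l -> M l -> M (T l).
Proof.
move=> Ol /nullLinesP[u1 xu nu]; have r0 := rho_gt0 Ol.
have v2 : rho l * (rho l * bf I1 (reflected l) (reflected l)) = 1.
  have v0 := reflected_sq_gt0 Ol; have q0 : Num.sqrt (bf I1 (reflected l) (reflected l)) != 0.
    by rewrite gt_eqF // sqrtr_gt0.
  by rewrite /rho -[X in _ * (_ * X)](sqr_sqrtr (ltW v0)); field.
apply/nullLinesP; rewrite billiardE /=; split.
- by rewrite bfZl bfZr v2.
- by rewrite bfDl bfNl bfZl [X in _ - _ * X]bfZl [X in _ - _ * (_ * X)]bfZr v2 mulr1 subrr.
- by rewrite bfZl bfZr reflected_pdot // nu !mulr0.
Qed.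

Lemma T_OE l : reflecting l -> OE (T l).
Proof.
move=> Ol; rewrite /hitting /= Phi_T //; last exact: adm0.
by apply: mulr_gt0; [rewrite exprn_gt0 // rho_gt0|case: Ol].
Qed.

Lemma domE l : billiard_dom p a l <-> (M l /\ reflecting l).
Proof.
rewrite /billiard_dom /= normalE pdotE -/(normal_sq (y l)).
split=> [[/(enteringP p ha)[Ml Ol] n0]|[Ml [Ol n0]]]; first by [].
by split=> //; apply/(enteringP p ha).
Qed.

Definition reverse l : E := (l.1, - l.2).

(** The product with the conormal distinguishes the exit point from the
    entrance point. *)
Lemma exit_unique l v t : v = l.1 + t *: l.2 -> bf (Q 0) v v = 1 ->
  0 < bf (Q 0) v l.2 -> OE l /\ y l = v.
Proof.
move=> -> v1 v2.
have P0E : P0 l = bf (Q 0) (l.1 + t *: l.2) l.2 ^+ 2.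
  by rewrite -(Phi_shift _ _ _ t) /Phi v1 subrr mulr0 subr0.
have Ol : OE l by rewrite /hitting /= P0E exprn_gt0.
split=> //; rewrite exit_pointE; congr (_ + _ *: _).
have be1 : bf (Q 0) l.2 l.2 != 0 by rewrite gt_eqF // OE_be.
rewrite /tau P0E sqrtr_sqr gtr0_norm // !bfE; field.
exact: be1.
Qed.

(** Reversing the direction conjugates the billiard map to its inverse: the
    reversed outgoing line leaves the ellipsoid at the same point, where it
    is reflected to the reversed incoming line. *)
Lemma T_reverse l : M l -> reflecting l -> [/\ M (reverse (T l)), reflecting (reverse (T l)) & T (reverse (T l)) = reverse l].
Proof.
move=> Ml Ol; have [OEl n0] := Ol; have r0 := rho_gt0 Ol.
have sM z : M z -> M (reverse z).
  by move=> /nullLinesP[h1 h2 h3]; apply/nullLinesP; rewrite /= !bfE h1 h2 h3 !opprK oppr0.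
have [OEs ys] : OE (reverse (T l)) /\ y (reverse (T l)) = y l.
  apply: (@exit_unique _ _ (- bf I1 (y l) (rho l *: reflected l))).
  - by rewrite /reverse billiardE /= scaleNr scalerN opprK subrK.
  - exact: y_on.
  - rewrite /reverse billiardE /= bfNr bfZr y_reflected // mulrN opprK mulr_gt0 // sqrtr_gt0.
    exact: OEl.
have OBs : reflecting (reverse (T l)) by split; rewrite ?ys.
split; [exact/sM/T_M|exact: OBs|].
have q0 : Num.sqrt (P0 l) != 0 by rewrite gt_eqF // sqrtr_gt0.
have vrs : reflected (reverse (T l)) = - (rho l *: l.2).
  rewrite /reflected ys {1 2}/reverse billiardE /=.
  have -> : eta (y l) (- (rho l *: reflected l)) = rho l * eta (y l) l.2.
    by rewrite /eta bfNr bfZr y_reflected // y_dir //; field.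
  rewrite /reflected scalerBr scalerA opprB addrAC subrr add0r //.
have [u1 xu nu] : [/\ bf I1 l.2 l.2 = 1, bf I1 l.1 l.2 = 0 & bf s l.2 l.2 = 0] by apply/nullLinesP.
have rhos : rho (reverse (T l)) = (rho l)^-1.
  have r2 : bf I1 (- (rho l *: l.2)) (- (rho l *: l.2)) = rho l ^+ 2.
    by rewrite bfNl bfNr bfZl bfZr u1; ring.
  by rewrite {1}/rho vrs r2 sqrtr_sqr gtr0_norm.
have e : rho (reverse (T l)) *: reflected (reverse (T l)) = - l.2.
  by rewrite vrs rhos scalerN scalerA mulVf ?scale1r // gt_eqF.
rewrite [LHS]billiardE e ys /reverse; congr (_, _).
rewrite bfNr scaleNr scalerN opprK exit_pointE !bfE xu u1 add0r mulr1.
by rewrite addrK.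
Qed.

Section TSmooth.
Variable q : nat.

Let c1 (W : set E) : open W -> Ck q W (fun l : E => l.1).
Proof. by move=> oW; apply: Ck_fst => //; exact: Ck_id. Qed.
Let c2 (W : set E) : open W -> Ck q W (fun l : E => l.2).
Proof. by move=> oW; apply: Ck_snd => //; exact: Ck_id. Qed.

Lemma tau_Ck : Ck q OE (tau : E -> R^o).
Proof.
have o := @open_hitting R n p a.
apply: (Ck_mul o); last first.
  apply: (Ck_inv o); first by move=> l /OE_be h; rewrite gt_eqF.
  by apply: (Ck_bfc o); exact: c2.
apply: (Ck_add o); first by apply: (Ck_opp o); apply: (Ck_bfc o); [exact: c1|exact: c2].
by apply: (Ck_sqrt o) => //; exact: P0_Ck.
Qed.

Lemma y_Ck : Ck q OE (y : E -> V).
Proof.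
have o := @open_hitting R n p a.
apply: (@Ck_ext _ _ _ _ _ (fun l => l.1 + tau l *: l.2)) => //.
  by move=> l _; rewrite exit_pointE.
apply: (Ck_add o); first exact: c1.
by apply: (Ck_scalev o); [exact: tau_Ck|exact: c2].
Qed.

Lemma normal_sq_Ck : Ck q OE (fun l => normal_sq (y l) : R^o).
Proof.
have o := @open_hitting R n p a.
by apply: (Ck_bfc o); do 2 apply: (Ck_wm o); exact: y_Ck.
Qed.

End TSmooth.

Lemma open_reflecting : open reflecting.
Proof.
apply: open_near => l [Ol n0].
have h1 := near_of_open (@open_hitting R n p a) Ol.
have h2 := Ck_near_neq (normal_sq_Ck 0) Ol n0.
by move: h1 h2; apply: filterS2.
Qed.

Section TSmooth2.
Variable q : nat.

Let sub (F : normedModType R) (f : E -> F) : Ck q OE f -> Ck q reflecting f.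
Proof. by apply: Ck_sub => l []. Qed.

Lemma reflected_Ck : Ck q reflecting (reflected : E -> V).
Proof.
have o := open_reflecting.
have cy : Ck q reflecting (y : E -> V) by apply: sub; exact: y_Ck.
have cu : Ck q reflecting (fun l : E => l.2) by apply: (Ck_snd o); exact: Ck_id.
apply: (Ck_subr o); first exact: cu.
apply: (Ck_scalev o); last by do 2 apply: (Ck_wm o); exact: cy.
apply: (Ck_mul o).
  by apply: (Ck_mul o (Ck_cst q (2 : R^o) o)); exact: (Ck_bfc o).
by apply: (Ck_inv o); [by move=> l []|apply: sub; exact: normal_sq_Ck].
Qed.

Lemma rho_Ck : Ck q reflecting (rho : E -> R^o).
Proof.
have o := open_reflecting.
apply: (Ck_inv o); first by move=> l Ol; rewrite gt_eqF // sqrtr_gt0 reflected_sq_gt0.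
apply: (Ck_sqrt o); first by move=> l Ol; exact: reflected_sq_gt0.
by apply: (Ck_bfc o); exact: reflected_Ck.
Qed.

Lemma T_Ck : Ck q reflecting T.
Proof.
have o := open_reflecting.
have cy : Ck q reflecting (y : E -> V) by apply: sub; exact: y_Ck.
have cv : Ck q reflecting (fun l => rho l *: reflected l) by apply: (Ck_scalev o); [exact: rho_Ck|exact: reflected_Ck].
apply: (@Ck_ext _ _ _ _ _ (fun l => (y l - bf I1 (y l) (rho l *: reflected l) *: (rho l *: reflected l),
  rho l *: reflected l))) => //; first by move=> l _; rewrite billiardE.
apply: (Ck_pair o) => //.
apply: (Ck_subr o) => //.
by apply: (Ck_scalev o) => //; exact: (Ck_bfc o).
Qed.

End TSmooth2.

Section Tangent.
Variables (l w : E).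
Hypotheses (Ml : M l) (Ol : reflecting l) (Tw : TM l w).

Local Notation dT := ('d T l w).

Let hT : has_diff T l w dT.
Proof. exact: (Ck_hasd w (T_Ck 1) Ol). Qed.

Let on_OB (F : normedModType R) (f g : E -> F) d e : (forall z, reflecting z -> f z = g z) ->
  has_diff f l w d -> has_diff g l w e -> d = e.
Proof.
move=> fg hf hg; apply: (has_diff_fun _ hg); apply: has_diff_near hf.
by apply: near_open open_reflecting _ _ Ol.
Qed.

Let hrho : has_diff (rho : E -> R^o) l w ('d (rho : E -> R^o) l w).
Proof. exact: (Ck_hasd w (rho_Ck 1) Ol). Qed.

Lemma T_lsq z : reflecting z -> bf I1 (T z).2 (T z).2 = 1.
Proof.
move=> Oz; rewrite billiardE /= bfZl bfZr.
have v0 := reflected_sq_gt0 Oz; have q0 : Num.sqrt (bf I1 (reflected z) (reflected z)) != 0.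
  by rewrite gt_eqF // sqrtr_gt0.
by rewrite /rho -[X in _ * (_ * X)](sqr_sqrtr (ltW v0)); field.
Qed.

Lemma T_perp z : reflecting z -> bf I1 (T z).1 (T z).2 = 0.
Proof.
move=> Oz; have := T_lsq Oz; rewrite billiardE /= => h.
by rewrite bfDl bfNl bfZl h mulr1 subrr.
Qed.

Lemma T_null z : reflecting z -> bf s (T z).2 (T z).2 = rho z ^+ 2 * bf s z.2 z.2.
Proof. by move=> Oz; rewrite billiardE /= bfZl bfZr reflected_pdot //; ring. Qed.

(** The three equations of M hold along T, the first two identically and the
    third up to the factor rho ^+ 2. *)
Lemma dT_TM : TM (T l) dT.
Proof.
have [_ _ nu] : [/\ True, True & bf s l.2 l.2 = 0] by case/nullLinesP: Ml.
have /tgNullP[_ _ t3] := Tw.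
have e1 := on_OB T_lsq (has_diff_bfc I1 (has_diff_snd hT) (has_diff_snd hT)) (has_diff_cst (1 : R^o) l w).
have e2 := on_OB T_perp (has_diff_bfc I1 (has_diff_fst hT) (has_diff_snd hT)) (has_diff_cst (0 : R^o) l w).
have e3 := on_OB T_null (has_diff_bfc s (has_diff_snd hT) (has_diff_snd hT))
  (has_diff_mul (has_diff_sqr hrho) (has_diff_bfc s (has_diff_l2 l w) (has_diff_l2 l w))).
rewrite (bfC s w.2) t3 nu addr0 !mulr0 addr0 (bfC s (dT).2) in e3.
rewrite (bfC I1 (dT).2) in e1.
by apply/tgNullP; split; [lra|exact: e2|lra].
Qed.

(** Moving the base point along the null line does not change theta, and the
    displacement of the exit point is orthogonal to the conormal, so that it
    has the same product with the incoming and with the reflected velocity. *)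
Lemma dT_theta : theta p (T l) dT = rho l * theta p l w.
Proof.
have [OEl n0] := Ol.
have [_ _ nu] : [/\ True, True & bf s l.2 l.2 = 0] by case/nullLinesP: Ml.
have /tgNullP[_ _ t3] := Tw.
have hy : has_diff (y : E -> V) l w ('d y l w) by exact: (Ck_hasd w (y_Ck 1) OEl).
have htau := Ck_hasd w (tau_Ck 1) OEl.
have dyE : 'd y l w = w.1 + ('d (tau : E -> R^o) l w *: l.2 + tau l *: w.2).
  apply: (has_diff_fun hy); rewrite (_ : y = fun l => l.1 + tau l *: l.2); last first.
    by apply/funext => z; rewrite exit_pointE.
  by apply: has_diff_add; [exact: has_diff_l1|apply: has_diff_scalev; [exact: htau|exact: has_diff_l2]].
have Ady : bf (Q 0) (y l) ('d y l w) = 0.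
  have h1 : \near l, bf (Q 0) (y l) (y l) = 1.
    by apply: near_open (@open_hitting R n p a) _ _ OEl => z; exact: y_on.
  have := has_diff_fun (has_diff_near h1 (has_diff_bfc (Q 0) hy hy)) (has_diff_cst (1 : R^o) l w).
  by rewrite (bfC _ ('d y l w)); lra.
have udy : bf s l.2 ('d y l w) = theta p l w.
  by rewrite dyE !bfE nu t3 !mulr0 !addr0.
have vdy : bf s (reflected l) ('d y l w) = theta p l w.
  by rewrite /reflected !bfE bf_normal_vec Ady mulr0 subr0.
have T2s : bf s (T l).2 (T l).2 = 0 by rewrite T_null // nu mulr0.
have dT2 : bf s (T l).2 (dT).2 = 0 by have /tgNullP[] := dT_TM.
have dT1 : (dT).1 = 'd y l w - ((bf I1 ('d y l w) (T l).2 + bf I1 (y l) (dT).2) *: (T l).2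
    + bf I1 (y l) (T l).2 *: (dT).2).
  apply: (on_OB (f := fun z => (T z).1) (g := fun z => y z - bf I1 (y z) (T z).2 *: (T z).2)).
  - by move=> z Oz; rewrite billiardE.
  - exact: has_diff_fst.
  - apply: has_diff_sub => //; apply: has_diff_scalev; last exact: has_diff_snd.
    by apply: has_diff_bfc; [exact: hy|exact: has_diff_snd].
have lin (v x z z' : V) c d : bf s v (x - (c *: z + d *: z')) =
    bf s v x - (c * bf s v z + d * bf s v z') by rewrite bfDr bfNr bfDr !bfZr.
rewrite /theta dT1 lin T2s dT2 !mulr0 addr0 subr0.
by rewrite billiardE /= bfZl vdy.
Qed.

Lemma dT_Phi mu : adm s b mu ->
  dPhi (Q mu) (T l) dT = 2 * rho l * 'd (rho : E -> R^o) l w * Phi (Q mu) l.1 l.2 +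
    rho l ^+ 2 * dPhi (Q mu) l w.
Proof.
move=> am.
have e := on_OB (fun z Oz => Phi_T am Oz) (has_diff_comp hT (has_diff_Phil (Q mu) (T l) dT))
  (has_diff_mul (has_diff_sqr hrho) (has_diff_Phil (Q mu) l w)).
by apply: (etrans e); rewrite addrC; congr (_ + _).
Qed.

End Tangent.

(** Both theta and the square root of the discriminant are multiplied by rho
    l. *)
Lemma T_lam l w : M l -> reflecting l -> TM l w -> contact_lam p a (T l) ('d T l w) = contact_lam p a l w.
Proof.
move=> Ml Ol Tw; rewrite /contact_lam dT_theta // Phi_T //; last exact: adm0.
have r0 := rho_gt0 Ol; have [OEl _] := Ol.
rewrite sqrtrM ?exprn_ge0 ?ltW // sqrtr_sqr gtr0_norm //.
have q0 : Num.sqrt (P0 l) != 0 by rewrite gt_eqF // sqrtr_gt0.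
by field; rewrite q0 gt_eqF.
Qed.

Lemma T_contactomorphism : contactomorphism M TM xi (billiard_dom p a) T.
Proof.
have domEq : billiard_dom p a = M `&` reflecting.
  by apply/seteqP; split=> l; rewrite /setI /=; [move/domE|move=> H; apply/domE].
have ls : linear (reverse : E -> E).
  by move=> c u v; congr (_, _); rewrite /= ?scalerN ?opprD ?scalerN.
have cs : continuous reverse.
  move=> l; apply: differentiable_continuous.
  have [] // : has_diff reverse l 0 ((0 : E).1, - (0 : E).2).
  by apply: has_diff_pair; [exact: has_diff_l1|apply: has_diff_opp; exact: has_diff_l2].
have sK l : reverse (reverse l) = l by rewrite /reverse /= opprK; case: l.
split; [|split].
- exists reflecting => //; split; first exact: open_reflecting.
  by move=> q; exact: T_Ck.
- have oW : open (reverse @^-1` reflecting).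
    by apply: (@open_comp E E reverse reflecting); [move=> l _; exact: cs|exact: open_reflecting].
  exists (reverse @^-1` reflecting), (fun l => reverse (T (reverse l))); split.
  + rewrite domEq; apply/seteqP; split.
      move=> _ [l [Ml Ol] <-]; have [h1 h2 h3] := T_reverse Ml Ol.
      by split; [exact: T_M|exact: h2].
    move=> l' [Ml' Ol']; have Ms : M (reverse l').
      by move/nullLinesP: Ml' => [h1 h2 h3]; apply/nullLinesP; rewrite /= !bfE h1 h2 h3 !opprK oppr0.
    have [h1 h2 h3] := T_reverse Ms Ol'.
    by exists (reverse (T (reverse l'))) => //; rewrite h3 sK.
  + split=> // q.
    apply: (@Ck_post R E E E q _ (fun l => T (reverse l)) reverse oW ls cs).
    exact: (@Ck_pre R E E E q reflecting _ T reverse oW (fun x Ox => Ox) ls cs (T_Ck q)).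
  + move=> l; rewrite domEq => -[Ml Ol].
    by have [_ _ ->] := T_reverse Ml Ol; rewrite sK.
- move=> l; rewrite domEq => -[Ml Ol] w Tw; split; first exact: dT_TM.
  rewrite !xi_theta dT_theta //; have r0 := rho_gt0 Ol.
  have T' := dT_TM Ml Ol Tw.
  split=> [[_ ->]|[_ /eqP]]; first by rewrite mulr0.
  by rewrite mulf_eq0 gt_eqF //= => /eqP.
Qed.

Lemma T_leaf L : leavesF p a n.-1 L -> forall l, L l -> billiard_dom p a l ->
  fol (T l) -> L (T l).
Proof.
move=> [c _ ->] l [fl tl] /domE[Ml Ol] fT; split=> // i.
have /(fol_tanE ha _ fl)[ai Pi] := tl i.
by apply/(fol_tanE ha _ fT); split=> //; rewrite Phi_T // Pi mulr0.
Qed.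

Lemma T_TF l w : billiard_dom p a l -> fol l -> fol (T l) -> TF l w -> TF (T l) ('d T l w).
Proof.
move=> /domE[Ml Ol] fl fT /(tgF_discr ha _ fl)[Tw H]; apply/(tgF_discr ha _ fT).
split; first exact: dT_TM.
move=> c ac; rewrite Phi_T // => /eqP.
rewrite mulf_eq0 sqrf_eq0 gt_eqF ?rho_gt0 //= => /eqP Pc.
by rewrite dT_Phi // Pc mulr0 add0r (H c ac Pc) mulr0.
Qed.

End Billiard.

(** * Complete integrability *)

Unset Implicit Arguments.

Theorem mainTheorem7 (R : realType) (p q n : nat) (a : 'I_n.+1 -> R)
    (hpq : (p + q = n.+1)%N) (ha : forall i, 0 < a i) :
  let M0 := @nullLines R n.+1 p in
  let TM := @tgNull R n.+1 p in
  let xi := @contactNull R n.+1 p in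
  let T := billiard p a in
  let domT := billiard_dom p a in
  let TF := tgF p a n.-1 in
  co_legendrian TM xi n (foliated p a n.-1) TF /\
  exists lambda : 'rV[R]_n.+1 * 'rV[R]_n.+1 -> 'rV[R]_n.+1 * 'rV[R]_n.+1 -> R,
  exists reeb : 'rV[R]_n.+1 * 'rV[R]_n.+1 -> 'rV[R]_n.+1 * 'rV[R]_n.+1,
    [/\ contact_form TM xi (entering p a) lambda,
        (forall l, domT l -> entering p a (T l)) /\
          preserves_form TM domT T lambda,
        reeb_field TM (entering p a) lambda reeb /\
          (forall l, (foliated p a n.-1 `&` entering p a) l ->
             TF l (reeb l)) &
        contact_ci_system M0 TM xi n domT T
          (foliated p a n.-1 `&` entering p a)
          (leavesF p a n.-1) TF lambda].
Proof.
move=> M0 TM xi T domT TF; split; first exact: fol_co_legendrian.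
exists (contact_lam p a), (reeb p a); split.
- exact: contact_lam_contact_form.
- split=> [l /(domE p ha)[Ml Ol]|l /(domE p ha)[Ml Ol] w Tw]; last exact: T_lam.
  by apply/(enteringP p ha); split; [exact: T_M|exact: T_OE].
- by split; [exact: reeb_lam|move=> l [fl el]; exact: reeb_TF].
- split.
  + exact: T_contactomorphism.
  + exact: contact_lam_ci.
  + by move=> L leafL l Ll Ul _ [fT _]; exact: (T_leaf ha leafL Ll Ul fT).
  + move=> l Ul [fl _] [fT _] w Tw; split; first exact: T_TF.
    have /(domE p ha)[Ml Ol] := Ul.
    by apply: T_lam => //; case/(tgF_discr ha _ fl): Tw.
Qed.
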